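(* For any $\frac12>\varepsilon_1,\varepsilon_2>0$ (and any rate $\rho\in(0,1-\varepsilon_1)$), there is an infinite family of codes $\mathcal{C}$ of blocklength $n$ with the following properties: (i) the rate of the code is $\rho$ and its distance is at least $1-\rho-\varepsilon_1$; (ii) the code is over an alphabet of size $Q=2^{O(\varepsilon_1^{-6}\log(1/\varepsilon_1))}$; (iii) the code can be list decoded from radius $\mathcal{J}_Q(1-\rho-\varepsilon_1)-\varepsilon_2$ in time $n^{O_{\varepsilon_1}(1/\varepsilon_2^4)}$, i.e. given any received word, all codewords at distance less than $\mathcal{J}_Q(1-\rho-\varepsilon_1)-\varepsilon_2$ from it are output within that time.
   Context: For a code $\mathcal{C}\subseteq[Q]^n$, the rate is $\log_Q|\mathcal{C}|/n$ and the distance is the minimum fractional Hamming distance $\Delta(f,g)=\Pr_i[f_i\ne g_i]$ between distinct codewords. $\mathcal{J}_Q(\delta)=(1-\frac1Q)(1-\sqrt{1-\frac{Q\delta}{Q-1}})$ is the $Q$-ary Johnson bound. $O_{\varepsilon_1}(\cdot)$ hides constants depending only on $\varepsilon_1$.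
   Formalization: ''The rate of the code is ρ'' is proved exactly for rational ρ; for irrational ρ, where equality can be impossible (e.g. ρ = 1/√2), the rates are at least ρ and converge to ρ along the family. *)

(* Defs.v *)
From HB Require Import structures.
From mathcomp Require Import all_boot all_order all_algebra.
From mathcomp Require Import all_classical all_reals all_analysis.

Set Implicit Arguments.
Unset Strict Implicit.
Unset Printing Implicit Defensive.

Import Order.TTheory GRing.Theory Num.Theory.
Import numFieldNormedType.Exports.

Local Open Scope classical_set_scope.
Local Open Scope ring_scope.

Section Codes.
Variables (R : realType) (Q n : nat).
Implicit Types (f g : n.-tuple 'I_Q) (C : {set n.-tuple 'I_Q}).

Definition hamming f g : R :=
  #|[set i : 'I_n | tnth f i != tnth g i]%SET|%:R / n%:R.

(* The default value 1, the largest fractional distance, is only seen by codes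
   with fewer than two codewords. *)
Definition distance C : R :=
  \big[Num.min/1]_(p : n.-tuple 'I_Q * n.-tuple 'I_Q
                     | [&& p.1 \in C, p.2 \in C & p.1 != p.2])
    hamming p.1 p.2.

Definition rate C : R := ln #|C|%:R / ln Q%:R / n%:R.

End Codes.

Definition johnson (R : realType) (Q : nat) (delta : R) : R :=
  (1 - 1 / Q%:R) * (1 - Num.sqrt (1 - Q%:R * delta / (Q%:R - 1))).

(* Q ^ (rho n) need not be an integer, so for fixed Q only countably many reals
   are the rate of some code.  "Rate rho" therefore means equality for every
   member of the family when rho is rational; for any real rho it means that
   the rates are at least rho and converge to rho. *)
Definition has_rate (R : realType) (Q : nat) (N : nat -> nat)
    (C : forall i, {set (N i).-tuple 'I_Q}) (rho : R) : Prop :=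
  [/\ forall i, rho <= rate R (C i),
      (fun i => rate R (C i)) @ \oo --> rho
    & (exists q : rat, rho = ratr q) -> forall i, rate R (C i) = rho].

Inductive move := MoveLeft | MoveStay | MoveRight.

(* The blank is None; Some (inl a) is the letter a of the code alphabet, and
   Some (inr b) an auxiliary symbol. *)
Definition symbol (Q : nat) (aux : finType) : Type := option ('I_Q + aux)%type.

(* Deterministic Turing machine with extra_tapes.+1 tapes, infinite to the right
   only.  It halts when trans returns None. *)
Record machine (Q : nat) := Machine {
  extra_tapes : nat;
  state : finType;
  aux : finType;
  start : state;
  trans : state -> {ffun 'I_extra_tapes.+1 -> symbol Q aux} ->
    option (state * {ffun 'I_extra_tapes.+1 -> symbol Q aux * move}) }.

Section Machines.
Variables (Q : nat) (M : machine Q).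

Notation tape := 'I_(extra_tapes M).+1.
Notation sym := (symbol Q (aux M)).

Record config := Config {
  cstate : state M;
  chead : tape -> nat;
  ccell : tape -> nat -> sym }.

Definition action (c : config) : option (state M * {ffun tape -> sym * move}) :=
  trans (cstate c) [ffun j => ccell c j (chead c j)].

Definition halted (c : config) : Prop := action c = None.

Definition shift (m : move) (h : nat) : nat :=
  match m with MoveLeft => h.-1 | MoveStay => h | MoveRight => h.+1 end.

Definition step (c : config) : config :=
  if action c is Some (q, a) then
    Config q (fun j => shift (a j).2 (chead c j))
      (fun j h => if h == chead c j then (a j).1 else ccell c j h)
  else c.

Definition written (s : seq 'I_Q) : nat -> sym :=
  nth None [seq Some (inl a) | a <- s].

Definition init (s : seq 'I_Q) : config :=
  Config (start M) (fun=> 0%N)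
    (fun j => if j == ord0 then written s else written [::]).

(* Input on the first tape, output on the last one.  The words of the output
   list L are concatenated without separators, all of them having length n. *)
Definition outputs_in (n : nat) (g : n.-tuple 'I_Q) (t : nat)
    (L : seq (n.-tuple 'I_Q)) : Prop :=
  let c := iter t step (init g) in
  halted c /\ ccell c ord_max =1 written (flatten [seq tval w | w <- L]).

End Machines.

(* A single machine serves the whole family: its states, symbols and transitions
   do not depend on i.  (A machine chosen for each i could hold a lookup table.)
   The list may contain words other than the codewords required of it; its length
   is limited by the time bound. *)
Definition list_decodes (R : realType) (Q : nat) (M : machine Q)
    (N : nat -> nat) (C : forall i, {set (N i).-tuple 'I_Q})
    (radius : R) (time : nat -> R) : Prop :=
  forall (i : nat) (g : (N i).-tuple 'I_Q),
    exists (t : nat) (L : seq ((N i).-tuple 'I_Q)),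
      [/\ t%:R <= time (N i),
          outputs_in M g t L
        & forall f, f \in C i -> hamming R f g < radius -> f \in L].

(* Main.v *)
(* By convexity [johnson Q delta <= delta], so it suffices to decode from radius
   delta = 1 - rho - eps1, that is, up to capacity, with lists of polynomial length.
   The distance then comes for free: a ball of radius delta around a codeword holds
   polynomially many codewords, so a greedy choice keeps all but a polynomial
   factor of the code at pairwise distance delta, and a subset of a code is decoded by
   the same algorithm.

   The code is a folded Reed-Solomon code whose symbols are encoded by an inner code
   and spread over the blocks by a graph of constant right degree (Alon, Edmonds
   and Luby), which makes the alphabet depend on eps1 only.  A received word that
   agrees with a codeword on a fraction rho + eps1 of the blocks agrees with almost
   every inner word on nearly that fraction of its letters, and each inner word is
   recovered up to a list of constant length.  The outer code is list recovered by
   linear algebra (Guruswami and Wang): interpolation gives polynomials A_j with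
   sum_j A_j(X) f(gamma^j X) = 0 for every message f whose codeword is close, and this
   equation determines the coefficients of f one after the other, all but s - 1 of
   them uniquely.

   Graph and inner code come from short seeds and exist by counting.  The machine
   tries all polynomially many values of the seeds, the primes and the other data,
   hence needs no way to find the right ones. *)

Require Import Defs.
From mathcomp Require Import all_boot all_order all_algebra.
From mathcomp Require Import all_classical all_reals all_analysis.
From mathcomp Require Import cyclic finfield.
From mathcomp Require Import zify ring lra.

Set Implicit Arguments.
Unset Strict Implicit.
Unset Printing Implicit Defensive.

Import Order.TTheory GRing.Theory Num.Theory.
Import numFieldNormedType.Exports.

(** * Stack programs for Turing machines *)

(** The time bound concerns an actual Turing machine, so the decoder is written as a function on
    lists of unary numbers. This costs only a polynomial factor, since all its data, including an
    outer symbol or a seed read as one number, are polynomial in the block length. A wrong guess,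
    however, satisfies none of the inequalities that keep numbers small. Values that could grow are
    therefore cut off by [minn], [take] or a modulus, and completeness includes a proof that for the
    right guess nothing is lost.

    One parameter z, a power of two between 10 / eps1 and 20 / eps1, fixes all constants. Of the
    agreement rho + 10 / z that is demanded, up to 6 / z goes into the rates of the two codes and
    into rounding, 3 / z into list decoding the inner code and 1 / z into the graph. The alphabet
    has size 2 ^ (8 z ^ 4).

    The delicate point is the seed of the graph. It must have O(log n) bits, although of the order
    of log n shifts of log n bits each are needed. They are overlapping windows of a single bit
    string, whose signs are shown to be as good as independent. *)

Section StackPrograms.
Variable Q : nat.
Local Open Scope nat_scope.

Notation sym := (symbol Q (option bool)).
Notation tape := 'I_6.
Notation reads := {ffun tape -> sym}.
Notation acts := {ffun tape -> sym * move}.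

Record tapes := Tapes { heads : tape -> nat; cells : tape -> nat -> sym }.

(** Alphabet and tapes are fixed, so that fragments compose through their states alone; [None] is
    the exit at which another fragment can take over. *)
Record fragment := Fragment {
  fstate : finType;
  fentry : fstate;
  ftrans : fstate -> reads -> option (fstate * acts) }.

Definition read (tp : tapes) : reads := [ffun j => cells tp j (heads tp j)].

Definition perform (a : acts) (tp : tapes) : tapes :=
  Tapes (fun j => Defs.shift (a j).2 (heads tp j))
        (fun j h => if h == heads tp j then (a j).1 else cells tp j h).

Inductive exec (f : fragment) : fstate f -> tapes -> nat -> tapes -> Prop :=
| ExecHalt q tp : ftrans q (read tp) = None -> exec q tp 0 tp
| ExecStep q tp q' a t tp' : ftrans q (read tp) = Some (q', a) ->
    exec q' (perform a tp) t tp' -> exec q tp t.+1 tp'.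

Definition idle (r : reads) : acts := [ffun j => (r j, MoveStay)].

Lemma perform_idle tp : perform (idle (read tp)) tp = tp.
Proof.
case: tp => hd ce; rewrite /perform; congr Tapes; apply/funext => j.
  by rewrite /idle !ffunE.
by apply/funext => h; rewrite /idle !ffunE /=; case: eqP => // ->.
Qed.

(** The exit of [f] becomes an idle step into [g], which is the successor in the running time of a
    sequence. *)
Definition fseq (f g : fragment) : fragment :=
  @Fragment (fstate f + fstate g)%type (inl (fentry f)) (fun q r =>
    match q with
    | inl p => if ftrans p r is Some (p', a) then Some (inl p', a)
               else Some (inr (fentry g), idle r)
    | inr p => if ftrans p r is Some (p', a) then Some (inr p', a) else None
    end).

Lemma exec_seqr f g q tp t tp' :
  @exec g q tp t tp' -> @exec (fseq f g) (inr q) tp t tp'.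
Proof.
elim=> {q tp t tp'} [q tp h|q tp q' a t tp' h _ IH].
  by apply: ExecHalt => /=; rewrite h.
by apply: ExecStep IH => /=; rewrite h.
Qed.

Lemma exec_seq f g q tp t tp' t' tp'' :
  @exec f q tp t tp' -> @exec g (fentry g) tp' t' tp'' ->
  @exec (fseq f g) (inl q) tp (t + t'.+1) tp''.
Proof.
move=> ef; elim: ef => {q tp t tp'} [q tp h|q tp q' a t tp1 h _ IH] eg.
  rewrite add0n; apply: (@ExecStep (fseq f g) _ _ (inr (fentry g)) (idle (read tp))) => /=.
    by rewrite h.
  rewrite perform_idle; exact: exec_seqr.
by rewrite addSn; apply: ExecStep (IH eg) => /=; rewrite h.
Qed.

Definition fif (c : reads -> bool) (f g : fragment) : fragment :=
  @Fragment (option (fstate f + fstate g)) None (fun q r =>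
    match q with
    | None => Some (Some (if c r then inl (fentry f) else inr (fentry g)), idle r)
    | Some (inl p) => if ftrans p r is Some (p', a) then Some (Some (inl p'), a)
                      else None
    | Some (inr p) => if ftrans p r is Some (p', a) then Some (Some (inr p'), a)
                      else None
    end).

Lemma exec_if_true (c : reads -> bool) f g tp t tp' : c (read tp) ->
  @exec f (fentry f) tp t tp' -> @exec (fif c f g) None tp t.+1 tp'.
Proof.
move=> hc ef; apply: (@ExecStep (fif c f g) _ _ (Some (inl (fentry f))) (idle (read tp))).
  by rewrite /= hc.
rewrite perform_idle; elim: ef => {hc tp t tp'} [q tp h|q tp q' a t tp' h _ IH].
  by apply: ExecHalt => /=; rewrite h.
by apply: ExecStep IH => /=; rewrite h.
Qed.

Lemma exec_if_false (c : reads -> bool) f g tp t tp' : ~~ c (read tp) ->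
  @exec g (fentry g) tp t tp' -> @exec (fif c f g) None tp t.+1 tp'.
Proof.
move=> hc ef; apply: (@ExecStep (fif c f g) _ _ (Some (inr (fentry g))) (idle (read tp))).
  by rewrite /= (negbTE hc).
rewrite perform_idle; elim: ef => {hc tp t tp'} [q tp h|q tp q' a t tp' h _ IH].
  by apply: ExecHalt => /=; rewrite h.
by apply: ExecStep IH => /=; rewrite h.
Qed.

Definition fwhile (c : reads -> bool) (f : fragment) : fragment :=
  @Fragment (option (fstate f)) None (fun q r =>
    match q with
    | None => if c r then Some (Some (fentry f), idle r) else None
    | Some p => if ftrans p r is Some (p', a) then Some (Some p', a)
                else Some (None, idle r)
    end).

Lemma exec_while_false (c : reads -> bool) f tp : ~~ c (read tp) -> @exec (fwhile c f) None tp 0 tp.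
Proof. by move=> hc; apply: ExecHalt => /=; rewrite (negbTE hc). Qed.

Lemma exec_while_true (c : reads -> bool) f tp t tp' t' tp'' : c (read tp) ->
  @exec f (fentry f) tp t tp' -> @exec (fwhile c f) None tp' t' tp'' ->
  @exec (fwhile c f) None tp (t + t'.+1).+1 tp''.
Proof.
move=> hc ef ew; apply: (@ExecStep (fwhile c f) _ _ (Some (fentry f)) (idle (read tp))).
  by rewrite /= hc.
rewrite perform_idle; elim: ef ew => {hc tp t tp'} [q tp h|q tp q' a t tp' h _ IH] ew.
  rewrite add0n; apply: (@ExecStep (fwhile c f) _ _ None (idle (read tp))); first by rewrite /= h.
  by rewrite perform_idle.
by rewrite addSn; apply: ExecStep (IH ew) => /=; rewrite h.
Qed.

(* [SI] is the unread input, the other stacks are scratch memory. *)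
Inductive stack := SI | SD | SA | SB | SC.

Definition stack_index (x : stack) : nat :=
  match x with SI => 0 | SD => 1 | SA => 2 | SB => 3 | SC => 4 end.

Definition stack_tape (x : stack) : tape := inord (stack_index x).

Lemma stack_tapeE x : stack_tape x = stack_index x :> nat.
Proof. by rewrite inordK //; case: x. Qed.

Lemma stack_tape_inj : injective stack_tape.
Proof.
by move=> x y /(congr1 (@nat_of_ord 6)); rewrite !stack_tapeE; case: x; case: y.
Qed.

Lemma stack_tape_out x : (stack_tape x == ord_max) = false.
Proof. by apply/negbTE/negP => /eqP/(congr1 (@nat_of_ord 6)); rewrite stack_tapeE; case: x. Qed.

Definition cell : Type := ('I_Q + bool)%type.

Record stacks := Stacks {
  stI : seq cell; stD : seq cell; stA : seq cell; stB : seq cell; stC : seq cell;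
  stOut : seq 'I_Q }.

Definition get (s : stacks) (x : stack) : seq cell :=
  match x with SI => stI s | SD => stD s | SA => stA s | SB => stB s | SC => stC s end.

Definition put (s : stacks) (x : stack) (l : seq cell) : stacks :=
  let: Stacks i d a b c o := s in
  match x with
  | SI => Stacks l d a b c o | SD => Stacks i l a b c o | SA => Stacks i d l b c o
  | SB => Stacks i d a l c o | SC => Stacks i d a b l o end.

Lemma get_put s x l y :
  get (put s x l) y = if stack_tape y == stack_tape x then l else get s y.
Proof. by rewrite -val_eqE /= !stack_tapeE; case: s; case: x; case: y. Qed.

Lemma stOut_put s x l : stOut (put s x l) = stOut s.
Proof. by case: s; case: x. Qed.

Inductive prog :=
| Push of stack & cell
| Pop of stack
| Emit of 'I_Q
| Seq of prog & prog
| If of stack & (option cell -> bool) & prog & prog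
| While of stack & (option cell -> bool) & prog.

Definition emit (s : stacks) (a : 'I_Q) : stacks :=
  let: Stacks i d a' b c o := s in Stacks i d a' b c (rcons o a).

(** The costs are exactly the steps of the compiled machine: a push moves and then writes, and
    sequences, branches and rounds of a loop contain idle transitions. A push on [SI] is excluded
    because the head on the input only moves right. *)
Inductive run : prog -> stacks -> nat -> stacks -> Prop :=
| RunPush x e s : x <> SI -> run (Push x e) s 2 (put s x (e :: get s x))
| RunPop x s : run (Pop x) s 1 (put s x (behead (get s x)))
| RunEmit a s : run (Emit a) s 1 (emit s a)
| RunSeq p q s1 t1 s2 t2 s3 : run p s1 t1 s2 -> run q s2 t2 s3 ->
    run (Seq p q) s1 (t1 + t2.+1) s3
| RunIfT x (c : option cell -> bool) p q s t s' : c (ohead (get s x)) -> run p s t s' ->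
    run (If x c p q) s t.+1 s'
| RunIfF x (c : option cell -> bool) p q s t s' : ~~ c (ohead (get s x)) -> run q s t s' ->
    run (If x c p q) s t.+1 s'
| RunWhileF x (c : option cell -> bool) p s : ~~ c (ohead (get s x)) -> run (While x c p) s 0 s
| RunWhileT x (c : option cell -> bool) p s t s' t' s'' : c (ohead (get s x)) -> run p s t s' ->
    run (While x c p) s' t' s'' -> run (While x c p) s (t + t'.+1).+1 s''.

Definition embed (e : cell) : sym :=
  match e with inl a => Some (inl a) | inr b => Some (inr (Some b)) end.

Definition marker : sym := Some (inr None).

Definition unembed (y : sym) : option cell :=
  match y with
  | Some (inl a) => Some (inl a)
  | Some (inr (Some b)) => Some (inr b)
  | _ => None end.

Definition move_right (x : tape) (r : reads) : acts :=
  [ffun j => (r j, if j == x then MoveRight else MoveStay)].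
Definition move_left (x : tape) (r : reads) : acts :=
  [ffun j => (r j, if j == x then MoveLeft else MoveStay)].
Definition overwrite (x : tape) (y : sym) (r : reads) : acts :=
  [ffun j => (if j == x then y else r j, MoveStay)].
Definition write_right (x : tape) (y : sym) (r : reads) : acts :=
  [ffun j => if j == x then (y, MoveRight) else (r j, MoveStay)].

Definition fact (a : reads -> acts) : fragment :=
  @Fragment bool true (fun q r => if q then Some (false, a r) else None).

Lemma exec_fact a tp : @exec (fact a) true tp 1 (perform (a (read tp)) tp).
Proof. exact: ExecStep (ExecHalt _). Qed.

Definition fpush (x : tape) (y : sym) : fragment :=
  @Fragment (option bool) (Some true) (fun q r =>
    match q with
    | Some true => Some (Some false, move_right x r)
    | Some false => Some (None, overwrite x y r)
    | None => None end).

Lemma exec_fpush x y tp :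
  let tp1 := perform (move_right x (read tp)) tp in
  @exec (fpush x y) (Some true) tp 2 (perform (overwrite x y (read tp1)) tp1).
Proof. exact: ExecStep (ExecStep _ (ExecHalt _)). Qed.

Fixpoint compile (p : prog) : fragment :=
  match p with
  | Push x e => fpush (stack_tape x) (embed e)
  | Pop SI => fact (move_right (stack_tape SI))
  | Pop x => fact (move_left (stack_tape x))
  | Emit a => fact (write_right ord_max (Some (inl a)))
  | Seq p q => fseq (compile p) (compile q)
  | If x c p q => fif (fun r => c (unembed (r (stack_tape x)))) (compile p) (compile q)
  | While x c p => fwhile (fun r => c (unembed (r (stack_tape x)))) (compile p)
  end.

(* The head of a scratch tape is on the topmost element, or on the marker in
   cell 0 if the stack is empty; what lies to its right is garbage. *)
Definition rep (s : stacks) (tp : tapes) : Prop :=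
  [/\ forall i, cells tp (stack_tape SI) (heads tp (stack_tape SI) + i) =
                nth None (map embed (stI s)) i,
      forall x, x <> SI -> heads tp (stack_tape x) = size (get s x) /\
        forall i, i <= size (get s x) ->
          cells tp (stack_tape x) i = nth None (marker :: rev (map embed (get s x))) i,
      heads tp ord_max = size (stOut s)
    & forall h, cells tp ord_max h = nth None [seq Some (inl a) | a <- stOut s] h].

Lemma embedK e : unembed (embed e) = Some e.
Proof. by case: e. Qed.

Lemma rep_top s tp x : rep s tp -> unembed (read tp (stack_tape x)) = ohead (get s x).
Proof.
case=> hI hS _ _; rewrite ffunE; case: (pselect (x = SI)) => [->|xI].
  by rewrite -[heads _ _]addn0 hI /=; case: (stI s) => //= e l; rewrite embedK.
have [-> ->] := hS x xI; last exact: leqnn.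
case: (get s x) => //= e l; rewrite rev_cons nth_rcons size_rev size_map ltnn eqxx.
exact: embedK.
Qed.

Lemma heads_move_right x tp j :
  heads (perform (move_right x (read tp)) tp) j =
  if j == x then (heads tp j).+1 else heads tp j.
Proof. by rewrite /= ffunE /=; case: eqP. Qed.

Lemma cells_move_right x tp j h :
  cells (perform (move_right x (read tp)) tp) j h = cells tp j h.
Proof. by rewrite /= !ffunE /=; case: eqP => // ->. Qed.

Lemma heads_move_left x tp j :
  heads (perform (move_left x (read tp)) tp) j =
  if j == x then (heads tp j).-1 else heads tp j.
Proof. by rewrite /= ffunE /=; case: eqP. Qed.

Lemma cells_move_left x tp j h :
  cells (perform (move_left x (read tp)) tp) j h = cells tp j h.
Proof. by rewrite /= !ffunE /=; case: eqP => // ->. Qed.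

Lemma heads_overwrite x y tp j :
  heads (perform (overwrite x y (read tp)) tp) j = heads tp j.
Proof. by rewrite /= ffunE. Qed.

Lemma cells_overwrite x y tp j h :
  cells (perform (overwrite x y (read tp)) tp) j h =
  if (j == x) && (h == heads tp j) then y else cells tp j h.
Proof. by rewrite /= !ffunE /=; case: (j == x); case: eqP => //= ->. Qed.

Lemma heads_write_right x y tp j :
  heads (perform (write_right x y (read tp)) tp) j =
  if j == x then (heads tp j).+1 else heads tp j.
Proof. by rewrite /= ffunE; case: eqP. Qed.

Lemma cells_write_right x y tp j h :
  cells (perform (write_right x y (read tp)) tp) j h =
  if (j == x) && (h == heads tp j) then y else cells tp j h.
Proof. by rewrite /= !ffunE; case: (j == x) => /=; case: eqP => //= ->. Qed.

Definition tapesE := (heads_move_right, cells_move_right, heads_move_left,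
  cells_move_left, heads_overwrite, cells_overwrite, heads_write_right,
  cells_write_right).

Lemma stack_tape_neq x y : x <> y -> (stack_tape x == stack_tape y) = false.
Proof. by move=> ne; apply/negbTE/negP => /eqP /stack_tape_inj. Qed.

Lemma stI_put s x l : x <> SI -> stI (put s x l) = stI s.
Proof. by case: s; case: x. Qed.

Lemma rep_push s tp x e : x <> SI -> rep s tp ->
  let tp1 := perform (move_right (stack_tape x) (read tp)) tp in
  rep (put s x (e :: get s x)) (perform (overwrite (stack_tape x) (embed e) (read tp1)) tp1).
Proof.
move=> xI [hI hS ho hc] tp1; split.
- move=> i; rewrite !tapesE stI_put //.
  by rewrite eq_sym (stack_tape_neq xI) hI.
- move=> y yI; rewrite get_put !tapesE.
  case: (altP eqP) => [/stack_tape_inj ->|ne].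
    have [hd hcs] := hS x xI; rewrite hd; split=> // i.
    rewrite !tapesE eqxx hd leq_eqVlt => /predU1P[->|].
      by rewrite eqxx /= rev_cons nth_rcons size_rev size_map ltnn eqxx.
    rewrite ltnS => ile; rewrite ltn_eqF //=.
    rewrite hcs //; case: i ile => //= i ile.
    by rewrite rev_cons nth_rcons size_rev size_map ile.
  have [hd hcs] := hS y yI; split=> // i ile.
  by rewrite !tapesE (negbTE ne) /= hcs.
- by rewrite !tapesE eq_sym stack_tape_out stOut_put.
- by move=> h; rewrite !tapesE stOut_put eq_sym stack_tape_out /= hc.
Qed.

Lemma rep_pop s tp x : x <> SI -> rep s tp ->
  rep (put s x (behead (get s x))) (perform (move_left (stack_tape x) (read tp)) tp).
Proof.
move=> xI [hI hS ho hc]; split.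
- by move=> i; rewrite !tapesE eq_sym stack_tape_neq // stI_put.
- move=> y yI; rewrite get_put !tapesE; case: eqP => [/stack_tape_inj -> |_].
    have [hd hcs] := hS x xI; rewrite hd size_behead; split=> // i ile.
    rewrite tapesE hcs; last by case: (size _) ile => //= k /leqW.
    case: i ile => //= i; case: (get s x) => //= e l ile.
    by rewrite rev_cons nth_rcons size_rev size_map ile.
  have [hd hcs] := hS y yI; split=> // i ile.
  by rewrite tapesE hcs.
- by rewrite !tapesE eq_sym stack_tape_out stOut_put.
- by move=> h; rewrite tapesE stOut_put.
Qed.

Lemma rep_popI s tp : rep s tp ->
  rep (put s SI (behead (stI s))) (perform (move_right (stack_tape SI) (read tp)) tp).
Proof.
move=> [hI hS ho hc]; split.
- move=> i; rewrite !tapesE eqxx addSnnS hI.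
  have -> : stI (put s SI (behead (stI s))) = behead (stI s) by case: (s).
  by case: (stI s) => //=; rewrite nth_nil.
- move=> y yI; rewrite get_put !tapesE stack_tape_neq //.
  have [hd hcs] := hS y yI; split=> // i ile.
  by rewrite tapesE hcs.
- by rewrite !tapesE eq_sym stack_tape_out stOut_put.
- by move=> h; rewrite tapesE stOut_put.
Qed.

Lemma rep_emit s tp a : rep s tp ->
  rep (emit s a) (perform (write_right ord_max (Some (inl a)) (read tp)) tp).
Proof.
move=> [hI hS ho hc]; split.
- move=> i; rewrite !tapesE stack_tape_out /= hI.
  by case: (s).
- move=> y yI; rewrite !tapesE stack_tape_out.
  have -> : get (emit s a) y = get s y by case: (s) y yI => ? ? ? ? ? ? [].
  have [hd hcs] := hS y yI; split=> // i ile.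
  by rewrite tapesE stack_tape_out hcs.
- by rewrite !tapesE eqxx /= ho; case: (s) => /= *; rewrite size_rcons.
- move=> h; rewrite !tapesE eqxx /= hc ho.
  have -> : stOut (emit s a) = rcons (stOut s) a by case: (s).
  rewrite map_rcons nth_rcons size_map.
  by case: ltngtP => // sh; rewrite nth_default // size_map ltnW.
Qed.

Theorem compile_run p s t s' : run p s t s' -> forall tp, rep s tp ->
  exists2 tp', exec (fentry (compile p)) tp t tp' & rep s' tp'.
Proof.
elim=> {p s t s'}.
- move=> x e s xI tp r; eexists; first exact: exec_fpush.
  exact: rep_push.
- move=> x s tp r; case: (pselect (x = SI)) => [->|xI].
    by eexists; [exact: exec_fact|exact: rep_popI].
  eexists; last exact: rep_pop xI r.
  by case: x xI => // _; exact: exec_fact.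
- by move=> a s tp r; eexists; [exact: exec_fact|exact: rep_emit].
- move=> p q s1 t1 s2 t2 s3 _ IH1 _ IH2 tp /IH1[tp1 e1] /IH2[tp2 e2 r2].
  by exists tp2 => //; exact: exec_seq e1 e2.
- move=> x c p q s t s' hc _ IH tp r; have [tp' e' r'] := IH _ r.
  by exists tp' => //; apply: exec_if_true e'; rewrite (rep_top _ r).
- move=> x c p q s t s' hc _ IH tp r; have [tp' e' r'] := IH _ r.
  by exists tp' => //; apply: exec_if_false e'; rewrite (rep_top _ r).
- move=> x c p s hc tp r; exists tp => //; apply: exec_while_false.
  by rewrite (rep_top _ r).
- move=> x c p s t s' t' s'' hc _ IH1 _ IH2 tp r.
  have [tp1 e1 /IH2[tp2 e2 r2]] := IH1 _ r.
  by exists tp2 => //; apply: exec_while_true e1 e2; rewrite (rep_top _ r).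
Qed.

(** A push moves right before it writes, so cell 0 keeps the marker as the bottom of the stack;
    popping an empty stack is harmless, since a left move at cell 0 stays there. *)
Definition fmark : fragment := fact (fun r =>
  [ffun j => (if (j == ord0) || (j == ord_max) then r j else marker, MoveStay)]).

Definition fragment_machine (f : fragment) : machine Q :=
  @Machine Q 5 (fstate f) (option bool) (fentry f) (@ftrans f).

Definition prog_machine (p : prog) : machine Q :=
  fragment_machine (fseq fmark (compile p)).

Lemma exec_iter f q tp t tp' : @exec f q tp t tp' ->
  let M := fragment_machine f in
  let c := iter t (@Defs.step Q M) (@Config Q M q (heads tp) (cells tp)) in
  halted c /\ ccell c = cells tp'.
Proof.
elim=> {q tp t tp'} [q tp h|q tp q' a t tp' h _ IH] //.
move=> M; rewrite iterSr; set c1 := Defs.step _.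
have -> // : c1 = @Config Q M q' (heads (perform a tp)) (cells (perform a tp)).
by rewrite /c1 /Defs.step /action /= h.
Qed.

(** The two additional steps write the markers and enter the program. *)
Lemma prog_machine_outputs p n (g : n.-tuple 'I_Q) t s' L :
  run p (Stacks (map inl g) [::] [::] [::] [::] [::]) t s' ->
  stOut s' = flatten [seq tval w | w <- L] ->
  outputs_in (prog_machine p) g t.+2 L.
Proof.
move=> rp outE.
pose tp0 := Tapes (fun=> 0) (fun j : tape => if j == ord0 then
  nth None [seq Some (inl a) | a <- tval g] else nth None [::]).
have si0 : stack_tape SI = ord0 by apply: val_inj; rewrite /= stack_tapeE.
pose mark_all (r : reads) : acts :=
  [ffun j => (if (j == ord0) || (j == ord_max) then r j else marker, MoveStay)].
have r1 : rep (Stacks (map inl g) [::] [::] [::] [::] [::])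
    (perform (mark_all (read tp0)) tp0).
  split.
  - move=> i; rewrite /= !ffunE /= si0 -map_comp; by case: i.
  - move=> x xI; split; first by rewrite /= !ffunE /=; case: x xI.
    move=> i; rewrite /= !ffunE stack_tape_out.
    have -> : (stack_tape x == ord0) = false.
      by apply/negbTE/negP; rewrite -si0 => /eqP /stack_tape_inj.
    by case: x xI => // _; case: i.
  - by rewrite /= !ffunE.
  - move=> h; rewrite /= !ffunE /= nth_nil; by case: h.
have [tp' e' [_ _ _ outc]] := compile_run rp r1.
have e1 := exec_seq (exec_fact mark_all tp0) e'.
have [hh hc] := exec_iter e1.
rewrite /outputs_in /init; split; first exact: hh.
move=> h; rewrite -[_.+2]/(1 + t.+1)%N.
set c := iter _ _ _ in hh hc *; rewrite [ccell c]hc outc outE.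
by [].
Qed.

End StackPrograms.

(** * Polynomial-time functions *)

Inductive tree := Leaf | Node of tree & tree.

Class Enc (T : Type) := enc : T -> tree.

Global Instance enc_unit : Enc unit := fun=> Leaf.
Global Instance enc_bool : Enc bool := fun b => if b then Node Leaf Leaf else Leaf.
(** Unary, so that [n] and [nseq n tt] have the same tree. Likewise a nonempty list is encoded as
    the pair of its head and tail. Such conversions need no computation. *)
Global Instance enc_nat : Enc nat := fix e n := if n is m.+1 then Node Leaf (e m) else Leaf.
Global Instance enc_pair (A B : Type) (eA : Enc A) (eB : Enc B) : Enc (A * B) :=
  fun p => Node (enc p.1) (enc p.2).
Global Instance enc_seq (A : Type) (eA : Enc A) : Enc (seq A) :=
  fix e l := if l is x :: l' then Node (enc x) (e l') else Leaf.

Section PolynomialTime.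
Variable Q : nat.
Local Open Scope nat_scope.

Notation cell := (cell Q).
Notation prog := (prog Q).
Notation stacks := (stacks Q).

Definition bit (b : bool) : cell := inr b.

(* Prefix notation, first symbol on top. *)
Fixpoint serialize (t : tree) : seq cell :=
  if t is Node a b then bit true :: serialize a ++ serialize b else [:: bit false].

Definition runs (p : prog) (s : stacks) (T : nat) (s' : stacks) : Prop :=
  exists2 t, t <= T & run p s t s'.

Lemma runsW p s T T' s' : runs p s T s' -> T <= T' -> runs p s T' s'.
Proof. by move=> [t tT r] TT'; exists t => //; apply: leq_trans TT'. Qed.

Lemma runs_push x e s : x <> SI -> runs (Push x e) s 2 (put s x (e :: get s x)).
Proof. by exists 2 => //; apply: RunPush. Qed.

Lemma runs_pop x s : runs (Pop _ x) s 1 (put s x (behead (get s x))).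
Proof. by exists 1 => //; apply: RunPop. Qed.

Lemma runs_seq p q s1 t1 s2 t2 s3 :
  runs p s1 t1 s2 -> runs q s2 t2 s3 -> runs (Seq p q) s1 (t1 + t2).+1 s3.
Proof.
move=> [u1 l1 r1] [u2 l2 r2]; exists (u1 + u2.+1); last exact: RunSeq r1 r2.
by rewrite addnS ltnS leq_add.
Qed.

Lemma runs_if x (c : option cell -> bool) p q s t s' :
  runs (if c (ohead (get s x)) then p else q) s t s' -> runs (If x c p q) s t.+1 s'.
Proof.
case: ifP => hc [u l r]; exists u.+1 => //; first exact: RunIfT.
by apply: RunIfF; rewrite ?hc.
Qed.

Lemma runs_while x (c : option cell -> bool) p s t s1 t' s' :
  c (ohead (get s x)) -> runs p s t s1 -> runs (While x c p) s1 t' s' ->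
  runs (While x c p) s (t + t').+2 s'.
Proof.
move=> hc [u l r] [u' l' r']; exists (u + u'.+1).+1; last exact: RunWhileT hc r r'.
by rewrite addnS !ltnS leq_add.
Qed.

Lemma runs_stop x (c : option cell -> bool) p s :
  ~~ c (ohead (get s x)) -> runs (While x c p) s 0 s.
Proof. by move=> hc; exists 0 => //; apply: RunWhileF. Qed.

Definition onebit (c : option cell) : bool := if c is Some (inr b) then b else false.
Definition nonempty (c : option cell) : bool := isSome c.

Definition tree_loop (x : stack) : prog :=
  While SC nonempty
    (If SD onebit
      (Seq (Pop _ SD) (Seq (Push x (bit true)) (Push SC (bit true))))
      (Seq (Pop _ SD) (Seq (Push x (bit false)) (Pop _ SC)))).

(* The height of [SC] counts the subtrees still to be read. *)
Definition take_tree (x : stack) : prog := Seq (Push SC (bit true)) (tree_loop x).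

(** Stated with an arbitrary continuation, because one loop reads both subtrees of a node: the
    induction hypothesis for the left subtree takes the run on the right one as its continuation. *)
Lemma tree_loop_run t x d a b c o T s' : x = SA \/ x = SB ->
  runs (tree_loop x) (match x with
     | SA => Stacks [::] d (rev (serialize t) ++ a) b c o
     | _ => Stacks [::] d a (rev (serialize t) ++ b) c o end) T s' ->
  runs (tree_loop x) (Stacks [::] (serialize t ++ d) a b (bit true :: c) o)
    (T + 12 * size (serialize t)) s'.
Proof.
move=> xAB; elim: t d a b c T => [|t1 IH1 t2 IH2] d a b c T r.
  apply: (@runsW _ _ (7 + T).+2); last by rewrite /=; lia.
  apply: runs_while r => //; apply: runs_if.
  by case: xAB => -> /=; apply: (runs_seq (runs_pop _ _));
    apply: (runs_seq (runs_push _ _ _) (runs_pop _ _)).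
pose s1 := match x with
  | SA => Stacks [::] (serialize t1 ++ serialize t2 ++ d) (bit true :: a) b (bit true :: bit true
    :: c) o
  | _ => Stacks [::] (serialize t1 ++ serialize t2 ++ d) a (bit true :: b) (bit true :: bit true
    :: c) o end.
apply: (@runsW _ _ (8 + (T + 12 * size (serialize t2) + 12 * size (serialize t1))).+2);
  last by rewrite /= size_cat; lia.
apply: (@runs_while _ _ _ _ 8 s1) => //.
- apply: runs_if; rewrite /s1.
  by case: xAB {r} => -> /=; apply: (runs_seq (runs_pop _ _)); rewrite /= ?catA;
    apply: (runs_seq (runs_push _ _ _) (runs_push _ _ _)).
- rewrite /s1; case: xAB r IH1 IH2 => -> r IH1 IH2; apply: IH1; apply: IH2; move: r;
    by rewrite /= rev_cons rev_cat cat_rcons catA.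
Qed.

Lemma take_treeA t d a b o :
  runs (take_tree SA) (Stacks [::] (serialize t ++ d) a b [::] o)
    (3 + 12 * size (serialize t)) (Stacks [::] d (rev (serialize t) ++ a) b [::] o).
Proof.
apply: runs_seq (runs_push _ _ _) _ => //; rewrite -[12 * _]add0n.
by apply: tree_loop_run; [left|exact: runs_stop].
Qed.

Lemma take_treeB t d a b o :
  runs (take_tree SB) (Stacks [::] (serialize t ++ d) a b [::] o)
    (3 + 12 * size (serialize t)) (Stacks [::] d a (rev (serialize t) ++ b) [::] o).
Proof.
apply: runs_seq (runs_push _ _ _) _ => //; rewrite -[12 * _]add0n.
by apply: tree_loop_run; [right|exact: runs_stop].
Qed.

Definition allbits (l : seq cell) : bool := all (fun e => if e is inr _ then true else false) l.

Lemma allbits_serialize t : allbits (serialize t).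
Proof. by elim: t => //= a ha b hb; rewrite /allbits all_cat; apply/andP. Qed.

Lemma allbits_rev l : allbits (rev l) = allbits l.
Proof. exact: all_rev. Qed.

Definition pour (x y : stack) : prog :=
  While x nonempty (If x onebit (Seq (Pop _ x) (Push y (bit true)))
                                (Seq (Pop _ x) (Push y (bit false)))).

Lemma pourAD l d b c o : allbits l ->
  runs (pour SA SD) (Stacks [::] d l b c o) (8 * size l) (Stacks [::] (rev l ++ d) [::] b c o).
Proof.
elim: l d => [|[//|e] l IH] d /= hl; first exact: runs_stop.
rewrite rev_cons cat_rcons; apply: (@runsW _ _ (5 + _).+2);
  [apply: runs_while (IH _ hl) => //|by lia].
by apply: runs_if; case: e => /=; apply: (runs_seq (runs_pop _ _)); apply: runs_push.
Qed.

Lemma pourBD l d a c o : allbits l ->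
  runs (pour SB SD) (Stacks [::] d a l c o) (8 * size l) (Stacks [::] (rev l ++ d) a [::] c o).
Proof.
elim: l d => [|[//|e] l IH] d /= hl; first exact: runs_stop.
rewrite rev_cons cat_rcons; apply: (@runsW _ _ (5 + _).+2);
  [apply: runs_while (IH _ hl) => //|by lia].
by apply: runs_if; case: e => /=; apply: (runs_seq (runs_pop _ _)); apply: runs_push.
Qed.

Definition pour2 : prog :=
  While SA nonempty (If SA onebit
    (Seq (Pop _ SA) (Seq (Push SD (bit true)) (Push SB (bit true))))
    (Seq (Pop _ SA) (Seq (Push SD (bit false)) (Push SB (bit false))))).

Lemma pour2_run l d b c o : allbits l ->
  runs pour2 (Stacks [::] d l b c o) (12 * size l) (Stacks [::] (rev l ++ d) [::] (rev l ++ b) c o).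
Proof.
elim: l d b => [|[//|e] l IH] d b /= hl; first exact: runs_stop.
rewrite rev_cons !cat_rcons; apply: (@runsW _ _ (8 + _).+2);
  [apply: runs_while (IH _ _ hl) => //|by lia].
by apply: runs_if; case: e => /=; apply: (runs_seq (runs_pop _ _));
  apply: (runs_seq (runs_push _ _ _) (runs_push _ _ _)).
Qed.

Lemma pourBA l d a c o : allbits l ->
  runs (pour SB SA) (Stacks [::] d a l c o) (8 * size l) (Stacks [::] d (rev l ++ a) [::] c o).
Proof.
elim: l a => [|[//|e] l IH] a /= hl; first exact: runs_stop.
rewrite rev_cons cat_rcons; apply: (@runsW _ _ (5 + _).+2);
  [apply: runs_while (IH _ hl) => //|by lia].
by apply: runs_if; case: e => /=; apply: (runs_seq (runs_pop _ _)); apply: runs_push.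
Qed.

Lemma clearA_run l d b c o :
  runs (While SA nonempty (Pop _ SA)) (Stacks [::] d l b c o) (4 * size l) (Stacks [::] d [::] b
    c o).
Proof.
elim: l => [|e l IH] /=; first exact: runs_stop.
apply: (@runsW _ _ (1 + 4 * size l).+2); last by lia.
by apply: runs_while IH => //; exact: runs_pop.
Qed.

Definition mem_state (d : seq cell) o : stacks := Stacks [::] d [::] [::] [::] o.

Definition p_dup : prog :=
  Seq (take_tree SA) (Seq pour2 (Seq (pour SB SA) (pour SA SD))).

Lemma p_dup_run t d o :
  runs p_dup (mem_state (serialize t ++ d) o) (10 + 40 * size (serialize t))
    (mem_state (serialize t ++ serialize t ++ d) o).
Proof.
have hb := allbits_serialize t.
have hr : allbits (rev (serialize t)) by rewrite allbits_rev.
have r1 := take_treeA t d [::] [::] o.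
have r2 := pour2_run d [::] [::] o hr.
have r3 := pourBA (serialize t ++ d) [::] [::] o hb.
have r4 := pourAD (serialize t ++ d) [::] [::] o hr.
rewrite !cats0 ?revK in r1 r2 r3 r4.
apply: runsW (runs_seq r1 (runs_seq r2 (runs_seq r3 r4))) _.
by rewrite size_rev; lia.
Qed.

Definition p_swap : prog :=
  Seq (take_tree SA) (Seq (take_tree SB) (Seq (pour SA SD) (pour SB SD))).

Lemma p_swap_run t u d o :
  runs p_swap (mem_state (serialize t ++ serialize u ++ d) o)
    (10 + 20 * (size (serialize t) + size (serialize u)))
    (mem_state (serialize u ++ serialize t ++ d) o).
Proof.
have hr x : allbits (rev (serialize x)) by rewrite allbits_rev allbits_serialize.
have r1 := take_treeA t (serialize u ++ d) [::] [::] o.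
have r2 := take_treeB u d (rev (serialize t)) [::] o.
have r3 := pourAD d (rev (serialize u)) [::] o (hr t).
have r4 := pourBD (serialize t ++ d) [::] [::] o (hr u).
rewrite !cats0 ?revK in r1 r2 r3 r4.
apply: runsW (runs_seq r1 (runs_seq r2 (runs_seq r3 r4))) _.
by rewrite !size_rev; lia.
Qed.

Definition p_drop : prog := Seq (take_tree SA) (While SA nonempty (Pop _ SA)).

Lemma p_drop_run t d o :
  runs p_drop (mem_state (serialize t ++ d) o) (10 + 20 * size (serialize t)) (mem_state d o).
Proof.
apply: runsW (runs_seq (take_treeA t d [::] [::] o) (clearA_run _ _ _ _ _)) _.
by rewrite cats0 size_rev; lia.
Qed.

(** An instruction adds at most one cell and takes at least one step. In this way a time bound also
    bounds the size of the result. *)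
Lemma run_growth (p : prog) (s : stacks) t (s' : stacks) : run p s t s' ->
  size (stD s') <= size (stD s) + t.
Proof.
elim=> {p s t s'} //=.
- by move=> x e [? ? ? ? ? ?] _; case: x => //=; lia.
- by move=> x [? ? ? ? ? ?]; case: x => //=; rewrite ?size_behead; lia.
- by move=> a [? ? ? ? ? ?] /=; lia.
- by move=> *; lia.
- by move=> *; lia.
- by move=> *; lia.
- by move=> *; lia.
- by move=> *; lia.
Qed.

End PolynomialTime.

Fixpoint tsize (t : tree) : nat := if t is Node a b then (tsize a + tsize b).+1 else 1.

Lemma size_serialize Q t : size (serialize Q t) = tsize t.
Proof. by elim: t => //= a ha b hb; rewrite size_cat ha hb. Qed.

Definition esize (T : Type) (e : Enc T) (x : T) : nat := tsize (enc x).
Arguments esize {T e} x.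

(** * Sizes of encodings and polynomial bounds *)

Section Bounds.
Local Open Scope nat_scope.

Lemma esize_nat (n : nat) : esize n = n.*2.+1.
Proof. by elim: n => //= n; rewrite /esize /= => ->; rewrite doubleS. Qed.

Lemma esize_pair (A B : Type) (eA : Enc A) (eB : Enc B) (p : A * B) :
  esize p = (esize p.1 + esize p.2).+1.
Proof. by []. Qed.

Lemma esize_cons (A : Type) (eA : Enc A) (x : A) l : esize (x :: l) = (esize x + esize l).+1.
Proof. by []. Qed.

Lemma esize_cat (A : Type) (eA : Enc A) (l l' : seq A) :
  (esize (l ++ l')).+1 = esize l + esize l'.
Proof. by elim: l => [|x l IH] //; rewrite cat_cons !esize_cons; lia. Qed.

Lemma size_esize (A : Type) (eA : Enc A) (l : seq A) : size l < esize l.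
Proof.
elim: l => //= x l IH; rewrite esize_cons ltnS; apply: leq_trans IH _.
exact: leq_addl.
Qed.

Lemma enc_nseq n : enc (nseq n tt) = enc n.
Proof. by elim: n => //= n; rewrite /enc /= => ->. Qed.

Section Polynomial.
Context {X : Type} {eX : Enc X}.

(** The summand 2 keeps the base above 1, so that a larger exponent absorbs constants, sums and
    products. *)
Definition poly_bounded (h : X -> nat) : Prop := exists c, forall x, h x <= (esize x).+2 ^ c.

Lemma pb_le (g h : X -> nat) : poly_bounded g -> (forall x, h x <= g x) -> poly_bounded h.
Proof. by move=> [c hc] hg; exists c => x; apply: leq_trans (hg x) (hc x). Qed.

Lemma pb_const k : poly_bounded (fun=> k).
Proof.
exists k => x; apply: leq_trans (ltnW (ltn_expl k (isT : 1 < 2))) _.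
by case: k => // k; rewrite leq_exp2r.
Qed.

Lemma pb_esize : poly_bounded esize.
Proof. by exists 1 => x; rewrite expn1; lia. Qed.

Lemma pb_mul (g h : X -> nat) : poly_bounded g -> poly_bounded h ->
  poly_bounded (fun x => g x * h x).
Proof. by move=> [a ha] [b hb]; exists (a + b) => x; rewrite expnD leq_mul. Qed.

Lemma pb_add (g h : X -> nat) : poly_bounded g -> poly_bounded h ->
  poly_bounded (fun x => g x + h x).
Proof.
move=> pg ph; apply: (@pb_le (fun x => (g x).+1 * (h x).+1)); last by move=> x; nia.
have pS f : poly_bounded f -> poly_bounded (fun x => (f x).+1).
  move=> [c hc]; exists c.+1 => x; rewrite expnS.
  have := hc x; have : 0 < (esize x).+2 ^ c by rewrite expn_gt0.
  by nia.
by apply: pb_mul; apply: pS.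
Qed.

Lemma pb_exp (h : X -> nat) c : poly_bounded h -> poly_bounded (fun x => h x ^ c).
Proof.
move=> ph; elim: c => [|c IH]; first exact: pb_const.
by apply: pb_le (pb_mul ph IH) _ => x; rewrite expnS.
Qed.

End Polynomial.

Lemma pb_comp (X Y : Type) (eX : Enc X) (eY : Enc Y) (f : X -> Y) (h : Y -> nat) :
  poly_bounded h -> poly_bounded (fun x => esize (f x)) -> poly_bounded (fun x => h (f x)).
Proof.
move=> [c hc] pf; apply: (@pb_le _ _ (fun x => (esize (f x) + 2) ^ c)).
  by apply: pb_exp; apply: pb_add => //; exact: pb_const.
by move=> x; rewrite addn2.
Qed.

End Bounds.

Ltac pb := repeat first
  [ assumption | exact: pb_const | exact: pb_esize
  | apply: pb_add | apply: pb_mul | apply: pb_exp ].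

(** * Closure properties of polynomial-time functions *)

Section PolynomialTimeFunctions.
Variable Q : nat.
Local Open Scope nat_scope.

Notation ser := (serialize Q).
Notation mem_state := (@mem_state Q).

(** The rest [d] of the stack is preserved and the scratch stacks are empty before and after, so a
    program can run on top of data that a later one uses. *)
Definition computes (X Y : Type) (eX : Enc X) (eY : Enc Y) (p : prog Q) (f : X -> Y)
    (h : X -> nat) : Prop :=
  forall x d o, runs p (mem_state (ser (enc x) ++ d) o) (h x) (mem_state (ser (enc (f x)) ++ d) o).

Definition PT (X Y : Type) (eX : Enc X) (eY : Enc Y) (f : X -> Y) : Prop :=
  exists p h, poly_bounded h /\ computes eX eY p f h.
Arguments PT {X Y eX eY} f.

Section Basics.
Context {X Y : Type} {eX : Enc X} {eY : Enc Y}.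

Lemma PT_ext (f g : X -> Y) : f =1 g -> PT f -> PT g.
Proof. by move=> fg [p [h [hb hc]]]; exists p, h; split=> // x d o; rewrite -fg. Qed.

Lemma PT_size (f : X -> Y) : PT f -> poly_bounded (fun x => esize (f x)).
Proof.
move=> [p [h [hb hc]]]; apply: pb_le (pb_add (pb_esize (X := X)) hb) _ => x.
have [t tT /run_growth] := hc x [::] [::].
by rewrite /= !cats0 !size_serialize => /leq_trans; apply; rewrite leq_add2l.
Qed.

(* Dropping a fresh leaf costs nothing to the data and has no empty-program
   counterpart in [prog]. *)
Lemma PT_reenc (f : X -> Y) : (forall x, enc (f x) = enc x) -> PT f.
Proof.
move=> fE; exists (Seq (Push SD (bit Q false)) (Pop Q SD)), (fun=> 4); split.
  exact: pb_const.
by move=> x d o; rewrite fE; apply: (runs_seq (runs_push _ _ _) (runs_pop _ _)).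
Qed.

End Basics.

Section Closure.
Context {X Y Z : Type} {eX : Enc X} {eY : Enc Y} {eZ : Enc Z}.

Lemma PT_comp (g : Y -> Z) (f : X -> Y) : PT g -> PT f -> PT (fun x => g (f x)).
Proof.
move=> [p [h [hb hc]]] pf; have sf := PT_size pf; case: pf => p' [h' [hb' hc']].
exists (Seq p' p), (fun x => 1 + (h' x + h (f x))); split.
  by pb; apply: pb_comp sf.
by move=> x d o; exact: runs_seq (hc' x d o) (hc (f x) d o).
Qed.

End Closure.

Section Products.
Context {X Y Z : Type} {eX : Enc X} {eY : Enc Y} {eZ : Enc Z}.

(** One copy of the argument is turned into [g x] and swapped below the other, which becomes [f x];
    the bit pushed last joins both results to a node. *)
Lemma PT_pair (f : X -> Y) (g : X -> Z) : PT f -> PT g -> PT (fun x => (f x, g x)).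
Proof.
move=> pf pg; have sf := PT_size pf; have sg := PT_size pg.
case: pf => p [h [hb hc]]; case: pg => p' [h' [hb' hc']].
exists (Seq (p_dup Q) (Seq p' (Seq (p_swap Q) (Seq p (Push SD (bit Q true)))))),
  (fun x => 100 + (40 * esize x + (h' x + (20 * (esize (g x) + esize x) + h x)))).
split; first by pb.
move=> x d o.
have r1 := p_dup_run (@enc _ eX x) d o; have r2 := hc' x (ser (@enc _ eX x) ++ d) o.
have r3 := p_swap_run (@enc _ eZ (g x)) (@enc _ eX x) d o.
have r4 := hc x (ser (@enc _ eZ (g x)) ++ d) o.
have r5 := @runs_push Q SD (bit Q true) (mem_state (ser (@enc _ eY (f x)) ++ ser (@enc _ eZ (g
  x)) ++ d) o).
have {}r5 := r5 (ltac:(by [])).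
rewrite /= -catA.
apply: runsW (runs_seq r1 (runs_seq r2 (runs_seq r3 (runs_seq r4 r5)))) _.
by rewrite !size_serialize /esize; lia.
Qed.

Lemma PT_const_tree (t : tree) : exists p k, forall d o,
  runs p (mem_state d o) k (mem_state (ser t ++ d) o).
Proof.
suff [p [k hp]] : exists p k, forall d o,
    runs p (mem_state d o) k (mem_state (rev (rev (ser t)) ++ d) o).
  by exists p, k => d o; have := hp d o; rewrite revK.
elim: (rev (ser t)) => [|e l [p [k hp]]].
  exists (Seq (Push SD (bit Q false)) (Pop Q SD)), 4 => d o.
  by apply: (runs_seq (runs_push _ _ _) (runs_pop _ _)).
exists (Seq (Push SD e) p), (2 + k).+1 => d o; rewrite rev_cons cat_rcons.
by apply: (runs_seq (@runs_push Q SD e (mem_state d o) _) (hp (e :: d) o)).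
Qed.

Lemma PT_const (y : Y) : PT (fun _ : X => y).
Proof.
have [p [k hp]] := PT_const_tree (@enc _ eY y).
exists (Seq (p_drop Q) p), (fun x => 11 + (20 * esize x + k)); split; first by pb.
move=> x d o; apply: runsW (runs_seq (p_drop_run _ _ _) (hp _ _)) _.
by rewrite size_serialize /esize; lia.
Qed.

Lemma PT_fst (f : X -> Y * Z) : PT f -> PT (fun x => (f x).1).
Proof.
move=> pf; apply: (PT_comp (g := @fst Y Z)) pf; exists (Seq (Pop Q SD) (Seq (p_swap Q) (p_drop
  Q))), (fun x => 100 + 40 * esize x).
split; first by pb.
move=> [y z] d o.
have r2 := p_swap_run (@enc _ eY y) (@enc _ eZ z) d o;
  have r3 := p_drop_run (@enc _ eZ z) (ser (@enc _ eY y) ++ d) o.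
rewrite /= -catA.
have r1 := runs_pop SD (mem_state (bit Q true :: ser (@enc _ eY y) ++ ser (@enc _ eZ z) ++ d) o).
apply: runsW (runs_seq r1 (runs_seq r2 r3)) _.
by rewrite !size_serialize esize_pair /esize /=; lia.
Qed.

Lemma PT_snd (f : X -> Y * Z) : PT f -> PT (fun x => (f x).2).
Proof.
move=> pf; apply: (PT_comp (g := @snd Y Z)) pf; exists (Seq (Pop Q SD) (p_drop Q)), (fun x =>
  100 + 40 * esize x).
split; first by pb.
move=> [y z] d o; have r2 := p_drop_run (@enc _ eY y) (ser (@enc _ eZ z) ++ d) o.
rewrite /= -catA.
have r1 := runs_pop SD (mem_state (bit Q true :: ser (@enc _ eY y) ++ ser (@enc _ eZ z) ++ d) o).
apply: runsW (runs_seq r1 r2) _.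
by rewrite !size_serialize esize_pair /esize /=; lia.
Qed.

End Products.

Lemma PT_id (X : Type) (eX : Enc X) : PT (fun x : X => x).
Proof. exact: PT_reenc. Qed.

(* Serves for [nat], [bool] and [seq], whose encodings are all either a leaf or a
   node. *)
Lemma PT_case_node (X W V Z : Type) (eX : Enc X) (eW : Enc W) (eV : Enc V) (eZ : Enc Z)
    (f : X -> W) (g0 : X -> Z) (g1 : X * V -> Z) (h : X -> Z) :
  PT f -> PT g0 -> PT g1 ->
  (forall x, (enc (f x) = Leaf /\ h x = g0 x) \/
     (exists v : V, [/\ enc v = enc (f x), enc v <> Leaf & h x = g1 (x, v)])) ->
  PT h.
Proof.
move=> pf p0 p1 hE.
have sf := PT_size pf.
have [q [k [kb kc]]] := PT_pair pf (PT_id eX).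
have [q0 [k0 [kb0 kc0]]] := p0.
have [q1 [k1 [kb1 kc1]]] : PT (fun p : V * X => g1 (p.2, p.1)).
  by apply: PT_comp p1 _; apply: PT_pair; [apply: PT_snd|apply: PT_fst]; apply: PT_id.
have [c hc] := kb1.
exists (Seq q (Seq (Pop Q SD) (If SD (@onebit Q) (Seq (Push SD (bit Q true)) q1) (Seq (Pop Q SD)
  q0)))),
  (fun x => k x + (20 + (k0 x + (esize (f x) + esize x + 3) ^ c))); split; first by pb.
move=> x d o; have r1 := kc x d o; rewrite /= -catA in r1.
apply: (@runsW _ _ _ (k x + (1 + (1 + (k0 x + 2 + (esize (f x) + esize x + 3) ^ c)).+2).+1).+1);
  last by lia.
apply: runs_seq r1 (runs_seq (runs_pop _ _) (runs_if _)) => /=.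
case: (hE x) => [[-> ->]|[v [vf vL ->]]] /=.
  have r3 := runs_pop SD (mem_state (bit Q false :: ser (@enc _ eX x) ++ d) o).
  apply: runsW (runs_seq r3 (kc0 x d o)) _.
  by rewrite -addSn; lia.
have r2 := kc1 (v, x) d o; have := hc (v, x); rewrite esize_pair /= {1}/esize vf -/(esize (f x)).
rewrite [enc (v, x)]/= -/(enc v) -/(enc x) /= vf -catA in r2.
case: (enc (f x)) r2 vf vL => [_ -> //|t1 t2] r2 _ _ kv.
have r3 := @runs_push Q SD (bit Q true)
  (mem_state (ser (Node t1 t2) ++ ser (@enc _ eX x) ++ d) o) _.
apply: runsW (runs_seq (r3 _) r2) _ => //.
by rewrite (addn3 (esize (f x) + _)); move: kv; set E := _ ^ c; lia.
Qed.

End PolynomialTimeFunctions.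

Arguments PT Q {X Y eX eY} f.

Section Folds.
Variable Q : nat.
Local Open Scope nat_scope.

Notation ser := (serialize Q).
Notation mem_state := (@mem_state Q).
Notation PT f := (@PT Q _ _ _ _ f).

Section Foldl.
Context {X Y A : Type} {eX : Enc X} {eY : Enc Y} {eA : Enc A}.

(** The partial results must be bounded separately: a polynomial-time step may double the size of
    the accumulator each time it is applied. *)
Lemma PT_foldl (F : X -> A -> Y -> A) (i : X -> A) (l : X -> seq Y) (h : X -> nat) :
  PT l -> PT i -> PT (fun p : X * (A * Y) => F p.1 p.2.1 p.2.2) ->
  poly_bounded h -> (forall x j, esize (foldl (F x) (i x) (take j (l x))) <= h x) ->
  PT (fun x => foldl (F x) (i x) (l x)).
Proof.
move=> pl pi pF hb hB; have sl := PT_size pl.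
pose body (s : (Y * seq Y) * (X * A)) := (s.1.2, (s.2.1, F s.2.1 s.2.2 s.1.1)).
have [b [kb [[c kbb] kbc]]] : PT body.
  have pid : PT (fun s : (Y * seq Y) * (X * A) => s) by apply: PT_id.
  apply: PT_pair; first by apply: PT_snd; apply: PT_fst.
  apply: PT_pair; first by apply: PT_fst; apply: PT_snd.
  apply: (PT_comp (g := fun p : X * (A * Y) => F p.1 p.2.1 p.2.2)
    (f := fun s : (Y * seq Y) * (X * A) => (s.2.1, (s.2.2, s.1.1)))) => //.
  apply: PT_pair; first by apply: PT_fst; apply: PT_snd.
  apply: PT_pair; first by apply: PT_snd; apply: PT_snd.
  by apply: PT_fst; apply: PT_fst.
(* [SD] holds the remaining list and, below it, the pair of [x] and the accumulator. A nonempty list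
   starts with the bit [true], which is the loop test. One more [true] joins both to an argument of
   [body], and the pop splits the result again. *)
pose loop := While SD (@onebit Q) (Seq (Push SD (bit Q true)) (Seq b (Pop Q SD))).
have aux : PT (fun x => (x, foldl (F x) (i x) (l x))); last exact: PT_snd aux.
have [q [kq [kqb kqc]]] : PT (fun x => (l x, (x, i x))).
  by apply: PT_pair => //; apply: PT_pair => //; apply: PT_id.
exists (Seq q (Seq (Pop Q SD) (Seq loop (Pop Q SD)))),
  (fun x => kq x + (5 + esize (l x) * (10 + (esize (l x) + esize x + h x + 4) ^ c))).
split; first by pb.
move=> x d o; set M := (_ + 4) ^ c.
have loopP L a : (forall j, esize (foldl (F x) a (take j L)) <= h x) ->
    esize L <= esize (l x) ->
    runs loop (mem_state (ser (@enc _ _ L) ++ ser (enc (x, a)) ++ d) o) (size L * (10 + M))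
      (mem_state (bit Q false :: ser (enc (x, foldl (F x) a L)) ++ d) o).
  elim: L a => [|y L IH] a ha hL; first exact: runs_stop.
  have {}IH := IH (F x a y).
  have hL' : esize L <= esize (l x).
    by apply: leq_trans hL; rewrite esize_cons; lia.
  have ha' : forall j, esize (foldl (F x) (F x a y) (take j L)) <= h x.
    by move=> j; apply: leq_trans (ha j.+1).
  have {}IH := IH ha' hL'.
  apply: (@runsW _ _ _ ((2 + (M + 1).+1).+1 + size L * (10 + M)).+2);
    last by rewrite /= mulSn; lia.
  apply: runs_while IH => //.
  pose proof (@runs_push Q SD (bit Q true)
     (mem_state (ser (@enc _ _ (y :: L)) ++ ser (@enc _ _ (x, a)) ++ d) o)) as r1.
  apply: runs_seq (r1 _) _ => //.
  have r2 : runs b (mem_state (bit Q true :: ser (enc (y :: L)) ++ ser (enc (x, a)) ++ d) o)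
      (kb ((y, L), (x, a))) (mem_state (ser (enc (body ((y, L), (x, a)))) ++ d) o).
    by rewrite catA; exact: kbc.
  have r3 : runs (Pop Q SD) (mem_state (ser (enc (body ((y, L), (x, a)))) ++ d) o) 1
      (mem_state (ser (enc L) ++ ser (enc (x, F x a y)) ++ d) o).
    by rewrite catA; exact: runs_pop.
  apply: runs_seq _ r3; apply: runsW r2 _.
  apply: leq_trans (kbb _) _; rewrite /M; case: (c) => // c'; rewrite leq_exp2r //.
  rewrite !esize_pair /=; have := ha 0; rewrite take0 /= => ha0.
  by move: hL; rewrite esize_cons; lia.
pose proof (kqc x d o) as r1.
have r2 : runs (Pop Q SD) (mem_state (ser (enc (l x, (x, i x))) ++ d) o) 1
    (mem_state (ser (enc (l x)) ++ ser (enc (x, i x)) ++ d) o).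
  by rewrite catA; exact: runs_pop.
pose proof (loopP (l x) (i x) (hB x) (leqnn _)) as r3.
pose proof (runs_pop SD (mem_state (bit Q false :: ser (enc (x,
  foldl (F x) (i x) (l x))) ++ d) o)) as r4.
apply: runsW (runs_seq r1 (runs_seq r2 (runs_seq r3 r4))) _.
have : size (l x) * (10 + M) <= esize (l x) * (10 + M) by rewrite leq_mul // ltnW // size_esize.
by rewrite -/M; set u := size _ * _; set v := esize _ * _; lia.
Qed.

End Foldl.
End Folds.

(** * Polynomial-time arithmetic and list functions *)

Section Library.
Variable Q : nat.
Local Open Scope nat_scope.

Notation PT f := (@PT Q _ _ _ _ f).

(** The pair of [tt] and [n] has the encoding of [n.+1]. *)
Lemma PT_S {X : Type} {eX : Enc X} (f : X -> nat) : PT f -> PT (fun x => (f x).+1).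
Proof.
move=> pf; have p2 : PT (fun x => (tt, f x)) by apply: PT_pair => //; apply: PT_const.
by apply: (PT_comp (g := fun p : unit * nat => p.2.+1)) p2; apply: PT_reenc.
Qed.

Lemma PT_nat_case {X : Type} {eX : Enc X} (f : X -> nat) (Z : Type) (eZ : Enc Z) (a : X ->
  Z) (b : X * nat -> Z) :
  PT f -> PT a -> PT b -> PT (fun x => if f x is n.+1 then b (x, n) else a x).
Proof.
move=> pf pa pb.
apply: (PT_case_node (f := f) (g0 := a) (g1 := fun p : X * (unit * nat) => b (p.1, p.2.2))) => //.
  apply: (PT_comp (g := b) (f := fun p : X * (unit * nat) => (p.1, p.2.2))) => //.
  by apply: PT_pair; [apply: PT_fst|apply: PT_snd; apply: PT_snd]; apply: PT_id.
by move=> x; case: (f x) => [|n]; [left|right; exists (tt, n)].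
Qed.

Lemma PT_predn {X : Type} {eX : Enc X} (f : X -> nat) : PT f -> PT (fun x => (f x).-1).
Proof.
move=> pf; apply: PT_ext (PT_nat_case (b := fun p => p.2) pf (PT_const Q 0) _).
  by move=> x /=; case: (f x).
by apply: PT_snd; apply: PT_id.
Qed.

Lemma PT_if {X : Type} {eX : Enc X} (Z : Type) (eZ : Enc Z) (c : X -> bool) (a b : X -> Z) :
  PT c -> PT a -> PT b -> PT (fun x => if c x then a x else b x).
Proof.
move=> pc pa pb.
apply: (PT_case_node (f := c) (g0 := b) (g1 := fun p : X * (unit * unit) => a p.1)) => //.
  by apply: (PT_comp (g := a)) => //; apply: PT_fst; apply: PT_id.
by move=> x; case: (c x); [right; exists (tt, tt)|left].
Qed.

Lemma PT_cons {X : Type} {eX : Enc X} (A : Type) (eA : Enc A) (a : X -> A) (l : X -> seq A) :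
  PT a -> PT l -> PT (fun x => a x :: l x).
Proof.
move=> pa pl; have p2 : PT (fun x => (a x, l x)) by apply: PT_pair.
by apply: (PT_comp (g := fun p : A * seq A => p.1 :: p.2)) p2; apply: PT_reenc.
Qed.

Lemma PT_iter {X : Type} {eX : Enc X} (A : Type) (eA : Enc A) (n : X -> nat) (F : X -> A ->
  A) (i : X -> A)
    (h : X -> nat) :
  PT n -> PT i -> PT (fun p : X * A => F p.1 p.2) -> poly_bounded h ->
  (forall x j, j <= n x -> esize (iter j (F x) (i x)) <= h x) ->
  PT (fun x => iter (n x) (F x) (i x)).
Proof.
move=> pn pi pF hb hB.
have iterE x j : iter j (F x) (i x) = foldl (fun a (_ : unit) => F x a) (i x) (nseq j tt).
  elim: j {hB} (i x) => //= j IH a; rewrite -IH -iterSr //.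
apply: (PT_ext (f := fun x => foldl (fun a (_ : unit) => F x a) (i x) (nseq (n x) tt))).
  by move=> x; rewrite iterE.
apply: PT_foldl hb _ => //.
- by apply: (PT_comp (g := fun m : nat => nseq m tt)) pn; apply: PT_reenc => m; rewrite enc_nseq.
- apply: (PT_comp (g := fun p : X * A => F p.1 p.2) (f := fun p : X * (A * unit) =>
  (p.1, p.2.1))) => //.
  by apply: PT_pair; [apply: PT_fst|apply: PT_fst; apply: PT_snd]; apply: PT_id.
- move=> x j; case: (leqP j (n x)) => jn.
    by rewrite take_nseq // -iterE hB.
  by rewrite take_oversize ?size_nseq ?(ltnW jn) // -iterE hB.
Qed.

Lemma pb_nat {X : Type} {eX : Enc X} (f : X -> nat) : PT f -> poly_bounded f.
Proof. by move=> /PT_size/pb_le; apply=> x; rewrite esize_nat -addnn; lia. Qed.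

Lemma PT_iter_nat {X : Type} {eX : Enc X} (n : X -> nat) (F : X -> nat -> nat) (i h : X -> nat) :
  PT n -> PT i -> PT (fun p : X * nat => F p.1 p.2) -> poly_bounded h ->
  (forall x j, j <= n x -> iter j (F x) (i x) <= h x) ->
  PT (fun x => iter (n x) (F x) (i x)).
Proof.
move=> pn pi pF hb hB; apply: (PT_iter (h := fun x => 2 * h x + 1)) => //; first by pb.
by move=> x j /hB; rewrite esize_nat -addnn; lia.
Qed.

Lemma PT_addn {X : Type} {eX : Enc X} (f g : X -> nat) : PT f -> PT g -> PT (fun x => f x + g x).
Proof.
move=> pf pg; apply: (PT_ext (f := fun x => iter (f x) S (g x))).
  by move=> x; rewrite iter_succn addnC.
apply: (PT_iter_nat (h := fun x => f x + g x)) => //.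
- by apply: (PT_S (f := snd)); apply: PT_snd; apply: PT_id.
- by apply: pb_add; apply: pb_nat.
- by move=> x j; rewrite iter_succn; lia.
Qed.

Lemma PT_muln {X : Type} {eX : Enc X} (f g : X -> nat) : PT f -> PT g -> PT (fun x => f x * g x).
Proof.
move=> pf pg; apply: (PT_ext (f := fun x => iter (f x) (addn (g x)) 0)).
  by move=> x; rewrite iter_addn_0 mulnC.
apply: (PT_iter_nat (h := fun x => f x * g x)) => //.
- exact: PT_const.
- apply: PT_addn; last by apply: PT_snd; apply: PT_id.
  by apply: (PT_comp (g := g)) => //; apply: PT_fst; apply: PT_id.
- by apply: pb_mul; apply: pb_nat.
- by move=> x j jf; rewrite iter_addn_0 mulnC leq_mul2r jf orbT.
Qed.

Lemma PT_subn {X : Type} {eX : Enc X} (f g : X -> nat) : PT f -> PT g -> PT (fun x => f x - g x).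
Proof.
move=> pf pg; apply: (PT_ext (f := fun x => iter (g x) predn (f x))).
  by move=> x; rewrite iter_predn.
apply: (PT_iter_nat (h := f)) => //.
- by apply: (PT_predn (f := snd)); apply: PT_snd; apply: PT_id.
- exact: pb_nat.
- by move=> x j _; rewrite iter_predn leq_subr.
Qed.

Lemma PT_leq {X : Type} {eX : Enc X} (f g : X -> nat) : PT f -> PT g -> PT (fun x => f x <= g x).
Proof.
move=> pf pg; apply: (PT_ext (f := fun x => if f x - g x is n.+1 then false else true)).
  by move=> x; rewrite /leq; case: (_ - _).
by apply: (PT_nat_case (b := fun=> false)); [apply: PT_subn|apply: PT_const|apply: PT_const].
Qed.

Lemma PT_andb {X : Type} {eX : Enc X} (a b : X -> bool) : PT a -> PT b -> PT (fun x => a x && b x).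
Proof.
by move=> pa pb; apply: (PT_if (a := b) (b := fun=> false)) => //; apply: PT_const.
Qed.

Lemma PT_eqn {X : Type} {eX : Enc X} (f g : X -> nat) : PT f -> PT g -> PT (fun x => f x == g x).
Proof.
move=> pf pg; apply: (PT_ext (f := fun x => (f x <= g x) && (g x <= f x))).
  by move=> x; rewrite eqn_leq.
by apply: PT_andb; apply: PT_leq.
Qed.

Lemma PT_minn {X : Type} {eX : Enc X} (f g : X -> nat) : PT f -> PT g ->
  PT (fun x => minn (f x) (g x)).
Proof.
move=> pf pg; apply: (PT_ext (f := fun x => f x - (f x - g x))).
  by move=> x; rewrite minnE.
by apply: PT_subn => //; apply: PT_subn.
Qed.

(** Division by counting. For [d = 0] the remainder is never reset, in accordance with [m %/ 0 = 0]
    and [m %% 0 = m]. *)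
Definition div_step (d : nat) (p : nat * nat) : nat * nat :=
  if p.2.+1 == d then (p.1.+1, 0) else (p.1, p.2.+1).

Lemma iter_div_step d m : iter m (div_step d) (0, 0) = (m %/ d, m %% d).
Proof.
elim: m => [|m IH]; first by rewrite div0n mod0n.
rewrite iterS IH /div_step /=; case: (posnP d) => [->|d0].
  by rewrite !divn0 !modn0.
have := ltn_pmod m d0; rewrite leq_eqVlt => /predU1P[e|lt].
  have -> : m.+1 = (m %/ d).+1 * d.
    by rewrite mulSn [in LHS](divn_eq m d) -addnS e addnC.
  by rewrite e eqxx mulnK // modnMl.
rewrite ltn_eqF //; have -> : m.+1 = m %/ d * d + (m %% d).+1.
  by rewrite addnS -divn_eq.
by rewrite divnMDl // modnMDl [_.+1 %/ d]divn_small // addn0 [_.+1 %% d]modn_small.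
Qed.

Lemma PT_edivn {X : Type} {eX : Enc X} (f g : X -> nat) : PT f -> PT g ->
  PT (fun x => (f x %/ g x, f x %% g x)).
Proof.
move=> pf pg; apply: (PT_ext (f := fun x => iter (f x) (div_step (g x)) (0, 0))).
  by move=> x; rewrite iter_div_step.
apply: (PT_iter (h := fun x => 4 * f x + 3)) => //.
- exact: PT_const.
- have px : PT (fun p : X * (nat * nat) => p) by apply: PT_id.
  have p1 : PT (fun p : X * (nat * nat) => p.2.1) by apply: PT_fst; apply: PT_snd.
  have p2 : PT (fun p : X * (nat * nat) => p.2.2.+1) by apply: PT_S; apply: PT_snd; apply: PT_snd.
  have pg' : PT (fun p : X * (nat * nat) => g p.1) by apply: (PT_comp (g := g)) => //;
    apply: PT_fst.
  apply: PT_if; first exact: PT_eqn.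
    by apply: PT_pair; [exact: PT_S|exact: PT_const].
  exact: PT_pair.
- by have := pb_nat pf => ?; pb.
- move=> x j jf; rewrite iter_div_step esize_pair !esize_nat /=.
  by have := leq_div j (g x); have := leq_mod j (g x); lia.
Qed.

Lemma PT_divn {X : Type} {eX : Enc X} (f g : X -> nat) : PT f -> PT g -> PT (fun x => f x %/ g x).
Proof. by move=> pf pg; exact: PT_fst (PT_edivn pf pg). Qed.

Lemma PT_modn {X : Type} {eX : Enc X} (f g : X -> nat) : PT f -> PT g -> PT (fun x => f x %% g x).
Proof. by move=> pf pg; exact: PT_snd (PT_edivn pf pg). Qed.

Lemma esize_rev {Y : Type} {eY : Enc Y} (s : seq Y) : esize (rev s) = esize s.
Proof.
elim: s => // y s IH; rewrite rev_cons -cats1 esize_cons; apply: succn_inj.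
by rewrite esize_cat IH esize_cons; rewrite {3}/esize /=; lia.
Qed.

Lemma PT_catrev {X Y : Type} {eX : Enc X} {eY : Enc Y} (l l' : X -> seq Y) : PT l -> PT l' ->
  PT (fun x => catrev (l x) (l' x)).
Proof.
move=> pl pl'; apply: (PT_ext (f := fun x => foldl (fun a y => y :: a) (l' x) (l x))).
  by move=> x; elim: (l x) (l' x) => //= y s IH a; rewrite IH.
apply: (PT_foldl (h := fun x => esize (l' x) + esize (l x))) => //.
- apply: PT_cons; first by apply: PT_snd; apply: PT_snd; apply: PT_id.
  by apply: PT_fst; apply: PT_snd; apply: PT_id.
- by have := PT_size pl; have := PT_size pl' => *; pb.
- move=> x j; elim: (l x) (l' x) j => [|y s IH] a [|j] //=; rewrite ?take0 /=; try lia.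
  by apply: leq_trans (IH _ _) _; rewrite !esize_cons; lia.
Qed.

Lemma PT_rev {X Y : Type} {eX : Enc X} {eY : Enc Y} (l : X -> seq Y) : PT l ->
  PT (fun x => rev (l x)).
Proof. by move=> pl; apply: PT_catrev => //; apply: PT_const. Qed.

Lemma PT_cat {X Y : Type} {eX : Enc X} {eY : Enc Y} (l l' : X -> seq Y) : PT l -> PT l' ->
  PT (fun x => l x ++ l' x).
Proof.
move=> pl pl'; apply: (PT_ext (f := fun x => catrev (rev (l x)) (l' x))).
  by move=> x; rewrite catrevE revK.
by apply: PT_catrev => //; apply: PT_rev.
Qed.

Lemma PT_size_seq {X Y : Type} {eX : Enc X} {eY : Enc Y} (l : X -> seq Y) : PT l ->
  PT (fun x => size (l x)).
Proof.
move=> pl; apply: (PT_ext (f := fun x => foldl (fun n (_ : Y) => n.+1) 0 (l x))).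
  by move=> x; rewrite -[RHS]add0n; elim: (l x) 0 => //= [|y s IH] n; rewrite ?addn0 // IH addSnnS.
apply: (PT_foldl (h := fun x => 2 * esize (l x) + 1)) => //.
- exact: PT_const.
- by apply: PT_S; apply: PT_fst; apply: PT_snd; apply: PT_id.
- by have := PT_size pl => ?; pb.
- move=> x j; have -> : foldl (fun n (_ : Y) => n.+1) 0 (take j (l x)) = 0 + size (take j (l x)).
    by elim: (take _ _) 0 => //= [|y s IH] n; rewrite ?addn0 // IH addSnnS.
  pose proof (size_esize _ (l x)) as sz.
  by rewrite esize_nat -addnn size_take; move: sz; case: (ltnP j (size (l x))) => *; lia.
Qed.

Lemma esize_drop {Y : Type} {eY : Enc Y} j (s : seq Y) : esize (drop j s) <= esize s.
Proof. by elim: s j => [|y s IH] [|j] //=; rewrite esize_cons; have := IH j; lia. Qed.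

Lemma PT_behead {X Y : Type} {eX : Enc X} {eY : Enc Y} (l : X -> seq Y) : PT l ->
  PT (fun x => behead (l x)).
Proof.
move=> pl; apply: (PT_case_node (f := l) (g0 := fun=> [::]) (g1 := fun p : X * (Y * seq Y) =>
  p.2.2)) => //.
- exact: PT_const.
- by apply: PT_snd; apply: PT_snd; apply: PT_id.
- by move=> x; case: (l x) => [|y s]; [left|right; exists (y, s)].
Qed.

Lemma PT_head {X Y : Type} {eX : Enc X} {eY : Enc Y} (y0 : Y) (l : X -> seq Y) : PT l ->
  PT (fun x => head y0 (l x)).
Proof.
move=> pl; apply: (PT_case_node (f := l) (g0 := fun=> y0) (g1 := fun p : X * (Y * seq Y) =>
  p.2.1)) => //.
- exact: PT_const.
- by apply: PT_fst; apply: PT_snd; apply: PT_id.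
- by move=> x; case: (l x) => [|y s]; [left|right; exists (y, s)].
Qed.

Lemma PT_drop {X Y : Type} {eX : Enc X} {eY : Enc Y} (n : X -> nat) (l : X -> seq Y) : PT n ->
  PT l -> PT (fun x => drop (n x) (l x)).
Proof.
have dE j (s : seq Y) : iter j behead s = drop j s.
  by elim: j s => [|j IH] [|y s] //=; rewrite -iterS iterSr IH //; case: (j).
move=> pn pl; apply: (PT_ext (f := fun x => iter (n x) behead (l x))).
  by move=> x; rewrite dE.
apply: (PT_iter (h := fun x => esize (l x))) => //.
- by apply: PT_behead; apply: PT_snd; apply: PT_id.
- exact: PT_size pl.
- by move=> x j _; rewrite dE esize_drop.
Qed.

Lemma PT_take {X Y : Type} {eX : Enc X} {eY : Enc Y} (n : X -> nat) (l : X -> seq Y) : PT n ->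
  PT l -> PT (fun x => take (n x) (l x)).
Proof.
move=> pn pl; apply: (PT_ext (f := fun x => rev (drop (size (l x) - n x) (rev (l x))))).
  move=> x; rewrite -[in LHS]size_rev -take_rev revK //.
apply: PT_rev; apply: PT_drop; last exact: PT_rev.
by apply: PT_subn => //; apply: PT_size_seq.
Qed.

Lemma PT_nth {X Y : Type} {eX : Enc X} {eY : Enc Y} (y0 : Y) (n : X -> nat) (l : X ->
  seq Y) : PT n -> PT l -> PT (fun x => nth y0 (l x) (n x)).
Proof.
move=> pn pl; apply: (PT_ext (f := fun x => head y0 (drop (n x) (l x)))).
  by move=> x; rewrite -nth0 nth_drop addn0.
by apply: PT_head; apply: PT_drop.
Qed.

Lemma esize_map {Y Z : Type} {eY : Enc Y} {eZ : Enc Z} (G : Y ->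
  Z) s N M : (forall y, esize y <= N -> esize (G y) <= M) ->
  esize s <= N -> esize (map G s) <= size s * M.+1 + 1.
Proof.
move=> hG; elim: s => [|y s IH] //=; rewrite esize_cons => hN.
rewrite esize_cons mulSn; have := hG y; have := IH.
by rewrite /= in hN *; lia.
Qed.

Lemma PT_map {X Y Z : Type} {eX : Enc X} {eY : Enc Y} {eZ : Enc Z} (G : X -> Y -> Z) (l : X ->
  seq Y) :
  PT (fun p : X * Y => G p.1 p.2) -> PT l -> PT (fun x => map (G x) (l x)).
Proof.
move=> pG pl; have [c hc] := PT_size pG; have sl := PT_size pl.
have fE x a s : foldl (fun a y => G x y :: a) a s = rev (map (G x) s) ++ a.
  by elim: s a => //= y s IH a; rewrite IH rev_cons cat_rcons.
apply: (PT_ext (f := fun x => rev (foldl (fun a y => G x y :: a) [::] (l x)))).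
  by move=> x; rewrite fE cats0 revK.
apply: PT_rev; apply: (PT_foldl (h := fun x => esize (l x) * ((esize x + esize (l x) + 3) ^ c +
  1) + 1)) => //.
- exact: PT_const.
- apply: PT_cons; last by apply: PT_fst; apply: PT_snd; apply: PT_id.
  apply: (PT_comp (g := fun p : X * Y => G p.1 p.2) (f := fun p : X * (seq Z * Y) =>
    (p.1, p.2.2))) => //.
  apply: PT_pair; first by apply: PT_fst; apply: PT_id.
  by apply: PT_snd; apply: PT_snd; apply: PT_id.
- by pb.
- move=> x j; set M := _ ^ c; rewrite fE cats0.
  rewrite esize_rev; apply: leq_trans (esize_map (N := esize (l x)) (M := M) _ _) _.
  + move=> y hy; apply: leq_trans (hc (x, y)) _; rewrite esize_pair /M.
    by case: (c) => // c'; rewrite leq_exp2r //= ; lia.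
  + by elim: (l x) j => [|y s IH] [|j] //=; rewrite !esize_cons; have := IH j; lia.
  + pose proof (size_esize _ (l x)) as sz; rewrite leq_add2r addn1 leq_mul // size_take.
    by move: sz; case: (ltnP j (size (l x))) => *; lia.
Qed.

Lemma PT_filter {X Y : Type} {eX : Enc X} {eY : Enc Y} (c : X -> Y -> bool) (l : X -> seq Y) :
  PT (fun p : X * Y => c p.1 p.2) -> PT l -> PT (fun x => seq.filter (c x) (l x)).
Proof.
move=> pc pl; have sl := PT_size pl.
have fE x a s : foldl (fun a y => if c x y then y :: a else a) a s = rev (seq.filter (c x) s) ++ a.
  elim: s a => //= y s IH a; rewrite IH; case: (c x y) => //=.
  by rewrite rev_cons cat_rcons.
apply: (PT_ext (f := fun x => rev (foldl (fun a y => if c x y then y :: a else a) [::] (l x)))).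
  by move=> x; rewrite fE cats0 revK.
apply: PT_rev; apply: (PT_foldl (h := fun x => esize (l x))) => //.
- exact: PT_const.
- apply: PT_if; last by apply: PT_fst; apply: PT_snd; apply: PT_id.
    apply: (PT_comp (g := fun p : X * Y => c p.1 p.2) (f := fun p : X * (seq Y * Y) =>
      (p.1, p.2.2))) => //.
    apply: PT_pair; first by apply: PT_fst; apply: PT_id.
    by apply: PT_snd; apply: PT_snd; apply: PT_id.
  apply: PT_cons; last by apply: PT_fst; apply: PT_snd; apply: PT_id.
  by apply: PT_snd; apply: PT_snd; apply: PT_id.
- move=> x j; rewrite fE cats0 esize_rev; elim: (l x) j => [|y s IH] [|j] //=.
  by case: ifP => _; rewrite !esize_cons; have := IH j; lia.
Qed.

Lemma PT_flatten {X Y : Type} {eX : Enc X} {eY : Enc Y} (l : X -> seq (seq Y)) : PT l ->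
  PT (fun x => flatten (l x)).
Proof.
move=> pl; have sl := PT_size pl.
have fE s (a : seq Y) : foldl (fun a (y : seq Y) => y ++ a) a s = flatten (rev s) ++ a.
  elim: s a => //= y s IH a; rewrite IH rev_cons -cats1 flatten_cat /=.
  by rewrite cats0 catA.
apply: (PT_ext (f := fun x => foldl (fun a (y : seq Y) => y ++ a) [::] (rev (l x)))).
  by move=> x; rewrite fE revK cats0.
apply: (PT_foldl (h := fun x => esize (l x))) => //.
- exact: PT_rev.
- exact: PT_const.
- apply: PT_cat; first by apply: PT_snd; apply: PT_snd; apply: PT_id.
  by apply: PT_fst; apply: PT_snd; apply: PT_id.
- move=> x j; rewrite fE cats0 take_rev revK.
  apply: leq_trans (esize_drop (size (l x) - j) (l x)).
  elim: (drop _ _) => //= y s IH; rewrite esize_cons.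
  by pose proof (esize_cat _ y (flatten s)); lia.
Qed.

Lemma PT_iota {X : Type} {eX : Enc X} (f : X -> nat) : PT f -> PT (fun x => iota 0 (f x)).
Proof.
move=> pf; have hf := pb_nat pf.
have iE n : iter n (fun s => size s :: s) [::] = rev (iota 0 n).
  by elim: n => // n IH; rewrite iterS IH size_rev size_iota -addn1 iotaD rev_cat.
apply: (PT_ext (f := fun x => rev (iter (f x) (fun s => size s :: s) [::]))).
  by move=> x; rewrite iE revK.
apply: PT_rev; apply: (PT_iter (h := fun x => f x * (2 * f x + 2) + 1)) => //.
- exact: PT_const.
- by apply: PT_cons; [apply: PT_size_seq|]; apply: PT_snd; apply: PT_id.
- by pb.
- move=> x j jf; rewrite iE esize_rev.
  have hj m k : esize (iota m k) <= k * (2 * (m + k) + 2) + 1.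
    elim: k m => [|k IH] m //=; rewrite esize_cons esize_nat -addnn.
    by have := IH m.+1; nia.
  by apply: leq_trans (hj _ _) _; nia.
Qed.

Lemma PT_sumn {X : Type} {eX : Enc X} (l : X -> seq nat) : PT l -> PT (fun x => sumn (l x)).
Proof.
move=> pl; have sl := PT_size pl.
have fE s a : foldl addn a s = a + sumn s by elim: s a => [|y s IH] a /=;
  [rewrite addn0|rewrite IH addnA].
apply: (PT_ext (f := fun x => foldl addn 0 (l x))).
  by move=> x; rewrite fE.
apply: (PT_foldl (h := fun x => esize (l x) * 2 + 1)) => //.
- exact: PT_const.
- by apply: PT_addn; [apply: PT_fst|apply: PT_snd]; apply: PT_snd; apply: PT_id.
- by pb.
- move=> x j; rewrite fE add0n esize_nat -addnn.
  have aux : sumn (take j (l x)) <= esize (l x); last by lia.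
  elim: (l x) j => [|y s IH] [|j] //=; rewrite esize_cons esize_nat -addnn.
  by have := IH j; lia.
Qed.

(** A bound on [F] for every accumulator bounds all partial results at once; the minima and moduli
    in the folds of the decoder provide it. *)
Lemma PT_foldr_nat {X : Type} {eX : Enc X} (Y : Type) (eY : Enc Y) (F : X -> Y -> nat ->
  nat) (f : X -> nat) (l : X -> seq Y) (h : X -> nat) :
  PT l -> PT f -> PT (fun p : X * (nat * Y) => F p.1 p.2.2 p.2.1) -> poly_bounded h ->
  (forall x y a, F x y a <= h x) ->
  PT (fun x => foldr (F x) (f x) (l x)).
Proof.
move=> pl pf pF hb hB; have sl := PT_size pl; have hf := pb_nat pf.
apply: (PT_ext (f := fun x => foldl (fun a y => F x y a) (f x) (rev (l x)))).
  by move=> x; rewrite foldl_rev.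
apply: (PT_foldl (h := fun x => 2 * (f x + h x) + 1)) => //.
- exact: PT_rev.
- by pb.
- move=> x j; rewrite esize_nat -addnn.
  suff: foldl (fun a y => F x y a) (f x) (take j (rev (l x))) <= f x + h x by lia.
  case/lastP: (take _ _) => [|s y] /=; first by lia.
  by rewrite -cats1 foldl_cat /=; apply: leq_trans (hB _ _ _) _; lia.
Qed.

End Library.

(** * The decoding algorithm *)

Ltac pt_user := fail.

Ltac pt_step :=
  lazymatch goal with
  | |- @PT _ _ _ _ _ (fun x => x) => exact: PT_id
  | |- @PT _ _ _ _ _ (fun _ => ?c) => exact: PT_const
  | |- @PT _ _ _ _ _ size => apply: (PT_size_seq (l := fun x => x))
  | |- @PT _ _ _ _ _ fst => apply: (PT_fst (f := fun x => x))
  | |- @PT _ _ _ _ _ snd => apply: (PT_snd (f := fun x => x))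
  | |- @PT _ _ _ _ _ (fun x => (@?f x).1) => apply: PT_fst
  | |- @PT _ _ _ _ _ (fun x => (@?f x).2) => apply: PT_snd
  | |- @PT _ _ _ _ _ (fun x => (@?f x, @?g x)) => apply: PT_pair
  | |- @PT _ _ _ _ _ (fun x => S (@?f x)) => apply: PT_S
  | |- @PT _ _ _ _ _ (fun x => predn (@?f x)) => apply: PT_predn
  | |- @PT _ _ _ _ _ (fun x => addn (@?f x) (@?g x)) => apply: PT_addn
  | |- @PT _ _ _ _ _ (fun x => subn (@?f x) (@?g x)) => apply: PT_subn
  | |- @PT _ _ _ _ _ (fun x => muln (@?f x) (@?g x)) => apply: PT_muln
  | |- @PT _ _ _ _ _ (fun x => minn (@?f x) (@?g x)) => apply: PT_minn
  | |- @PT _ _ _ _ _ (fun x => divn (@?f x) (@?g x)) => apply: PT_divn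
  | |- @PT _ _ _ _ _ (fun x => modn (@?f x) (@?g x)) => apply: PT_modn
  | |- @PT _ _ _ _ _ (fun x => leq (@?f x) (@?g x)) => apply: PT_leq
  | |- @PT _ _ _ _ _ (fun x => @eq_op _ (@?f x) (@?g x)) => apply: PT_eqn
  | |- @PT _ _ _ _ _ (fun x => if _ then _ else _) => apply: PT_if
  | |- @PT _ _ _ _ _ (fun x => (@?a x) :: (@?l x)) => apply: PT_cons
  | |- @PT _ _ _ _ _ (fun x => (@?a x) ++ (@?l x)) => apply: PT_cat
  | |- @PT _ _ _ _ _ (fun x => head _ (@?l x)) => apply: PT_head
  | |- @PT _ _ _ _ _ (fun x => behead (@?l x)) => apply: PT_behead
  | |- @PT _ _ _ _ _ (fun x => size (@?l x)) => apply: PT_size_seq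
  | |- @PT _ _ _ _ _ (fun x => drop (@?n x) (@?l x)) => apply: PT_drop
  | |- @PT _ _ _ _ _ (fun x => take (@?n x) (@?l x)) => apply: PT_take
  | |- @PT _ _ _ _ _ (fun x => nth _ (@?l x) (@?n x)) => apply: PT_nth
  | |- @PT _ _ _ _ _ (fun x => map (@?G x) (@?l x)) => apply: PT_map
  | |- @PT _ _ _ _ _ (fun x => seq.filter (@?G x) (@?l x)) => apply: PT_filter
  | |- @PT _ _ _ _ _ (fun x => flatten (@?l x)) => apply: PT_flatten
  | |- @PT _ _ _ _ _ (fun x => iota 0 (@?n x)) => apply: PT_iota
  | |- @PT _ _ _ _ _ (fun x => sumn (@?l x)) => apply: PT_sumn
  | _ => first [ assumption | pt_user
     | lazymatch goal with
       | H : @PT _ _ _ _ _ ?u |- @PT _ _ _ _ _ (fun x => ?u x) => exact: H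
       end
     | match goal with
       | H : @PT _ _ _ _ _ ?u |- @PT _ _ _ _ _ (fun x => ?u (@?f x)) =>
         apply: (PT_comp (g := u) (f := f) H)
       end ]
  end.
Ltac pt := repeat (cbv beta; pt_step).

Section Algorithm.
Variable Q0 : nat. (* machine alphabet *)
Local Open Scope nat_scope.
Notation PTQ f := (@PT Q0 _ _ _ _ f).

(** Repeated division keeps the intermediate values below [x], whereas [b ^ e] in unary could be
    exponentially large. *)
Definition digit (b e x : nat) : nat := iter e (fun y => y %/ b) x %% b.

Lemma digitE b e x : digit b e x = (x %/ b ^ e) %% b.
Proof.
rewrite /digit; congr (_ %% _); elim: e => [|e IH]; first by rewrite expn0 divn1.
by rewrite iterS IH -divnMA mulnC -expnS.
Qed.

Lemma PT_digit {X : Type} {eX : Enc X} (b e x : X -> nat) : PTQ b -> PTQ e -> PTQ x ->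
  PTQ (fun p => digit (b p) (e p) (x p)).
Proof.
move=> pb pe px; apply: PT_modn => //.
apply: (PT_iter_nat (h := x)) => //; first by pt.
  exact: (pb_nat px).
move=> p j _; elim: j => // j IH /=.
by apply: leq_trans (leq_div _ _) IH.
Qed.

(* Arithmetic modulo [p.+1], so that the modulus is never zero. *)
Definition expm (p a e : nat) : nat := iter e (fun y => (y * a) %% p.+1) 1.

Lemma expmE p a e : expm p a e = a ^ e %[mod p.+1].
Proof.
elim: e => // e IH; rewrite /expm iterS -/(expm _ _ _) modn_mod expnS mulnC.
by rewrite -modnMmr IH modnMmr.
Qed.

Lemma PT_expm {X : Type} {eX : Enc X} (p a e : X -> nat) : PTQ p -> PTQ a -> PTQ e ->
  PTQ (fun x => expm (p x) (a x) (e x)).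
Proof.
move=> pp pa pe; apply: (PT_iter_nat (h := fun x => p x + 1)) => //; first exact: PT_const.
- by pt.
- by have := pb_nat pp => ?; pb.
- by move=> x [|j] _ /=; [lia|rewrite addn1 ltnW // ltn_pmod].
Qed.

(** Horner's rule for the polynomial with coefficients [cs], the constant term first. *)
Definition hash (p : nat) (cs : seq nat) (x : nat) : nat :=
  foldr (fun c a => (c + x * a) %% p.+1) 0 cs.

Lemma PT_hash {X : Type} {eX : Enc X} (p : X -> nat) (cs : X -> seq nat) (x : X -> nat) :
  PTQ p -> PTQ cs -> PTQ x -> PTQ (fun y => hash (p y) (cs y) (x y)).
Proof.
move=> pp pc px; apply: (PT_foldr_nat (F := fun y c a => (c + x y * a) %% (p y).+1) (h := p)) =>
  //; first exact: PT_const.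
- by pt.
- exact: (pb_nat pp).
- by move=> y c a; rewrite -ltnS ltn_pmod.
Qed.

Ltac pt_user ::= lazymatch goal with
  | |- @PT _ _ _ _ _ (fun x => digit (@?a x) (@?b x) (@?c x)) => apply: PT_digit
  | |- @PT _ _ _ _ _ (fun x => expm (@?a x) (@?b x) (@?c x)) => apply: PT_expm
  | |- @PT _ _ _ _ _ (fun x => hash (@?a x) (@?b x) (@?c x)) => apply: PT_hash
  end.

(* Parameters of the code family: inner alphabet size, right degree, list size
   of the inner code, folding, window, order of the interpolation polynomial, and
   degree factor. *)
Variables q0 d l m m' s w : nat.

(* The decoder tries every list [u] of numbers below a power of the block length;
   the entries stand for the following data of the code. *)
Definition g_q (u : seq nat) := nth 0 u 0.       (* field size minus one *)
Definition g_gamma (u : seq nat) := nth 0 u 1.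
Definition g_P (u : seq nat) := nth 0 u 2.       (* hash modulus minus one *)
Definition g_k (u : seq nat) := nth 0 u 3.
Definition g_m0 (u : seq nat) := nth 0 u 4.
Definition g_beta (u : seq nat) := nth 0 u 5.
Definition g_seed (u : seq nat) := nth 0 u 6.
Definition g_tau (u : seq nat) := nth 0 u 7.
Definition g_low (u : seq nat) := nth 0 u 8.
Definition g_K (u : seq nat) := nth 0 u 9.
Definition g_deg (u : seq nat) := nth 0 u 10.
Definition g_cap (u : seq nat) := nth 0 u 11.
Definition g_hash (u : seq nat) := drop 12 u.

(** Bitwise addition modulo 2 of [i] and the window of the seed at position [e]. Edge [e] of the
    left vertex [i] ends at the right vertex [neighbor u e i * beta + e %/ d], in slot [e %% d]. The
    addition is an involution in [i], so the same function follows edges in both directions. The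
    minimum keeps wrong guesses polynomial. *)
Definition neighbor (u : seq nat) (e i : nat) : nat :=
  foldr (fun t a => minn (g_m0 u) ((digit 2 t i + digit 2 (e + t) (g_seed u)) %% 2 + 2 * a))
    0 (iota 0 (g_k u)).

Definition inner (u : seq nat) (x e : nat) : nat := digit q0 e (hash (g_P u) (g_hash u) x).

Definition agreement (g u : seq nat) (i x : nat) : nat :=
  size [seq e <- iota 0 (d * g_beta u) |
    digit q0 (e %% d) (nth 0 g (neighbor u e i * g_beta u + e %/ d)) == inner u x e].

(** The truncation bounds the number of equations outright; with a good inner code at most [l]
    values reach the threshold, so the correct one survives. *)
Definition candidates (g u : seq nat) (i : nat) : seq nat :=
  take l [seq x <- iota 0 (g_K u) | g_tau u <= agreement g u i x].

Definition point (u : seq nat) (e h : nat) : nat := expm (g_q u) (g_gamma u) (e * h).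

(** Position [h * s + j] belongs to the coefficient of X^h in A_j. If [x] is the symbol of f at [i],
    its digits [t + j] are the values f(gamma^(i m + t + j)), and orthogonality to the row says that
    sum_j A_j(X) f(gamma^j X) vanishes at gamma^(i m + t). *)
Definition row (u : seq nat) (i x t : nat) : seq nat :=
  flatten [seq [seq (point u (i * m + t) h * digit (g_q u).+1 (t + j) x) %% (g_q u).+1
    | j <- iota 0 s] | h <- iota 0 (w * g_m0 u)].

Definition rows (g u : seq nat) : seq (seq nat) :=
  flatten [seq flatten [seq [seq row u i x t | t <- iota 0 m'] | x <- candidates g u i]
    | i <- iota 0 (g_m0 u)].

Definition dotm (p n : nat) (v z : seq nat) : nat :=
  sumn [seq nth 0 v a * nth 0 z a | a <- iota 0 n] %% p.+1.

Definition nonorthogonal p n v (L : seq (seq nat)) := [seq z <- L | 0 < dotm p n v z].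

(** One step of elimination without division: a vector of [L] that violates the new equation [v]
    serves as pivot and is dropped, and a multiple of it corrects the others after cross
    multiplication. *)
Definition eliminate (p n : nat) (v : seq nat) (L : seq (seq nat)) : seq (seq nat) :=
  if size (nonorthogonal p n v L) == 0 then L else
  [seq [seq (dotm p n v (head [::] (nonorthogonal p n v L)) * nth 0 z a +
             (p.+1 - dotm p n v z) * nth 0 (head [::] (nonorthogonal p n v L)) a) %% p.+1
        | a <- iota 0 n]
  | z <- [seq z <- L | dotm p n v z == 0] ++ behead (nonorthogonal p n v L)].

Definition unit_vectors (n : nat) : seq (seq nat) :=
  [seq [seq if a == b then 1 else 0 | b <- iota 0 n] | a <- iota 0 n].

Definition unknowns (u : seq nat) : nat := s * (w * g_m0 u).

Definition kernel (g u : seq nat) : seq nat :=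
  head [::] (foldl (fun L v => eliminate (g_q u) (unknowns u) v L)
                   (unit_vectors (unknowns u)) (rows g u)).

(** The tested quantity is the coefficient of X^(low + i) in sum_j A_j(X) f(gamma^j X). *)
Definition coefficient_vanishes (u z f : seq nat) (i : nat) : bool :=
  sumn [seq sumn [seq nth 0 z (h * s + j) * point u j (g_low u + i - h) *
                      nth 0 f (g_low u + i - h) | j <- iota 0 s]
       | h <- iota 0 (g_low u + i).+1] %% (g_q u).+1 == 0.

(** For a wrong guess each step could multiply the number of prefixes by the field size; [g_cap]
    prevents this. *)
Definition extend (u z : seq nat) (i : nat) (L : seq (seq nat)) : seq (seq nat) :=
  take (g_cap u) (flatten [seq [seq f ++ [:: v] | v <-
    [seq v <- iota 0 (g_q u).+1 | coefficient_vanishes u z (f ++ [:: v]) i]] | f <- L]).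

Definition recover (g u : seq nat) : seq (seq nat) :=
  foldl (fun L i => extend u (kernel g u) i L) [:: [::]] (iota 0 (g_deg u)).

Definition block_value (u f : seq nat) (i t : nat) : nat :=
  sumn [seq nth 0 f h * point u (i * m + t) h | h <- iota 0 (g_deg u)] %% (g_q u).+1.

Definition block (u f : seq nat) (i : nat) : nat :=
  foldr (fun t a => minn (g_K u) (block_value u f i t + (g_q u).+1 * a)) 0 (iota 0 m).

(** The right vertex [r] is the pair of [r %/ beta] and [r %% beta]. Its letter packs the inner
    letters that arrive on its [d] edges, as digits in base [q0]. *)
Definition letter (u f : seq nat) (r : nat) : nat :=
  foldr (fun j a => (inner u (block u f (neighbor u (r %% g_beta u * d + j) (r %/ g_beta u)))
                       (r %% g_beta u * d + j) + q0 * a) %% (q0 ^ d))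
    0 (iota 0 d).

Definition word (n : nat) (u f : seq nat) : seq nat := [seq letter u f r | r <- iota 0 n].

Fixpoint tuples (k n : nat) : seq (seq nat) :=
  if k is k'.+1 then flatten [seq [seq x :: t | t <- tuples k' n] | x <- iota 0 n]
  else [:: [::]].

Definition decode (k c : nat) (g : seq nat) : seq (seq nat) :=
  flatten [seq [seq word (size g) u f | f <- recover g u] | u <- tuples k (size g ^ c)].

Ltac unfold_guess := rewrite /g_q /g_gamma /g_P /g_k /g_m0 /g_beta /g_seed /g_tau /g_low
  /g_K /g_deg /g_cap /g_hash.

Section Efficiency.
Context {X : Type} {eX : Enc X}.

Lemma PT_neighbor (u : X -> seq nat) (e i : X -> nat) :
  PTQ u -> PTQ e -> PTQ i -> PTQ (fun a => neighbor (u a) (e a) (i a)).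
Proof.
move=> pu pe pi.
pose F (a : X) (t b : nat) :=
  minn (g_m0 (u a)) ((digit 2 t (i a) + digit 2 (e a + t) (g_seed (u a))) %% 2 + 2 * b).
apply: (PT_foldr_nat (F := F) (h := fun a => g_m0 (u a))); rewrite /F; unfold_guess.
- by pt.
- by pt.
- by pt.
- by apply: (@pb_nat Q0); pt.
- by move=> a b b'; apply: geq_minl.
Qed.

Lemma PT_inner (u : X -> seq nat) (x e : X -> nat) :
  PTQ u -> PTQ x -> PTQ e -> PTQ (fun a => inner (u a) (x a) (e a)).
Proof. by move=> *; rewrite /inner; unfold_guess; pt. Qed.

Lemma PT_point (u : X -> seq nat) (e h : X -> nat) :
  PTQ u -> PTQ e -> PTQ h -> PTQ (fun a => point (u a) (e a) (h a)).
Proof. by move=> *; rewrite /point; unfold_guess; pt. Qed.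

Lemma PT_dotm (p n : X -> nat) (v z : X -> seq nat) :
  PTQ p -> PTQ n -> PTQ v -> PTQ z -> PTQ (fun a => dotm (p a) (n a) (v a) (z a)).
Proof. by move=> *; rewrite /dotm; pt. Qed.

End Efficiency.

Ltac pt_user ::= lazymatch goal with
  | |- @PT _ _ _ _ _ (fun x => digit (@?a x) (@?b x) (@?c x)) => apply: PT_digit
  | |- @PT _ _ _ _ _ (fun x => expm (@?a x) (@?b x) (@?c x)) => apply: PT_expm
  | |- @PT _ _ _ _ _ (fun x => hash (@?a x) (@?b x) (@?c x)) => apply: PT_hash
  | |- @PT _ _ _ _ _ (fun x => neighbor (@?a x) (@?b x) (@?c x)) => apply: PT_neighbor
  | |- @PT _ _ _ _ _ (fun x => inner (@?a x) (@?b x) (@?c x)) => apply: PT_inner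
  | |- @PT _ _ _ _ _ (fun x => point (@?a x) (@?b x) (@?c x)) => apply: PT_point
  | |- @PT _ _ _ _ _ (fun x => dotm (@?a x) (@?b x) (@?c x) (@?e x)) => apply: PT_dotm
  end.

Lemma PT_rows {X : Type} {eX : Enc X} (g u : X -> seq nat) :
  PTQ g -> PTQ u -> PTQ (fun a => rows (g a) (u a)).
Proof. by move=> *; rewrite /rows /row /candidates /agreement; unfold_guess; pt. Qed.

Lemma PT_eliminate {X : Type} {eX : Enc X} (p n : X -> nat) (v : X -> seq nat)
    (L : X -> seq (seq nat)) :
  PTQ p -> PTQ n -> PTQ v -> PTQ L -> PTQ (fun a => eliminate (p a) (n a) (v a) (L a)).
Proof. by move=> *; rewrite /eliminate /nonorthogonal; pt. Qed.

Definition bounded_entries (n p : nat) (L : seq (seq nat)) : bool :=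
  (size L <= n) && all (fun z : seq nat => (size z <= n) && all (fun y => y <= p.+1) z) L.

Lemma esize_bounded n p L : bounded_entries n p L ->
  esize L <= n * (n * (2 * p.+1 + 2) + 2) + 1.
Proof.
case/andP=> sL aL; set M := n * (2 * p.+1 + 2).
have hM z : (size z <= n) && all (fun y => y <= p.+1) z -> esize z <= M + 1.
  case/andP=> sz az; rewrite /M; apply: (@leq_trans (size z * (2 * p.+1 + 2) + 1)); last first.
    by rewrite leq_add2r leq_mul2r sz orbT.
  elim: z az {sz} => //= y z IH /andP[hy /IH hz].
  by rewrite esize_cons esize_nat -addnn; move: hz; rewrite mulSn; set T := size z * _; lia.
apply: (@leq_trans (size L * (M + 2) + 1)); last by rewrite leq_add2r leq_mul2r sL orbT.
elim: L aL {sL} => //= z L IH /andP[/hM hz /IH hL].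
by rewrite esize_cons mulSn; move: hL hz; set T := size L * _; lia.
Qed.

Lemma bounded_eliminate n p v L : bounded_entries n p L -> bounded_entries n p (eliminate p n v L).
Proof.
case/andP=> sL aL; rewrite /eliminate; case: ifP => _; first by rewrite /bounded_entries sL.
apply/andP; split.
  rewrite size_map size_cat size_behead; apply: leq_trans sL.
  apply: (@leq_trans (size [seq z <- L | dotm p n v z == 0] + size (nonorthogonal p n v L))).
    by rewrite leq_add2l leq_pred.
  rewrite /nonorthogonal !size_filter -[leqRHS](count_predC (fun z => dotm p n v z == 0)).
  by rewrite leq_add2l leq_eqVlt; apply/orP; left; apply/eqP/eq_count => z; rewrite /= lt0n.
rewrite all_map; apply/allP => z _ /=; rewrite size_map size_iota leqnn /= all_map.
by apply/allP => y _ /=; rewrite ltnW // ltn_pmod.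
Qed.

Lemma PT_unit_vectors {X : Type} {eX : Enc X} (n : X -> nat) :
  PTQ n -> PTQ (fun a => unit_vectors (n a)).
Proof. by move=> pn; rewrite /unit_vectors; pt. Qed.

Lemma PT_kernel {X : Type} {eX : Enc X} (g u : X -> seq nat) :
  PTQ g -> PTQ u -> PTQ (fun a => kernel (g a) (u a)).
Proof.
move=> pg pu; have pr := PT_rows pg pu.
have pn : PTQ (fun a => unknowns (u a)) by rewrite /unknowns; unfold_guess; pt.
have pq : PTQ (fun a => g_q (u a)) by unfold_guess; pt.
apply: PT_head.
apply: (PT_foldl (F := fun a L v => eliminate (g_q (u a)) (unknowns (u a)) v L)
  (h := fun a => unknowns (u a) * (unknowns (u a) * (2 * (g_q (u a) + 1) + 2) + 2) + 1)) => //.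
- exact: PT_unit_vectors.
- by apply: PT_eliminate; unfold_guess; rewrite /unknowns; unfold_guess; pt.
- by have := pb_nat pn; have := pb_nat pq => *; pb.
- move=> a j; rewrite (addn1 (g_q _)); apply: esize_bounded.
  have bu : bounded_entries (unknowns (u a)) (g_q (u a)) (unit_vectors (unknowns (u a))).
    rewrite /bounded_entries size_map size_iota leqnn all_map; apply/allP => b _ /=.
    by rewrite size_map size_iota leqnn all_map; apply/allP => b' _ /=; case: ifP.
  elim: (take _ _) (unit_vectors _) bu => //= v s' IH L hL.
  by apply: IH; apply: bounded_eliminate.
Qed.

Lemma PT_extend {X : Type} {eX : Enc X} (u z : X -> seq nat) (i : X -> nat)
    (L : X -> seq (seq nat)) :
  PTQ u -> PTQ z -> PTQ i -> PTQ L -> PTQ (fun a => extend (u a) (z a) (i a) (L a)).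
Proof. by move=> *; rewrite /extend /coefficient_vanishes; unfold_guess; pt. Qed.

Lemma PT_recover {X : Type} {eX : Enc X} (g u : X -> seq nat) :
  PTQ g -> PTQ u -> PTQ (fun a => recover (g a) (u a)).
Proof.
move=> pg pu; have pk := PT_kernel pg pu.
have pc : PTQ (fun a => g_cap (u a)) by unfold_guess; pt.
have pq : PTQ (fun a => g_q (u a)) by unfold_guess; pt.
have pd : PTQ (fun a => g_deg (u a)) by unfold_guess; pt.
pose n a := g_cap (u a) + g_deg (u a) + 1.
apply: (PT_foldl (F := fun a L i => extend (u a) (kernel (g a) (u a)) i L)
  (h := fun a => n a * (n a * (2 * (g_q (u a) + 1) + 2) + 2) + 1)).
- by pt.
- by pt.
- by apply: PT_extend; try pt; apply: (PT_comp pk); pt.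
- by rewrite /n; have := pb_nat pc; have := pb_nat pq; have := pb_nat pd => *; pb.
- move=> a j; rewrite (addn1 (g_q _)); apply: esize_bounded.
  have aux i0 k L : bounded_entries (n a) (g_q (u a)) L ->
      all (fun f : seq nat => size f <= i0) L -> i0 + k <= g_deg (u a) ->
      bounded_entries (n a) (g_q (u a))
        (foldl (fun L i => extend (u a) (kernel (g a) (u a)) i L) L (iota i0 k)).
    elim: k i0 L => [|k IH] i0 L //= bL aL hik.
    have aE : all (fun f : seq nat => (size f <= i0.+1) && all (fun y => y <= (g_q (u a)).+1) f)
        (extend (u a) (kernel (g a) (u a)) i0 L).
      apply/allP => f /mem_take /flattenP[_ /mapP[f0 f0L ->] /mapP[v]].
      rewrite mem_filter mem_iota => /andP[_ /andP[_ hv]] ->.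
      rewrite size_cat addn1 ltnS (allP aL _ f0L) all_cat /= andbT.
      move/andP: bL => [_ /allP/(_ _ f0L)/andP[_ ->]] /=.
      exact: ltnW.
    apply: IH; last by rewrite addSnnS.
    + rewrite /bounded_entries; apply/andP; split.
        by rewrite /extend size_take; rewrite /n; case: ltnP => *; lia.
      apply: sub_all aE => f /andP[h1 ->]; rewrite andbT; apply: leq_trans h1 _.
      by rewrite /n; lia.
    + by apply: sub_all aE => f /andP[].
  rewrite take_iota; apply: aux; rewrite ?add0n ?geq_minr //.
  by rewrite /bounded_entries /= andbT /n addn1.
Qed.

Lemma PT_block {X : Type} {eX : Enc X} (u f : X -> seq nat) (i : X -> nat) :
  PTQ u -> PTQ f -> PTQ i -> PTQ (fun a => block (u a) (f a) (i a)).
Proof.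
move=> pu pf pi.
pose F (a : X) t b := minn (g_K (u a)) (block_value (u a) (f a) (i a) t + (g_q (u a)).+1 * b).
apply: (PT_foldr_nat (F := F) (h := fun a => g_K (u a))); rewrite /F /block_value; unfold_guess.
- by pt.
- by pt.
- by pt.
- by apply: (@pb_nat Q0); pt.
- by move=> a b b'; apply: geq_minl.
Qed.

Lemma PT_word {X : Type} {eX : Enc X} (n : X -> nat) (u f : X -> seq nat) :
  0 < q0 -> PTQ n -> PTQ u -> PTQ f -> PTQ (fun a => word (n a) (u a) (f a)).
Proof.
move=> q0_gt0 pn pu pf; apply: PT_map; last by pt.
pose F (a : X * nat) j b := (inner (u a.1)
  (block (u a.1) (f a.1) (neighbor (u a.1) (a.2 %% g_beta (u a.1) * d + j) (a.2 %/ g_beta (u a.1))))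
                       (a.2 %% g_beta (u a.1) * d + j) + q0 * b) %% (q0 ^ d).
apply: (PT_foldr_nat (F := F) (h := fun=> q0 ^ d)); rewrite /F.
- by pt.
- by pt.
- unfold_guess; pt.
  by apply: PT_block; pt.
- exact: pb_const.
- by move=> a b b'; rewrite ltnW // ltn_pmod // expn_gt0 q0_gt0.
Qed.

Lemma PT_tuples {X : Type} {eX : Enc X} k (n : X -> nat) : PTQ n -> PTQ (fun a => tuples k (n a)).
Proof.
move=> pn; elim: k => [|k IH] /=; pt.
  exact: PT_comp IH (PT_fst (PT_id _ _)).
Qed.

Lemma PT_expn {X : Type} {eX : Enc X} (n : X -> nat) c : PTQ n -> PTQ (fun a => n a ^ c).
Proof.
move=> pn; elim: c => [|c IH]; first by apply: PT_ext (PT_const _ 1) => a; rewrite expn0.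
by apply: PT_ext (PT_muln pn IH) => a; rewrite expnS.
Qed.

Theorem PT_decode k c : 0 < q0 -> PTQ (decode k c).
Proof.
move=> q0_gt0.
apply: PT_flatten; apply: PT_map; last by apply: PT_tuples; apply: PT_expn; pt.
apply: PT_map; last by apply: PT_recover; pt.
by apply: PT_word; pt.
Qed.

End Algorithm.

(** * Reading the received word and writing the list *)

Section InputOutput.
Variable Q : nat.
Local Open Scope nat_scope.

Notation prog := (prog Q).
Notation cell := (cell Q).
Notation ser := (serialize Q).

Definition p_skip : prog := Seq (Push SC (bit Q false)) (Pop Q SC).

Lemma p_skip_run i d a b c o : runs p_skip (Stacks i d a b c o) 4 (Stacks i d a b c o).
Proof. by apply: (runs_seq (runs_push _ _ _) (runs_pop _ _)). Qed.

(** Instructions contain letters as constants only, so the letter on top is compared with each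
    letter of the alphabet. *)
Definition dispatch (x : stack) (body : 'I_Q -> prog) : prog :=
  foldr (fun a p => If x (fun c => c == Some (inl a)) (body a) p) p_skip (enum 'I_Q).

Lemma dispatch_run x body s a T s' :
  runs (body a) s T s' -> ohead (get s x) = Some (inl a) -> runs (dispatch x body) s (T + Q) s'.
Proof.
move=> r hx; rewrite -[X in _ + X]card_ord cardE /dispatch.
have : a \in enum 'I_Q by rewrite mem_enum.
elim: (enum _) => //= a' l IH; rewrite inE addnS => al; apply: runs_if; rewrite hx.
case: (eqVneq a a') al => [<- _|ne al].
  by rewrite eqxx; apply: runsW r _; rewrite leq_addr.
have -> : (Some (inl a : cell) == Some (inl a')) = false.
  by apply/negbTE/negP => /eqP[e]; rewrite e eqxx in ne.
exact: IH.
Qed.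

Definition pushes (l : seq cell) : prog := foldr (fun e p => Seq (Push SD e) p) p_skip l.

Lemma pushes_run l i d a b c o :
  runs (pushes l) (Stacks i d a b c o) (4 + 3 * size l) (Stacks i (rev l ++ d) a b c o).
Proof.
elim: l d => [|e l IH] d; first exact: p_skip_run.
rewrite rev_cons cat_rcons.
have r1 := @runs_push Q SD e (Stacks i d a b c o).
by apply: runsW (runs_seq (r1 _) (IH _)) _ => //=; lia.
Qed.

Definition letters (g : seq 'I_Q) : seq cell := [seq inl a | a <- g].

Definition reverse_input : prog :=
  While SI (@nonempty Q) (Seq (dispatch SI (fun a => Push SA (inl a))) (Pop Q SI)).

Lemma reverse_input_run g a :
  runs reverse_input (Stacks (letters g) [::] a [::] [::] [::]) (size g * (Q + 10))
    (Stacks [::] [::] (rev (letters g) ++ a) [::] [::] [::]).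
Proof.
elim: g a => [|x g IH] a; first exact: runs_stop.
rewrite /= rev_cons cat_rcons.
apply: (@runsW _ _ _ ((2 + Q + 1).+1 + size g * (Q + 10)).+2); last by rewrite mulSn; lia.
apply: runs_while (IH _) => //.
have r1 := @runs_push Q SA (inl x) (Stacks (letters (x :: g)) [::] a [::] [::] [::]).
have r2 := runs_pop SI (Stacks (letters (x :: g)) [::] (inl x :: a) [::] [::] [::]).
have r3 := @dispatch_run SI (fun a => Push SA (inl a)) _ x _ _ (r1 ltac:(discriminate)) erefl.
exact: (runs_seq r3 r2).
Qed.

Definition load_letter (a : 'I_Q) : prog := pushes (rev (bit Q true :: ser (enc (a : nat)))).

Definition load_input : prog :=
  Seq (Push SD (bit Q false))
    (While SA (@nonempty Q) (Seq (dispatch SA load_letter) (Pop Q SA))).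

Lemma load_input_run g :
  runs load_input (Stacks [::] [::] (rev (letters g)) [::] [::] [::])
    (3 + size g * (8 * Q + 20)) (mem_state (ser (enc (map val g))) [::]).
Proof.
have loopP (h h' : seq 'I_Q) :
  runs (While SA (@nonempty Q) (Seq (dispatch SA load_letter) (Pop Q SA)))
    (Stacks [::] (ser (enc (map val h'))) (letters h) [::] [::] [::])
    (size h * (8 * Q + 20)) (mem_state (ser (enc (map val (catrev h h')))) [::]).
  elim: h h' => [|x h IH] h'; first exact: runs_stop.
  apply: (@runsW _ _ _ ((4 + 3 * (2 * Q + 2) + Q + 1).+1 + size h * (8 * Q + 20)).+2);
    last by rewrite /= mulSn; lia.
  apply: runs_while (IH _) => //.
  have sz : size (rev (bit Q true :: ser (enc (x : nat)))) <= 2 * Q + 2.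
    rewrite size_rev /= size_serialize -/(esize (x : nat)) esize_nat -addnn.
    by have := ltn_ord x; lia.
  have r1 := pushes_run (rev (bit Q true :: ser (@enc _ enc_nat (x : nat)))) [::]
     (ser (@enc _ (enc_seq enc_nat) (map val h'))) (letters (x :: h)) [::] [::] [::].
  have r2 : runs (load_letter x) (Stacks [::] (ser (enc (map val h'))) (letters (x :: h)) [::]
    [::] [::])
      (4 + 3 * (2 * Q + 2))
      (Stacks [::] (bit Q true :: ser (enc (x : nat)) ++ ser (enc (map val h')))
        (letters (x :: h)) [::] [::] [::]).
    by rewrite revK in r1; apply: runsW r1 _; rewrite leq_add2l leq_mul2l sz.
  have r3 := @dispatch_run SA load_letter _ x _ _ r2 erefl.
  exact: (runs_seq r3 (runs_pop SA (Stacks [::] (bit Q true :: ser (enc (x : nat)) ++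
    ser (enc (map val h'))) (letters (x :: h)) [::] [::] [::]))).
have := loopP (rev g) [::]; rewrite catrevE revK cats0 size_rev /letters map_rev => r.
have r0 := @runs_push Q SD (bit Q false) (Stacks [::] [::] (rev (letters g)) [::] [::] [::]).
exact: (runs_seq (r0 ltac:(discriminate)) r).
Qed.

Fixpoint emit_letter (l : seq 'I_Q) : prog :=
  if l is a :: l' then
    If SD (@onebit Q) (Seq (Pop Q SD) (Seq (Pop Q SD) (emit_letter l')))
      (Seq (Pop Q SD) (Emit a))
  else p_skip.

Lemma emit_letter_run l (a : 'I_Q) v d o : nth a l v = a -> v < size l ->
  runs (emit_letter l) (mem_state (ser (enc v) ++ d) o) (10 * size l) (mem_state d (rcons o a)).
Proof.
elim: l v => // x l IH [|v] /= hv sv.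
  apply: (@runsW _ _ _ (1 + 1).+2); last by lia.
  apply: runs_if => /=; rewrite hv.
  apply: (runs_seq (runs_pop _ _)); exists 1 => //; exact: RunEmit.
apply: (@runsW _ _ _ (1 + (1 + 10 * size l).+1).+2); last by lia.
apply: runs_if => /=; apply: (runs_seq (runs_pop _ _)); apply: (runs_seq (runs_pop _ _)).
exact: IH.
Qed.

Definition emit_output : prog :=
  While SD (@onebit Q) (Seq (Pop Q SD) (emit_letter (enum 'I_Q))).

Lemma emit_output_run (h : seq 'I_Q) o :
  runs emit_output (mem_state (ser (enc (map val h))) o) (size h * (10 * Q + 10))
    (mem_state [:: bit Q false] (o ++ h)).
Proof.
elim: h o => [|a h IH] o; first by rewrite cats0; exact: runs_stop.
rewrite -cat_rcons; apply: (@runsW _ _ _ ((1 + 10 * Q).+1 + size h * (10 * Q + 10)).+2);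
  last by rewrite /= mulSn; lia.
apply: runs_while (IH _) => //.
apply: (runs_seq (runs_pop _ _)); rewrite -[X in 10 * X]card_ord cardE.
apply: emit_letter_run; last by rewrite -cardE card_ord ltn_ord.
exact: nth_ord_enum.
Qed.

Theorem machine_of_PT (F : seq nat -> seq (seq nat)) :
  PT Q F -> (forall g z, z \in F g -> size z = size g /\ {in z, forall y, y < Q}) ->
  exists (M : machine Q) c, forall n (g : n.-tuple 'I_Q), 1 < n ->
    exists t (L : seq (n.-tuple 'I_Q)),
      [/\ t <= n ^ c, outputs_in M g t L & [seq map val (tval z) | z <- L] = F (map val g)].
Proof.
move=> pF hF.
have [p [h [hb hc]]] : PT Q (fun g => flatten (F g)) by apply: PT_flatten.
have sF : poly_bounded (fun g => esize (flatten (F g))) by apply: (@PT_size Q); apply: PT_flatten.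
pose pr := Seq reverse_input (Seq load_input (Seq p emit_output)).
pose T (g : seq nat) := 10 + size g * (Q + 10) + size g * (8 * Q + 20) + h g +
  @esize _ (enc_seq enc_nat) (flatten (F g)) * (10 * Q + 10).
have [c Tc] : poly_bounded T.
  have sz : poly_bounded (fun g : seq nat => size g).
    by apply: pb_le pb_esize _ => g; apply: ltnW; apply: size_esize.
  by rewrite /T; pb.
(* The encoded input satisfies [esize g' + 2 <= n * (2 * Q + 5)], which is below [n ^ (2 * Q + 6)]
   because [1 < n]. *)
exists (prog_machine pr), ((2 * Q + 6) * c) => n g n1.
pose g' := map val (tval g).
have [L LE] : exists L : seq (n.-tuple 'I_Q), [seq map val (tval z) | z <- L] = F g'.
  have : {in F g', forall z, size z = n /\ {in z, forall y, y < Q}}.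
    by move=> z /hF; rewrite size_map size_tuple.
  elim: (F g') => [|z s IH] hs; first by exists [::].
  have [|L <-] := IH; first by move=> z' z's; apply: hs; rewrite inE z's orbT.
  have [sz zQ] := hs z (mem_head _ _).
  have sz' : size (pmap insub z : seq 'I_Q) == n.
    by rewrite size_pmap_sub -sz -all_count; apply/allP => y /zQ.
  exists (Tuple sz' :: L) => /=; congr (_ :: _).
  by rewrite (pmap_filter (insubK _)); apply/all_filterP/allP => y /zQ yQ; rewrite insubT.
pose out := flatten [seq tval z | z <- L].
have outE : map val out = flatten (F g') by rewrite map_flatten -map_comp -LE.
have [t tT r] : runs pr (Stacks (letters g) [::] [::] [::] [::] [::]) (T g').-2
    (mem_state [:: bit Q false] out).
  have r1 := reverse_input_run g [::]; rewrite cats0 in r1.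
  have r2 := load_input_run g.
  pose proof (hc g' [::] [::]) as r3; rewrite !cats0 -outE in r3.
  have r4 := emit_output_run out [::].
  apply: runsW (runs_seq r1 (runs_seq r2 (runs_seq r3 r4))) _.
  have so : size out <= esize (flatten (F g')).
    by rewrite -outE -(size_map val); apply: ltnW; apply: size_esize.
  have := leq_mul so (leqnn (10 * Q + 10)).
  rewrite /T size_map size_tuple; set u1 := n * _; set u2 := n * _; set u3 := _ * _;
    set u4 := _ * _.
  by lia.
exists t.+2, L; split => //; last exact: prog_machine_outputs r _.
have : 2 < T g' by rewrite /T; lia.
move=> T2; apply: (@leq_trans (T g')); first by lia.
apply: leq_trans (Tc g') _; rewrite expnM; case: c {Tc} => // c; rewrite leq_exp2r //.
have eg : esize g' <= n * (2 * Q + 2) + 1.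
  rewrite /g'; have := size_tuple g; move: (tval g) => gs <-; elim: gs => //= a s IH.
  by rewrite esize_cons esize_nat -addnn mulSn; have := ltn_ord a; lia.
rewrite [2 * Q + 6]addnS expnS.
have := ltn_expl (2 * Q + 5) n1; nia.
Qed.

End InputOutput.

(** * Interpolation decoding of the outer code *)

Section PrimeFieldCast.
Local Open Scope ring_scope.
Variable p : nat.
Hypothesis q_prime : prime p.+1.
Local Notation F := 'F_(p.+1).

Lemma natF_mod n : (n %% p.+1)%:R = n%:R :> F.
Proof. exact: Fp_nat_mod. Qed.

Lemma natF_eq0 n : (n%:R == 0 :> F) = (p.+1 %| n)%N.
Proof. by rewrite (dvdn_pcharf (pchar_Fp q_prime)). Qed.

Lemma natF_inj a b : (a < p.+1)%N -> (b < p.+1)%N -> a%:R = b%:R :> F -> a = b.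
Proof.
move=> ha hb; wlog ab : a b ha hb / (a <= b)%N => [hw|] e.
  by case: (leqP a b) => [|/ltnW] ?; [apply: hw|apply/esym/hw].
have : (b - a)%:R == 0 :> F by rewrite natrB // e subrr.
rewrite natF_eq0 => /dvdnP[k hk]; case: k hk => [|k]; first by lia.
by rewrite mulSn; lia.
Qed.

Lemma natF_sub_modulus a : (a <= p.+1)%N -> (p.+1 - a)%:R = - a%:R :> F.
Proof. by move=> ha; rewrite natrB // pchar_Fp_0 // sub0r. Qed.

Lemma natr_sumn (R : pzSemiRingType) (l : seq nat) : (sumn l)%:R = \sum_(x <- l) x%:R :> R.
Proof. by elim: l => [|x l IH]; rewrite ?big_nil // big_cons /= natrD IH. Qed.

Section Elimination.
Variable n : nat.

Definition row_of (z : seq nat) : 'rV[F]_n := \row_(a < n) (nth 0%N z a)%:R.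

Definition pairing (v : seq nat) (x : 'rV[F]_n) : F := \sum_(a < n) (nth 0%N v a)%:R * x 0 a.

Lemma natF_dotm v z : (dotm p n v z)%:R = pairing v (row_of z).
Proof.
rewrite natF_mod natr_sumn big_map.
have -> : iota 0 n = index_iota 0 n by rewrite /index_iota subn0.
rewrite big_mkord.
by apply: eq_bigr => a _; rewrite natrM mxE.
Qed.

Lemma dotm_eq0 v z : (dotm p n v z == 0%N) = (pairing v (row_of z) == 0).
Proof.
rewrite -natF_dotm natF_eq0; apply/eqP/idP => [->|]; first exact: dvdn0.
by rewrite /dvdn modn_small ?ltn_pmod // => /eqP.
Qed.

Lemma pairingB v c x c' y : pairing v (c *: x - c' *: y) = c * pairing v x - c' * pairing v y.
Proof.
rewrite /pairing !mulr_sumr -sumrB; apply: eq_bigr => a _; rewrite !mxE; ring.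
Qed.

(** As [c] is invertible, each [y] is a combination of its image and [x]. The images together with
    [x] thus span at least the old space, and there are no more of them than before. *)
Lemma free_eliminate (x : 'rV[F]_n) (c : F) (c' : 'rV[F]_n -> F) X : c != 0 ->
  free (x :: X) -> free [seq c *: y - c' y *: x | y <- X].
Proof.
move=> c0; set X' := map _ X => fx.
have sub : (<<x :: X>> <= <<x :: X'>>)%VS.
  apply/span_subvP => y; rewrite inE => /predU1P[->|yX].
    by apply: memv_span; rewrite mem_head.
  have -> : y = c^-1 *: (c *: y - c' y *: x) + (c^-1 * c' y) *: x.
    by rewrite scalerBr !scalerA mulVf // scale1r subrK.
  apply: memvD; apply: memvZ; apply: memv_span; rewrite ?mem_head //.
  by rewrite inE (map_f _ yX) orbT.
have : free (x :: X').
  rewrite /free eqn_leq dim_span /=; move: (dimvS sub).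
  by move: fx; rewrite /free /= size_map => /eqP ->.
by rewrite free_cons => /andP[].
Qed.

(** The invariant of the elimination: an equation costs at most one vector, its pivot, so fewer
    equations than unknowns leave a nonzero solution. *)
Lemma foldl_eliminate (Rs : seq (seq nat)) :
  let L := foldl (fun L v => eliminate p n v L) (unit_vectors n) Rs in
  [/\ free (map row_of L), (n - size Rs <= size L)%N
    & forall v z, v \in Rs -> z \in L -> pairing v (row_of z) = 0].
Proof.
elim/last_ind: Rs => [|Rs v [fL sL oL]] /=.
  split=> //; last by rewrite size_map size_iota subn0.
  have -> : map row_of (unit_vectors n) = [seq delta_mx 0 i | i : 'I_n].
    rewrite /unit_vectors -map_comp -val_enum_ord -map_comp /image_mem.
    apply: eq_map => i /=; apply/rowP => a; rewrite !mxE eqxx /=.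
    rewrite (nth_map 0%N) ?val_enum_ord ?size_iota // nth_iota // add0n val_eqE eq_sym.
    by case: (a == i).
  rewrite /free size_map -cardE card_ord.
  have -> : <<[seq delta_mx 0%R i | i : 'I_n]>>%VS = fullv :> {vspace 'rV[F]_n}.
    apply/eqP; rewrite eqEsubv subvf; apply/subvP => x _; rewrite [x]row_sum_delta.
    apply: memv_suml => i _; apply: memvZ; apply: memv_span; apply: map_f.
    by rewrite mem_enum.
  by rewrite dimvf /dim /= mul1n.
rewrite foldl_rcons size_rcons; set L := foldl _ _ _ in fL sL oL *.
rewrite /eliminate; case: ifP => [/eqP nz0|nz].
  split=> // [|v' z]; first by lia.
  rewrite mem_rcons inE => /predU1P[->|v'R] zL; last exact: oL.
  apply/eqP; rewrite -dotm_eq0 -leqn0 leqNgt; apply/negP => d0.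
  have : z \in nonorthogonal p n v L by rewrite mem_filter d0.
  by rewrite (size0nil nz0).
case E : (nonorthogonal p n v L) nz => [//|x0 X] _ /=.
set Z := _ ++ X; pose c z : F := (dotm p n v z)%:R.
have permL : perm_eq (x0 :: Z) L.
  rewrite -cat1s /Z perm_catCA /= -E /nonorthogonal.
  have -> : [seq z <- L | (0 < dotm p n v z)%N] =
      seq.filter (predC (fun z => dotm p n v z == 0%N)) L.
    by apply: seq.eq_filter => z /=; rewrite lt0n.
  by rewrite perm_filterC.
have c0 : c x0 != 0.
  have : x0 \in nonorthogonal p n v L by rewrite E mem_head.
  by rewrite mem_filter lt0n dotm_eq0 -natF_dotm => /andP[].
have rowE z : row_of [seq ((dotm p n v x0 * nth 0 z a + (p.+1 - dotm p n v z) * nth 0 x0 a) %%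
  p.+1)%N
    | a <- iota 0 n] = c x0 *: row_of z - c z *: row_of x0.
  apply/rowP => a; rewrite !mxE (nth_map 0%N) ?size_iota // nth_iota // add0n natF_mod.
  by rewrite natrD !natrM natF_sub_modulus ?mulNr // ltnW // ltn_pmod.
have mapE : map row_of [seq [seq ((dotm p n v x0 * nth 0 z a + (p.+1 - dotm p n v z) * nth 0 x0
  a) %% p.+1)%N
    | a <- iota 0 n] | z <- Z] = [seq c x0 *: y - pairing v y *: row_of x0 | y <- map row_of Z].
  by rewrite -!map_comp; apply: eq_map => z; rewrite /= rowE -natF_dotm.
split.
- rewrite mapE; apply: free_eliminate => //.
  by rewrite -map_cons (perm_free (perm_map row_of permL)).
- by move: (perm_size permL) sL; rewrite size_map /=; lia.
- move=> v' _ v'R /mapP[z zZ ->]; rewrite rowE pairingB.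
  move: v'R; rewrite mem_rcons inE => /predU1P[->|v'R].
    by rewrite -!natF_dotm /c; ring.
  by rewrite !oL ?mulr0 ?subrr // -(perm_mem permL) inE ?eqxx // zZ orbT.
Qed.

Lemma kernel_head (Rs : seq (seq nat)) : (size Rs < n)%N ->
  let z := head [::] (foldl (fun L v => eliminate p n v L) (unit_vectors n) Rs) in
  row_of z != 0 /\ forall v, v \in Rs -> pairing v (row_of z) = 0.
Proof.
move=> sR /=; have [] := foldl_eliminate Rs.
case: (foldl _ _ _) => [|z L] /=; first by lia.
rewrite free_cons => /andP[zL _] _ oL; split; last by move=> v vR; apply: oL; rewrite ?mem_head.
by apply: contraNneq zL => ->; rewrite mem0v.
Qed.

End Elimination.
End PrimeFieldCast.

(** * Digits of numbers built by Horner's rule *)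

Section HornerDigits.
Local Open Scope nat_scope.

(** With [k] digits the partial values stay below [b ^ k], so the cap [K] is never reached. *)
Lemma horner_digits (b K : nat) (y : nat -> nat) t0 k :
  (forall t, y t < b) -> b ^ k <= K ->
  let v := foldr (fun t a => minn K (y t + b * a)) 0 (iota t0 k) in
  v < b ^ k /\ forall j, j < k -> digit b j v = y (t0 + j).
Proof.
move=> hy; elim: k t0 => [|k IH] t0 hK /=; first by split.
have b0 : 0 < b by apply: leq_ltn_trans (hy 0).
have [|lt dg] := IH t0.+1; first by apply: leq_trans hK; rewrite leq_pexp2l.
set v := foldr _ _ _ in lt dg *.
have lt1 : y t0 + b * v < b ^ k.+1.
  have := hy t0; have : b * v.+1 <= b * b ^ k by rewrite leq_mul2l lt orbT.
  by rewrite expnS mulnS; lia.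
rewrite (minn_idPr (leq_trans (ltnW lt1) hK)); split=> // -[_|j jk].
  by rewrite addn0 digitE expn0 divn1 mulnC addnC modnMDl modn_small.
rewrite digitE expnS divnMA [b * v]mulnC divnDMl // [y t0 %/ b]divn_small // add0n -digitE dg //.
by rewrite addSnnS.
Qed.

Lemma digit_lt (b e x : nat) : 0 < b -> digit b e x < b.
Proof. by move=> b0; rewrite /digit ltn_pmod. Qed.

Lemma horner_digits_mod (b K : nat) (y : nat -> nat) t0 k :
  (forall t, y t < b) -> b ^ k = K ->
  forall j, j < k -> digit b j (foldr (fun t a => (y t + b * a) %% K) 0 (iota t0 k)) = y (t0 + j).
Proof.
move=> hy hK j jk; have [_ /(_ j jk) <-] := horner_digits t0 hy (eq_leq hK).
congr digit; rewrite -hK.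
have b0 : 0 < b by apply: leq_ltn_trans (hy 0).
suff H i : i <= k -> foldr (fun t a => (y t + b * a) %% b ^ k) 0 (iota (t0 + (k - i)) i) =
    foldr (fun t a => minn (b ^ k) (y t + b * a)) 0 (iota (t0 + (k - i)) i).
  by have := H k (leqnn _); rewrite subnn addn0.
elim: i => // i IH ik /=.
have e : (t0 + (k - i.+1)).+1 = t0 + (k - i) by lia.
have bik : b ^ i.+1 <= b ^ k by rewrite leq_pexp2l.
have [lt _] := @horner_digits b (b ^ k) y (t0 + (k - i)) i hy (leq_trans (leq_pexp2l b0 (leqnSn
  i)) bik).
rewrite e IH ?(ltnW ik) //; set v := foldr _ _ _ in lt *.
have lt1 : y (t0 + (k - i.+1)) + b * v < b ^ k.
  apply: leq_trans bik; have := hy (t0 + (k - i.+1)).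
  have : b * v.+1 <= b * b ^ i by rewrite leq_mul2l lt orbT.
  by rewrite expnS mulnS; lia.
by rewrite modn_small // (minn_idPr (ltnW lt1)).
Qed.

Lemma nth_flatten_iota (F : nat -> nat -> nat) s W h j : h < W -> j < s ->
  nth 0 (flatten [seq [seq F h j | j <- iota 0 s] | h <- iota 0 W]) (h * s + j) = F h j.
Proof.
move=> hW js; suff H a : h < W -> nth 0 (flatten [seq [seq F h j | j <- iota 0 s] | h <- iota a W])
    (h * s + j) = F (a + h) j by rewrite H.
elim: W h a {hW} => // W IH [|h] a hW /=; rewrite nth_cat size_map size_iota.
  by rewrite mul0n add0n js (nth_map 0) ?size_iota // nth_iota // addn0.
rewrite mulSn -addnA ltnNge leq_addr /= addKn IH //.
by rewrite addSnnS.
Qed.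

End HornerDigits.

(** * Completeness of the list recovery of the outer code *)

Section Recovery.
Local Open Scope ring_scope.
Variables q0 d l m m' s w : nat.
Variables g u : seq nat.
Local Notation p := (g_q u).
Local Notation F := 'F_(p.+1).
Local Notation D := (g_deg u).
Local Notation W := (w * g_m0 u)%N.
Local Notation c := (g_gamma u)%:R.

Hypothesis q_prime : prime p.+1.

Lemma natF_expm a e : (expm p a e)%:R = a%:R ^+ e :> F.
Proof. by rewrite -(natF_mod q_prime) expmE (natF_mod q_prime) natrX. Qed.

Lemma natF_point e h : (point u e h)%:R = c ^+ e ^+ h :> F.
Proof. by rewrite /point natF_expm exprM. Qed.

Definition message_poly (f : seq nat) : {poly F} := \poly_(h < D) (nth 0%N f h)%:R.

Lemma natF_block_value f i t :
  (block_value m u f i t)%:R = (message_poly f).[c ^+ (i * m + t)] :> F.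
Proof.
rewrite (natF_mod q_prime) natr_sumn big_map horner_poly.
have -> : iota 0 D = index_iota 0 D by rewrite /index_iota subn0.
by rewrite big_mkord; apply: eq_bigr => h _; rewrite natrM natF_point.
Qed.

Lemma block_value_lt f i t : (block_value m u f i t < p.+1)%N.
Proof. by rewrite ltn_pmod. Qed.

Hypothesis KE : g_K u = (p.+1 ^ m)%N.

Lemma block_digits f i : (block m u f i < g_K u)%N /\
  forall t, (t < m)%N -> digit p.+1 t (block m u f i) = block_value m u f i t.
Proof.
have [lt dg] := @horner_digits p.+1 (g_K u) (block_value m u f i) 0 m
  (block_value_lt f i) (eq_leq (esym KE)).
by split; [rewrite KE|move=> t tm; rewrite /block dg].
Qed.

Section Interpolation.
Variable z : seq nat.

Definition coefficient (h j : nat) : F := (nth 0%N z (h * s + j))%:R.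

Definition interpolant (j : nat) : {poly F} := \poly_(h < W) coefficient h j.

Definition dilated (f : seq nat) (j : nat) : {poly F} :=
  \poly_(h < D) ((nth 0%N f h)%:R * c ^+ (j * h)).

Definition residual (f : seq nat) : {poly F} := \sum_(j < s) interpolant j * dilated f j.

Lemma horner_dilated f j x : (dilated f j).[x] = (message_poly f).[c ^+ j * x].
Proof.
rewrite !horner_poly; apply: eq_bigr => h _.
by rewrite exprMn exprM mulrA.
Qed.

Lemma pairing_row i x t :
  pairing (row m s w u i x t) (row_of p (unknowns s w u) z) =
  \sum_(j < s) (interpolant j).[c ^+ (i * m + t)] * (digit p.+1 (t + j) x)%:R.
Proof.
rewrite /pairing; under eq_bigr do rewrite mxE.
rewrite -(big_mkord predT (fun a => (nth 0%N (row m s w u i x t) a)%:R * (nth 0%N z a)%:R)).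
rewrite /unknowns mulnC big_nat_mul big_mkord.
under [RHS]eq_bigr => j _ do rewrite horner_poly mulr_suml.
rewrite [RHS]exchange_big /=; apply: eq_bigr => h _.
rewrite -{1}(add0n (h * s)%N) big_addn mulSn addnK big_mkord; apply: eq_bigr => j _.
rewrite addnC nth_flatten_iota // (natF_mod q_prime) natrM natF_point /coefficient.
ring.
Qed.

Hypothesis cand_kernel : forall v, v \in rows q0 d l m m' s w g u ->
  pairing v (row_of p (unknowns s w u) z) = 0.
Hypothesis s_gt0 : (0 < s)%N.
Hypothesis mE : m = (m' + s).-1.
Hypothesis c_inj : forall a b, (a < m * g_m0 u)%N -> (b < m * g_m0 u)%N ->
  c ^+ a = c ^+ b :> F -> a = b.

Definition good_block (f : seq nat) (i : nat) : bool := block m u f i \in candidates q0 d l g u i.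

(** For [t < m'] and [j < s] the position [t + j] is below [m' + s - 1 = m]. The whole window thus
    lies in block [i], and the equation of the true symbol is among those that [z] solves. *)
Lemma residual_root f i t : (i < g_m0 u)%N -> good_block f i -> (t < m')%N ->
  (residual f).[c ^+ (i * m + t)] = 0.
Proof.
move=> im gi tm; rewrite -(cand_kernel (v := row m s w u i (block m u f i) t)); last first.
  apply/flattenP; exists (flatten [seq [seq row m s w u i x t | t <- iota 0 m'] | x <- candidates
    q0 d l g u i]).
    by apply/mapP; exists i; rewrite ?mem_iota.
  apply/flattenP; exists [seq row m s w u i (block m u f i) t | t <- iota 0 m'].
    by apply/mapP; exists (block m u f i).
  by apply/mapP; exists t; rewrite ?mem_iota.
rewrite pairing_row horner_sum; apply: eq_bigr => j _.
rewrite hornerM horner_dilated -exprD; congr (_ * _).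
have [_ ->] := block_digits f i; last by have := ltn_ord j; lia.
by rewrite natF_block_value; congr (_.[_ ^+ _]); lia.
Qed.

Lemma size_residual f : (size (residual f) <= (W + D).-1)%N.
Proof.
apply: leq_trans (size_sum _ _ _) _; apply/bigmax_leqP => j _.
apply: leq_trans (size_polyMleq _ _) _.
have h1 : (size (interpolant j) <= W)%N by apply: size_poly.
have h2 : (size (dilated f j) <= D)%N by apply: size_poly.
by rewrite -!subn1 leq_sub2r // leq_add.
Qed.

(** Each good block yields [m'] roots, all distinct by [c_inj], more than the degree of the residual
    allows. *)
Lemma residual_eq0 f :
  (0 < W + D <= count (good_block f) (iota 0 (g_m0 u)) * m')%N -> residual f = 0.
Proof.
case/andP=> WD0 WD; apply/eqP/negPn/negP => nz.
pose rs := [seq c ^+ (i * m + t) : F | i <- seq.filter (good_block f) (iota 0 (g_m0 u)),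
  t <- iota 0 m'].
have := @max_poly_roots _ _ rs nz; rewrite size_allpairs size_filter size_iota => lt.
have {}lt : (count (good_block f) (iota 0 (g_m0 u)) * m' < size (residual f))%N.
  apply: lt.
    apply/allP => _ /allpairsP[[i t] /= [+ + ->]]; rewrite mem_filter !mem_iota add0n.
    by move=> /andP[gi /andP[_ im]] /andP[_ tm]; apply/eqP; apply: residual_root.
  apply: allpairs_uniq; rewrite ?filter_uniq ?iota_uniq //.
  move=> [i t] [i' t'] /allpairsP[[i1 t1] /= [+ + [-> ->]]] /allpairsP[[i2 t2] /= [+ + [-> ->]]].
  rewrite !mem_filter !mem_iota !add0n => /andP[_ /andP[_ im1]] /andP[_ tm1] /andP[_ /andP[_
    im2]] /andP[_ tm2] /c_inj e.
  have tm1' : (t1 < m)%N by lia.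
  have tm2' : (t2 < m)%N by lia.
  have lim i3 t3 : (i3 < g_m0 u)%N -> (t3 < m)%N -> (i3 * m + t3 < m * g_m0 u)%N.
    move=> i3m t3m; have : (m * i3.+1 <= m * g_m0 u)%N by rewrite leq_mul2l i3m orbT.
    by rewrite mulnS [(m * i3)%N]mulnC; lia.
  have dv i3 t3 : (t3 < m)%N -> ((i3 * m + t3) %/ m = i3)%N.
    by move=> t3m; rewrite divnMDl ?divn_small ?addn0 //; lia.
  have {}e := e (lim _ _ im1 tm1') (lim _ _ im2 tm2').
  have ie : i1 = i2 by rewrite -(dv i1 t1 tm1') e dv.
  by move: e; rewrite ie => /addnI ->.
by have := size_residual f; lia.
Qed.

Local Notation low := (g_low u).

Hypothesis size_z : (size z <= W * s)%N.
Hypothesis low_min : forall h j, (h < low)%N -> (j < s)%N -> coefficient h j = 0.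

Lemma coefficient_vanishesE f i : coefficient_vanishes s u z f i =
  (\sum_(h < (low + i).+1) \sum_(j < s)
     coefficient h j * c ^+ j ^+ (low + i - h) * (nth 0%N f (low + i - h))%:R == 0 :> F).
Proof.
rewrite /coefficient_vanishes; set S := sumn _.
have -> : (S %% p.+1 == 0)%N = (S%:R == 0 :> F) by rewrite (natF_eq0 q_prime).
rewrite /S natr_sumn big_map.
have -> n : iota 0 n = index_iota 0 n by rewrite /index_iota subn0.
rewrite big_mkord; congr (_ == _); apply: eq_bigr => h _.
rewrite natr_sumn big_map; have -> n : iota 0 n = index_iota 0 n by rewrite /index_iota subn0.
by rewrite big_mkord; apply: eq_bigr => j _; rewrite !natrM natF_point.
Qed.

(** The interpolants have no coefficients below [low], so only the first [i.+1] coefficients of [f]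
    enter the coefficient at [low + i]. *)
Lemma vanishes_take f i : size f = D -> residual f = 0 ->
  coefficient_vanishes s u z (take i.+1 f) i.
Proof.
move=> sf r0; rewrite coefficient_vanishesE; apply/eqP.
have r1 : (residual f)`_(low + i) = 0 by rewrite r0 coef0.
rewrite -[RHS]r1.
rewrite coef_sum; under [RHS]eq_bigr do rewrite coefM.
rewrite exchange_big /=; apply: eq_bigr => j _; apply: eq_bigr => h _.
rewrite !coef_poly.
have -> : (if (h < W)%N then coefficient h j else 0) = coefficient h j.
  case: ltnP => // Wh; rewrite /coefficient nth_default //.
  apply: leq_trans size_z _; apply: leq_trans (leq_addr _ _).
  by rewrite leq_mul2r Wh orbT.
case: (ltnP h low) => hl; first by rewrite low_min ?ltn_ord // !mul0r.
rewrite nth_take; last by lia.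
rewrite exprM -mulrA; congr (_ * _); rewrite mulrC.
by case: ltnP => // Df; rewrite nth_default ?sf // mul0r.
Qed.

Definition lowest : {poly F} := \poly_(j < s) coefficient low j.

(** In the coefficient at [low + i] the newest entry is multiplied by the value of [lowest] at
    [c ^+ i]; all other terms involve earlier entries only. *)
Lemma vanishes_unique f v v' i : size f = i -> lowest.[c ^+ i] != 0 ->
  (v < p.+1)%N -> (v' < p.+1)%N -> coefficient_vanishes s u z (f ++ [:: v]) i ->
  coefficient_vanishes s u z (f ++ [:: v']) i -> v = v'.
Proof.
move=> sf nz vq vq'; rewrite !coefficient_vanishesE => /eqP e /eqP e'.
apply: (natF_inj q_prime) => //; apply/eqP; rewrite -subr_eq0.
have : lowest.[c ^+ i] * (v%:R - v'%:R) = 0.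
  have := f_equal2 (fun a b : F => a - b) e e'; rewrite subrr -sumrB => <-.
  have lt : (low < (low + i).+1)%N by rewrite ltnS leq_addr.
  rewrite (bigD1 (Ordinal lt)) //= addKn [X in _ = _ + X]big1 ?addr0 => [|h /eqP hl].
    rewrite -sumrB horner_poly mulr_suml; apply: eq_bigr => j _.
    rewrite !nth_cat sf ltnn subnn /= -exprM mulnC exprM; ring.
  have {}hl : nat_of_ord h <> low by move=> hl'; apply: hl; apply: val_inj.
  rewrite -sumrB big1 // => j _; case: (ltnP h low) => [hlt|hge].
    by rewrite low_min ?ltn_ord // !mul0r subrr.
  have lt' : (low + i - h < i)%N by have := ltn_ord h; lia.
  by rewrite !nth_cat sf lt' subrr.
by move/eqP; rewrite mulf_eq0 (negbTE nz).
Qed.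

Hypothesis D_le : (D <= m * g_m0 u)%N.
Hypothesis low_nz : exists2 j, (j < s)%N & coefficient low j != 0.

(** [lowest] is nonzero of degree below [s], and the powers of [c] are distinct in this range. These
    roots are the only steps at which a prefix can branch. *)
Lemma count_root_lowest : (count (fun i => root lowest (c ^+ i)) (iota 0 D) < s)%N.
Proof.
have [j js cj] := low_nz.
have nz : lowest != 0.
  by apply: contraNneq cj => /(congr1 (fun P : {poly F} => P`_j)); rewrite coef_poly js coef0 => ->.
rewrite -size_filter; set rs := seq.filter _ _.
have := @max_poly_roots _ _ [seq c ^+ i : F | i <- rs] nz; rewrite size_map => lt.
apply: leq_trans (size_poly s (coefficient low)); apply: lt.
  by apply/allP => _ /mapP[i + ->]; rewrite mem_filter => /andP[].
rewrite map_inj_in_uniq ?filter_uniq ?iota_uniq // => a b.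
rewrite !mem_filter !mem_iota !add0n => /andP[_ /andP[_ aD]] /andP[_ /andP[_ bD]].
by apply: c_inj; apply: leq_trans D_le.
Qed.

Lemma size_flatten_le (T : Type) (k : nat) (ss : seq (seq T)) :
  all (fun x => size x <= k)%N ss -> (size (flatten ss) <= size ss * k)%N.
Proof.
elim: ss => //= x ss IH /andP[hx /IH h].
by rewrite size_cat mulSn leq_add.
Qed.

Definition branch (i : nat) (f : seq nat) : seq (seq nat) :=
  [seq f ++ [:: v] | v <- [seq v <- iota 0 p.+1 | coefficient_vanishes s u z (f ++ [:: v]) i]].

Lemma size_branch i f : size f = i ->
  (size (branch i f) <= p.+1 ^ (root lowest (c ^+ i) : nat))%N.
Proof.
move=> sf; rewrite size_map; case: (boolP (root _ _)) => [_|nz].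
  by rewrite expn1 size_filter -[leqRHS](size_iota 0); exact: count_size.
rewrite expn0; set vs := seq.filter _ _.
have uv : uniq vs by rewrite filter_uniq ?iota_uniq.
have eqv : {in vs &, forall v v', v = v'}.
  move=> v v'; rewrite !mem_filter !mem_iota !add0n =>
    /andP[cv /andP[_ vq]] /andP[cv' /andP[_ vq']].
  exact: (vanishes_unique sf nz).
case: vs uv eqv => [|v [|v' vs]] //= uv /(_ v v').
by rewrite !inE !eqxx orbT => /(_ isT isT) e; rewrite e inE eqxx in uv.
Qed.

Hypothesis cap_ge : (p.+1 ^ s.-1 <= g_cap u)%N.

(** The induction carries the size of the list: it is multiplied by the field size at roots of
    [lowest] only, hence remains within [g_cap] and no prefix is cut off. *)
Lemma mem_foldl_extend f i : size f = D -> all (fun y => y < p.+1)%N f -> residual f = 0 ->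
  (i <= D)%N -> take i f \in foldl (fun L i => extend s u z i L) [:: [::]] (iota 0 i).
Proof.
move=> sf fq r0.
pose L k := foldl (fun L i => extend s u z i L) [:: [::]] (iota 0 k); rewrite -/(L i).
suff H : (i <= D)%N -> [/\ take i f \in L i, all (fun f' => size f' == i) (L i)
    & (size (L i) <= p.+1 ^ count (fun a => root lowest (c ^+ a)) (iota 0 i))%N].
  by move=> /H[].
elim: i => [|i IH] iD; first by rewrite /L /= take0 mem_head.
have [mi si ci] := IH (ltnW iD).
have LS : L i.+1 = extend s u z i (L i) by rewrite /L -addn1 iotaD foldl_cat.
pose L' := flatten [seq branch i f' | f' <- L i].
have sL' : (size L' <= p.+1 ^ count (fun a => root lowest (c ^+ a)) (iota 0 i.+1))%N.
  apply: leq_trans (size_flatten_le (k := (p.+1 ^ (root lowest (c ^+ i) : nat))%N) _) _.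
    by rewrite all_map; apply/allP => f' /(allP si)/eqP; exact: size_branch.
  rewrite size_map -[i.+1]addn1 iotaD count_cat /= addn0 expnD leq_mul2r.
  by rewrite ci orbT.
have LE : L i.+1 = L'.
  rewrite LS /extend take_oversize //; apply: leq_trans sL' (leq_trans _ cap_ge).
  rewrite leq_pexp2l // -ltnS prednK //; apply: leq_trans count_root_lowest.
  by rewrite ltnS -(subnKC iD) [iota 0 (_ + _)]iotaD count_cat leq_addr.
rewrite LE; split=> //.
  apply/flattenP; exists (branch i (take i f)); first exact: map_f.
  have fi : take i.+1 f = take i f ++ [:: nth 0%N f i] by rewrite cats1 -take_nth ?sf.
  rewrite fi; apply: map_f; rewrite mem_filter -fi vanishes_take // mem_iota add0n.
  by rewrite (allP fq) // mem_nth ?sf.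
apply/allP => _ /flattenP[_ /mapP[f' f'L ->] /mapP[v _ ->]].
by rewrite size_cat addn1 (eqP (allP si _ f'L)).
Qed.

End Interpolation.

Lemma size_kernel : (0 < W * s)%N -> (size (rows q0 d l m m' s w g u) < W * s)%N ->
  (size (kernel q0 d l m m' s w g u) <= W * s)%N.
Proof.
move=> n0 lt; rewrite /kernel; set L := foldl _ _ _.
suff: all (fun z : seq nat => size z == unknowns s w u) L.
  by rewrite /unknowns mulnC; case: L => //= z L /andP[/eqP -> _].
have : all (fun z : seq nat => size z == unknowns s w u) (unit_vectors (unknowns s w u)).
  by apply/allP => _ /mapP[a _ ->]; rewrite size_map size_iota.
rewrite /L; elim: (rows _ _ _ _ _ _ _ _ _) (unit_vectors _) => //= v vs IH L0 h0.
apply: IH; rewrite /eliminate; case: ifP => // _.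
by apply/allP => _ /mapP[a _ ->]; rewrite size_map size_iota.
Qed.

(* The guess of the lowest row of the kernel vector holding a non-zero
   coefficient. *)
Definition low_index (z : seq nat) : nat :=
  find (fun h => has (fun j => nth 0 z (h * s + j) %% p.+1 != 0)%N (iota 0 s)) (iota 0 W).

(** The degree [W] of the interpolants is subject to opposite demands: the [W * s] unknowns must
    outnumber the equations, while [W + D] must not exceed the number of roots from good blocks. *)
Theorem recover_complete f : (0 < s)%N -> m = (m' + s).-1 ->
  (forall a b, (a < m * g_m0 u)%N -> (b < m * g_m0 u)%N -> c ^+ a = c ^+ b :> F -> a = b) ->
  (g_m0 u * (l * m') < W * s)%N -> (D <= m * g_m0 u)%N -> (p.+1 ^ s.-1 <= g_cap u)%N ->
  g_low u = low_index (kernel q0 d l m m' s w g u) ->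
  size f = D -> all (fun y => y < p.+1)%N f ->
  (0 < W + D <= count (good_block f) (iota 0 (g_m0 u)) * m')%N ->
  f \in recover q0 d l m m' s w g u.
Proof.
move=> s0 mE c_inj Wl Dm cap lowE sf fq WD.
set z := kernel _ _ _ _ _ _ _ _ _ in lowE.
have sR : (size (rows q0 d l m m' s w g u) < W * s)%N.
  apply: leq_ltn_trans Wl; rewrite -[X in (_ <= X * _)%N](size_iota 0) /rows.
  rewrite -[X in (_ <= X * _)%N](size_map (fun i => flatten [seq [seq row m s w u i x t | t <-
    iota 0 m']
    | x <- candidates q0 d l g u i])).
  apply: size_flatten_le; rewrite all_map; apply/allP => i _ /=.
  apply: leq_trans (size_flatten_le (k := m') _) _.
    by rewrite all_map; apply/allP => x _ /=; rewrite size_map size_iota.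
  by rewrite size_map leq_mul2r size_take; apply/orP; right; case: ltnP.
have sz : (size z <= W * s)%N by apply: size_kernel => //; apply: leq_ltn_trans sR.
have [znz zR] : row_of p (unknowns s w u) z != 0 /\ forall v, v \in rows q0 d l m m' s w g u ->
    pairing v (row_of p (unknowns s w u) z) = 0.
  by apply: kernel_head => //; rewrite /unknowns mulnC.
have cE h j : (nth 0 z (h * s + j) %% p.+1 != 0)%N = (coefficient z h j != 0).
  by rewrite /coefficient (natF_eq0 q_prime).
have hasl : has (fun h => has (fun j => nth 0 z (h * s + j) %% p.+1 != 0)%N (iota 0 s)) (iota 0 W).
  have [a za] : exists a, row_of p (unknowns s w u) z 0 a != 0.
    apply/existsP; apply: contraNT znz; rewrite negb_exists => /forallP h.
    by apply/eqP/rowP => a; rewrite !mxE; move: (h a); rewrite negbK mxE => /eqP.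
  have an : (a < W * s)%N by rewrite mulnC; have := ltn_ord a.
  apply/hasP; exists (a %/ s)%N; first by rewrite mem_iota ltn_divLR.
  apply/hasP; exists (a %% s)%N; first by rewrite mem_iota ltn_pmod.
  by rewrite cE /coefficient -divn_eq; move: za; rewrite mxE.
rewrite /recover -/z -{1}(take_oversize (eq_leq sf)).
apply: mem_foldl_extend => //.
- move=> h j; rewrite lowE => hlow js.
  have hW : (h < W)%N.
    by apply: leq_trans hlow _; rewrite -[leqRHS](size_iota 0); exact: find_size.
  apply/eqP/negPn; rewrite -cE; have := before_find 0%N hlow; rewrite nth_iota //.
  by move/negbT/hasPn/(_ j); rewrite mem_iota; apply.
- have := nth_find 0%N hasl; rewrite -/(low_index z) -lowE.
  have lW : (g_low u < W)%N by rewrite lowE -[ltnRHS](size_iota 0) -has_find.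
  rewrite nth_iota // => /hasP[j]; rewrite mem_iota add0n => js.
  by rewrite cE => cj; exists j.
- exact: residual_eq0.
Qed.

End Recovery.

(** * The bipartite graph *)

Section Sampler.
Local Open Scope ring_scope.
Variable k : nat.
Local Notation V := {ffun 'I_k -> bool}.

Definition xorf (x y : V) : V := [ffun t => x t (+) y t].

Definition zerof : V := [ffun=> false].

(** The characters of the group F_2^k. For each [b] the graph is a Cayley graph of this group, and
    the characters diagonalise it. *)
Definition chi (u x : V) : rat := \prod_(t < k) (-1) ^+ (u t && x t).

Lemma xorfA x y z : xorf x (xorf y z) = xorf (xorf x y) z.
Proof. by apply/ffunP => t; rewrite !ffunE addbA. Qed.

Lemma xorff x : xorf x x = zerof.
Proof. by apply/ffunP => t; rewrite !ffunE addbb. Qed.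

Lemma xorf0 x : xorf x zerof = x.
Proof. by apply/ffunP => t; rewrite !ffunE addbF. Qed.

Lemma xorfK y : involutive (xorf^~ y).
Proof. by move=> x; rewrite -xorfA xorff xorf0. Qed.

Lemma chi_xor u x y : chi u (xorf x y) = chi u x * chi u y.
Proof.
rewrite -big_split; apply: eq_bigr => t _ /=; rewrite ffunE.
by case: (u t); case: (x t); case: (y t); rewrite /= ?expr0 ?expr1; ring.
Qed.

Lemma chi_sqr u x : chi u x * chi u x = 1.
Proof. by rewrite -chi_xor xorff /chi big1 // => t _; rewrite ffunE andbF. Qed.

Lemma chi_sign u x : (chi u x == 1) || (chi u x == -1).
Proof. by rewrite -sqrf_eq1 expr2 chi_sqr. Qed.

Lemma sum_chi x : \sum_u chi u x = if x == zerof then 2 ^+ k else 0.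
Proof.
rewrite -(bigA_distr_bigA (fun t b => (-1) ^+ (b && x t) : rat)).
case: eqP => [->|/eqP nz].
  rewrite -[X in 2 ^+ X]card_ord -prodr_const; apply: eq_bigr => t _.
  by rewrite big_bool /= ffunE !expr0.
have [t xt] : exists t, x t.
  apply/existsP; apply: contraNT nz; rewrite negb_exists => /forallP h.
  by apply/eqP/ffunP => t; rewrite ffunE; apply/negbTE.
by rewrite (bigD1 t) //= big_bool xt /= expr1 expr0 addNr mul0r.
Qed.

Definition fourier (phi : V -> rat) (u : V) : rat := \sum_x phi x * chi u x.

Lemma sum_shift (phi : V -> rat) y : \sum_x phi (xorf x y) = \sum_x phi x.
Proof. by rewrite [RHS](reindex_inj (inv_inj (xorfK y))). Qed.

(** Plancherel for two translates of [phi]: by orthogonality of the characters only the pairs with x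
    + y = s + s' remain. *)
Lemma correlation (phi : V -> rat) s s' :
  \sum_u fourier phi u ^+ 2 * (chi u s * chi u s') =
  2 ^+ k * \sum_a phi (xorf a s) * phi (xorf a s').
Proof.
have -> : \sum_u fourier phi u ^+ 2 * (chi u s * chi u s') =
    \sum_x \sum_y phi x * phi y * \sum_u chi u (xorf (xorf x y) (xorf s s')).
  rewrite [RHS](eq_bigr (fun x => \sum_u \sum_y phi x * phi y * chi u (xorf (xorf x y) (xorf s
    s')))); last first.
    by move=> x _; rewrite exchange_big; apply: eq_bigr => y _; rewrite mulr_sumr.
  rewrite [RHS]exchange_big; apply: eq_bigr => u _.
  rewrite expr2 /fourier mulr_suml mulr_suml; apply: eq_bigr => x _.
  rewrite mulr_sumr mulr_suml; apply: eq_bigr => y _.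
  by rewrite !chi_xor; ring.
rewrite -(sum_shift _ s) mulr_sumr; apply: eq_bigr => a _.
rewrite (bigD1 (xorf a s')) //= [X in _ + X]big1 ?addr0 => [|y ny].
  have -> : xorf (xorf (xorf a s) (xorf a s')) (xorf s s') = zerof.
    by apply/ffunP => t; rewrite !ffunE; case: (a t); case: (s t); case: (s' t).
  by rewrite sum_chi eqxx; ring.
rewrite sum_chi ifN ?mulr0 //; apply: contraNneq ny => /ffunP h.
apply/eqP/ffunP => t; move: (h t); rewrite !ffunE.
by case: (a t); case: (s t); case: (s' t); case: (y t).
Qed.

Lemma sum_mul_sqr (I J : finType) (w : I -> rat) (f : I -> J -> rat) :
  \sum_a w a * (\sum_j f a j) ^+ 2 = \sum_i \sum_j \sum_a w a * (f a i * f a j).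
Proof.
under [RHS]eq_bigr do rewrite exchange_big; rewrite [RHS]exchange_big.
apply: eq_bigr => a _; rewrite expr2 mulr_suml mulr_sumr; apply: eq_bigr => i _.
by rewrite mulr_sumr mulr_sumr.
Qed.

Section Expansion.
Variables d beta : nat.
Variable sigma : 'I_beta -> 'I_d -> V.
(** For independent random shifts the left side has mean [d * beta]; the factor 2 leaves room for
    deviations. *)
Hypothesis spectral : forall u, u != zerof ->
  \sum_b (\sum_j chi u (sigma b j)) ^+ 2 <= 2 * d%:R * beta%:R.

Lemma chi0 x : chi zerof x = 1.
Proof. by rewrite /chi big1 // => t _; rewrite ffunE. Qed.

(** In the Fourier basis the operators multiply by the character sums. The trivial character, which
    [spectral] does not control, has coefficient 0 because [phi] is centred. *)
Lemma operator_bound (phi : V -> rat) : \sum_x phi x = 0 ->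
  \sum_b \sum_a (\sum_j phi (xorf a (sigma b j))) ^+ 2 <=
  2 * d%:R * beta%:R * \sum_x phi x ^+ 2.
Proof.
move=> phi0; have k0 : 0 < 2 ^+ k :> rat by rewrite exprn_gt0.
rewrite -(ler_pM2l k0).
have -> : 2 ^+ k * (\sum_b \sum_a (\sum_j phi (xorf a (sigma b j))) ^+ 2) =
    \sum_u fourier phi u ^+ 2 * \sum_b (\sum_j chi u (sigma b j)) ^+ 2.
  rewrite mulr_sumr; under [RHS]eq_bigr do rewrite mulr_sumr.
  rewrite [RHS]exchange_big; apply: eq_bigr => b _.
  rewrite sum_mul_sqr -(eq_bigr _ (fun a _ => mul1r _)) sum_mul_sqr mulr_sumr.
  apply: eq_bigr => i _; rewrite mulr_sumr; apply: eq_bigr => j _.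
  by rewrite correlation; under eq_bigr do rewrite mul1r.
have -> : 2 ^+ k * (2 * d%:R * beta%:R * \sum_x phi x ^+ 2) =
    \sum_u fourier phi u ^+ 2 * (2 * d%:R * beta%:R).
  rewrite -mulr_suml; have := correlation phi zerof zerof.
  under eq_bigr do rewrite chi_sqr mulr1.
  move=> ->; have -> : \sum_a phi (xorf a zerof) * phi (xorf a zerof) = \sum_x phi x ^+ 2.
    by apply: eq_bigr => x _; rewrite xorf0 expr2.
  by ring.
apply: ler_sum => u _; case: (eqVneq u zerof) => [->|nz].
  rewrite /fourier; under eq_bigr do rewrite chi0 mulr1.
  by rewrite phi0 expr0n /= !mul0r.
by rewrite ler_wpM2l ?sqr_ge0 // spectral.
Qed.

(* If few left vertices see many right vertices of [T], Cauchy-Schwarz applied to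
   the centred indicator of the exceptional left vertices bounds their number. *)
Lemma few_exceptions (T : V -> 'I_beta -> bool) (A : {set V}) (z : nat) :
  (0 < d)%N -> (0 < beta)%N -> (0 < z)%N ->
  {in A, forall i, (\sum_b \sum_j T (xorf i (sigma b j)) b)%:R <=
     d%:R * (\sum_a \sum_b T a b)%:R / 2 ^+ k - (d * beta)%:R / z%:R :> rat} ->
  #|A|%:R * d%:R <= 2 * z%:R ^+ 2 * 2 ^+ k :> rat.
Proof.
move=> d0 b0 z0 hA.
have N0 : 0 < 2 ^+ k :> rat by rewrite exprn_gt0.
set N : rat := 2 ^+ k in N0 hA *.
pose ind (x : V) : rat := (x \in A)%:R.
pose alpha := #|A|%:R / N.
pose phi x := ind x - alpha.
have cardV : (#|{: V}|)%:R = N by rewrite card_ffun card_bool card_ord natrX.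
have sind : \sum_x ind x = #|A|%:R by rewrite -natr_sum -big_mkcond /= sum1_card.
have phi0 : \sum_x phi x = 0.
  rewrite sumrB sind sumr_const -[X in _ - X]mulr_natl cardV /alpha.
  by rewrite mulrCA mulfV ?mulr1 ?subrr // gt_eqF.
have phi2 : \sum_x phi x ^+ 2 <= #|A|%:R.
  have -> : \sum_x phi x ^+ 2 = #|A|%:R - alpha * #|A|%:R.
    rewrite (eq_bigr (fun x => ind x - alpha * ind x - alpha * phi x)) => [|x _]; last first.
      by rewrite /phi /ind; case: (x \in A) => /=; ring.
    by rewrite !sumrB -!mulr_sumr phi0 sind; ring.
  by rewrite lerBlDr lerDl mulr_ge0 ?divr_ge0 // ltW.
pose Y a b : rat := \sum_j phi (xorf a (sigma b j)).
pose t a b : rat := (T a b)%:R.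
pose M : rat := (\sum_a \sum_b T a b)%:R.
have S1 : \sum_a \sum_b t a b * Y a b = \sum_(i in A) (\sum_b \sum_j T (xorf i (sigma b j)) b)%:R
    - alpha * d%:R * M.
  have -> : \sum_(i in A) (\sum_b \sum_j T (xorf i (sigma b j)) b)%:R =
      \sum_b \sum_j \sum_a t a b * ind (xorf a (sigma b j)) :> rat.
    under eq_bigr do rewrite natr_sum; rewrite exchange_big; apply: eq_bigr => b _.
    under eq_bigr do rewrite natr_sum; rewrite exchange_big; apply: eq_bigr => j _.
    rewrite big_mkcond -(sum_shift _ (sigma b j)); apply: eq_bigr => a _.
    by rewrite xorfK /t /ind; case: (_ \in A); rewrite ?mulr1 ?mulr0.
  rewrite exchange_big.
  have -> : alpha * d%:R * M = \sum_b \sum_(j < d) \sum_a t a b * alpha.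
    rewrite /M exchange_big natr_sum mulr_sumr; apply: eq_bigr => b _.
    rewrite sumr_const card_ord natr_sum -mulr_suml -mulr_natl /t; ring.
  rewrite -sumrB; apply: eq_bigr => b _.
  rewrite -sumrB; under eq_bigr do rewrite /Y mulr_sumr.
  rewrite exchange_big; apply: eq_bigr => j _; rewrite -sumrB; apply: eq_bigr => a _.
  by rewrite /phi mulrBr.
have S2 : \sum_a \sum_b t a b * Y a b <= - (#|A|%:R * ((d * beta)%:R / z%:R)).
  rewrite S1; set S := \sum_(i in A) _.
  have le1 : S <= #|A|%:R * (d%:R * M / N) - #|A|%:R * ((d * beta)%:R / z%:R).
    apply: (@le_trans _ _ (\sum_(i in A) (d%:R * M / N - (d * beta)%:R / z%:R))).
      by apply: ler_sum => i iA; exact: hA.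
    by rewrite sumr_const -[X in X <= _]mulr_natl mulrBr.
  have -> : alpha * d%:R * M = #|A|%:R * (d%:R * M / N) by rewrite /alpha; ring.
  by rewrite -subr_le0; move: le1; rewrite -subr_le0; congr (_ <= 0); ring.
have M0 : M <= N * beta%:R.
  rewrite /M -cardV -natrM ler_nat.
  apply: (@leq_trans (\sum_(a : V) \sum_(b < beta) 1)).
    by apply: leq_sum => a _; apply: leq_sum => b _; case: (T a b).
  by rewrite !sum_nat_const card_ord muln1.
have P0 : \sum_a \sum_b Y a b ^+ 2 <= 2 * d%:R * beta%:R * #|A|%:R.
  rewrite exchange_big; apply: le_trans (operator_bound phi0) _.
  by rewrite ler_wpM2l // mulr_ge0 // mulr_ge0.
have M_ge0 : 0 <= M by apply: ler0n.
have tM : \sum_a \sum_b t a b ^+ 2 = M.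
  rewrite /M natr_sum; apply: eq_bigr => a _; rewrite natr_sum; apply: eq_bigr => b _.
  by rewrite /t; case: (T a b); rewrite ?expr1n ?expr0n.
set E := #|A|%:R * _ in S2.
have cs c : 0 <= c -> 0 <= 2 * d%:R * beta%:R * #|A|%:R - 2 * c * E + c ^+ 2 * (N * beta%:R) :> rat.
  move=> c_ge0; have : 0 <= \sum_a \sum_b (Y a b + c * t a b) ^+ 2.
    by apply: sumr_ge0 => a _; apply: sumr_ge0 => b _; apply: sqr_ge0.
  have -> : \sum_a \sum_b (Y a b + c * t a b) ^+ 2 = \sum_a \sum_b Y a b ^+ 2
      + 2 * c * (\sum_a \sum_b t a b * Y a b) + c ^+ 2 * M.
    rewrite -tM !mulr_sumr -!big_split; apply: eq_bigr => a _ /=.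
    rewrite !mulr_sumr -!big_split; apply: eq_bigr => b _ /=; ring.
  move=> /le_trans; apply; apply: lerD; last by rewrite ler_wpM2l // sqr_ge0.
  apply: lerD => //; have := ler_wpM2l (_ : 0 <= 2 * c) S2.
  by rewrite mulrN; apply; rewrite mulr_ge0.
have [|A0] := posnP #|A|.
  by move=> ->; rewrite mul0r mulr_ge0 // ?mulr_ge0 ?sqr_ge0 // ltW.
have A0' : 0 < #|A|%:R :> rat by rewrite ltr0n.
have d0' : 0 < d%:R :> rat by rewrite ltr0n.
have b0' : 0 < beta%:R :> rat by rewrite ltr0n.
have z0' : 0 < z%:R :> rat by rewrite ltr0n.
have E0 : 0 <= E by rewrite /E mulr_ge0 ?divr_ge0.
have Nb : 0 < N * beta%:R by rewrite mulr_gt0.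
(* The quadratic in [c] has its minimum here, which gives [E ^ 2 <= 2 * d * beta * #|A| * (N *
   beta)]; the claim follows by cancelling. *)
have := cs (E / (N * beta%:R)) (divr_ge0 E0 (ltW Nb)).
have -> : 2 * d%:R * beta%:R * #|A|%:R - 2 * (E / (N * beta%:R)) * E +
    (E / (N * beta%:R)) ^+ 2 * (N * beta%:R) =
    beta%:R * d%:R * #|A|%:R / (N * z%:R ^+ 2) * (2 * z%:R ^+ 2 * N - #|A|%:R * d%:R).
  by rewrite /E natrM; field; rewrite ?gt_eqF.
rewrite pmulr_rge0 ?subr_ge0 // divr_gt0 ?mulr_gt0 // exprn_gt0 //.
Qed.

End Expansion.
End Sampler.

(** * Existence of a good seed of logarithmic length *)

Section Seeds.
Local Open Scope ring_scope.
Variables k d beta : nat.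
Local Notation L := (d * beta + k)%N.
Local Notation V := {ffun 'I_k -> bool}.
Local Notation seed := {ffun 'I_L -> bool}.

Definition at_seed (s : seed) (n : nat) : bool := if insub n is Some i then s i else false.

(** Overlapping windows draw all [d * beta] shifts from [d * beta + k] bits. Independent shifts
    would take [d * beta * k] bits, too many for trying all seeds in polynomial time when [beta] is
    of order [k]. *)
Definition window (s : seed) (e : nat) : V := [ffun t : 'I_k => at_seed s (e + t)].

Definition flip (p : nat) (s : seed) : seed := [ffun i => s i (+) (val i == p)].

Lemma flipK p : involutive (flip p).
Proof. by move=> s; apply/ffunP => i; rewrite !ffunE -addbA addbb addbF. Qed.

Lemma at_flip p s n : (p < L)%N -> at_seed (flip p s) n = at_seed s n (+) (n == p).
Proof.
move=> pL; rewrite /at_seed; case: insubP => [i _ <-|nL]; first by rewrite ffunE.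
by case: eqP nL => // ->; rewrite pL.
Qed.

(** [e + t = e0 + top] with [e <= e0] and [t <= top] forces [e = e0]. The flipped bit therefore
    changes the sign at [e0], but [u] does not see it through any earlier window. *)
Lemma chi_flip (u : V) (top : 'I_k) s e e0 : u top -> (forall t, u t -> t <= top)%N ->
  (e0 < d * beta)%N -> (e <= e0)%N ->
  chi u (window (flip (e0 + top) s) e) = (-1) ^+ (e == e0) * chi u (window s e).
Proof.
move=> utop umax e0L ee0; have pL : (e0 + top < L)%N by have := ltn_ord top; lia.
pose delta : V := [ffun t : 'I_k => (e + t == e0 + top)%N].
have -> : window (flip (e0 + top) s) e = xorf (window s e) delta.
  by apply/ffunP => t; rewrite !ffunE at_flip.
rewrite chi_xor mulrC; congr (_ * _); rewrite /chi (bigD1 top) //= ffunE utop eqn_add2r.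
rewrite big1 ?mulr1 // => t tt; rewrite ffunE; case: (boolP (u t)) => //= ut.
have := umax t ut; have : nat_of_ord t != top by [].
by move=> ? ?; have -> : (e + t == e0 + top)%N = false by lia.
Qed.

Definition pair_sign (u : V) (j j' : nat) (b : nat) (s : seed) : rat :=
  chi u (window s (b * d + j)) * chi u (window s (b * d + j')).

(** For the largest index [bm] of [J], the window at [bm * d + j] is the last one in the product. By
    [chi_flip] some flip negates its sign alone, which pairs off the seeds with opposite values. *)
Lemma sum_pair_signs u j j' (J : {set 'I_beta}) : u != zerof k -> (j' < j < d)%N ->
  J != finset.set0 -> \sum_s \prod_(b in J) pair_sign u j j' b s = 0.
Proof.
move=> nz /andP[j'j jd] /set0Pn[b0 b0J].
have [t0 ut0] : exists t, u t.
  apply/existsP; apply: contraNT nz; rewrite negb_exists => /forallP h.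
  by apply/eqP/ffunP => t; rewrite ffunE; apply/negbTE.
have [top utop umax] := @arg_maxnP _ t0 (fun t => u t) (@nat_of_ord k) ut0.
have [bm bmJ bmax] := @arg_maxnP _ b0 (fun b => b \in J) (@nat_of_ord beta) b0J.
pose e0 := (bm * d + j)%N.
have lim b i : (b < beta)%N -> (i < d)%N -> (b * d + i < d * beta)%N.
  move=> bb id_; have : (d * b.+1 <= d * beta)%N by rewrite leq_mul2l bb orbT.
  by rewrite mulnS mulnC; lia.
have e0L : (e0 < d * beta)%N by apply: lim.
have flipE s : \prod_(b in J) pair_sign u j j' b (flip (e0 + top) s) =
    - \prod_(b in J) pair_sign u j j' b s.
  rewrite (bigD1 bm) //= [in RHS](bigD1 bm) //= -mulNr; congr (_ * _).
    rewrite /pair_sign !(chi_flip _ utop umax) //; last by rewrite /e0; lia.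
    have -> : (bm * d + j' == e0)%N = false by rewrite /e0; lia.
    by rewrite eqxx /= expr1 expr0; ring.
  apply: eq_bigr => b /andP[bJ bbm].
  have lt : (b < bm)%N by rewrite ltn_neqAle bbm; apply: bmax.
  have lt' : (b * d + d <= bm * d)%N by rewrite addnC -mulSn leq_mul2r lt orbT.
  rewrite /pair_sign !(chi_flip _ utop umax) // /e0; try lia.
  have -> : (b * d + j == bm * d + j)%N = false by lia.
  have -> : (b * d + j' == bm * d + j)%N = false by lia.
  by rewrite !expr0 !mul1r.
have e : \sum_s \prod_(b in J) pair_sign u j j' b s =
    - \sum_s \prod_(b in J) pair_sign u j j' b s.
  rewrite {1}(reindex_inj (inv_inj (flipK (e0 + top)))) /= -sumrN.
  by apply: eq_bigr => s _; apply: flipE.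
by move: e; lra.
Qed.

(** After expansion only the empty product has a nonzero mean: despite the overlaps the pair signs
    behave like independent fair signs. *)
Lemma expected_product (theta : rat) u j j' : u != zerof k -> (j' < j < d)%N ->
  \sum_s \prod_(b < beta) (1 + theta * pair_sign u j j' b s) = 2 ^+ L.
Proof.
move=> nz jj.
have expand s : \prod_(b < beta) (1 + theta * pair_sign u j j' b s) =
    \sum_(J : {set 'I_beta}) \prod_(b < beta) (if b \in J then theta * pair_sign u j j' b s else 1).
  by under eq_bigr do rewrite addrC; rewrite bigA_distr.
under eq_bigr do rewrite expand.
rewrite exchange_big /= (bigD1 finset.set0) //= [X in _ + X]big1 ?addr0 => [|J J0].
  rewrite (eq_bigr (fun=> 1)) => [|s _]; last by rewrite big1 // => b _; rewrite inE.
  by rewrite sumr_const card_ffun card_bool card_ord natrX.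
rewrite (eq_bigr (fun s => theta ^+ #|J| * \prod_(b in J) pair_sign u j j' b s)) => [|s _];
  last first.
  by rewrite -big_mkcond big_split /= prodr_const.
by rewrite -mulr_sumr sum_pair_signs // mulr0.
Qed.

Lemma pair_sign_pm1 u j j' b s : (pair_sign u j j' b s == 1) || (pair_sign u j j' b s == -1).
Proof. by rewrite /pair_sign -chi_xor chi_sign. Qed.

(* Chernoff: a large value of the sum makes the product of the (1 + theta x_b)
   exponentially large, for theta = 1 / (2 d). *)
Lemma large_product (x : 'I_beta -> rat) v : (0 < d)%N -> (8 * d ^ 2 * v <= beta)%N ->
  (forall b, (x b == 1) || (x b == -1)) -> beta%:R <= d%:R * \sum_b x b ->
  2 ^+ v <= \prod_b (1 + (2 * d%:R)^-1 * x b).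
Proof.
move=> d0 hv hx hs; set th := (2 * d%:R)^-1.
have d1 : 1 <= d%:R :> rat by rewrite ler1n.
have thE : th * (2 * d%:R) = 1 by rewrite mulVf // gt_eqF // mulr_gt0 // ltr0n.
have th0 : 0 < th by rewrite invr_gt0 mulr_gt0 // ltr0n.
have th1 : th <= 1 / 2 by nra.
pose P := [set b | x b == 1]%SET.
have xE b : x b = if b \in P then 1 else -1.
  by rewrite inE; have := hx b; case: eqP => [->|] //= _ /eqP ->.
have prodE : \prod_b (1 + th * x b) = (1 + th) ^+ #|P| * (1 - th) ^+ #|~: P|.
  rewrite (bigID (mem P)) /= -!prodr_const; congr (_ * _).
    by apply: eq_bigr => b bP; rewrite xE bP mulr1.
  apply: eq_big => [b|b bP]; first by rewrite !inE.
  by rewrite xE (negbTE bP) mulrN1.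
have sumE : \sum_b x b = #|P|%:R - #|~: P|%:R.
  rewrite (bigID (mem P)) /= -!sum1_card !natr_sum -sumrN; congr (_ + _).
    by apply: eq_bigr => b bP; rewrite xE bP.
  apply: eq_big => [b|b bP]; first by rewrite !inE.
  by rewrite xE (negbTE bP).
have cE : (#|P| + #|~: P| = beta)%N by rewrite cardsC card_ord.
move: sumE hs prodE cE; move: #|P| #|~: P| => a c -> hs -> cE.
have ac : (beta + d * c <= d * a)%N.
  by rewrite -(ler_nat rat) natrD !natrM -lerBrDr -mulrBr.
have {}ac : (beta <= d * (a - c))%N by rewrite mulnBr; lia.
have acE : (a = c + (a - c))%N.
  by case: (leqP c a) => h; [lia|exfalso; move: ac; rewrite (eqP (ltnW h)); nia].
(* Opposite signs are paired at the cost of [1 - th ^+ 2] each, and at least [beta / d] positive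
   signs remain. Raising to the power [d] below avoids this quotient. *)
have -> : (1 + th) ^+ a * (1 - th) ^+ c = (1 - th ^+ 2) ^+ c * (1 + th) ^+ (a - c).
  rewrite [in LHS]acE exprD (_ : 1 - th ^+ 2 = (1 + th) * (1 - th)); last by ring.
  by rewrite exprMn; ring.
have q0 : 0 <= 1 - th ^+ 2 by rewrite expr2; nra.
have q1 : 1 - th ^+ 2 <= 1 by rewrite lerBlDr lerDl sqr_ge0.
have bern (y : rat) n : -1 <= y -> 1 + n%:R * y <= (1 + y) ^+ n.
  move=> y1; elim: n => [|n IH]; first by rewrite mul0r addr0 expr0.
  rewrite exprS; apply: le_trans (ler_wpM2l _ IH); last by lra.
  have : 0 <= n%:R * y ^+ 2 by rewrite mulr_ge0 ?sqr_ge0.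
  by rewrite -natr1 expr2; nra.
rewrite -(@ler_pXn2r _ d) //; last 2 first.
- by rewrite nnegrE exprn_ge0.
- by rewrite nnegrE mulr_ge0 // exprn_ge0 //; lra.
apply: (@le_trans _ _ (((1 - th ^+ 2) ^+ d * (1 + th)) ^+ beta)); last first.
  rewrite !exprMn -!exprM; apply: ler_pM; rewrite ?exprn_ge0 //; first by lra.
    have h : (c * d <= d * beta)%N by rewrite mulnC leq_mul2l; apply/orP; right; lia.
    exact: ler_wiXn2l.
  by apply: ler_weXn2l; [lra|rewrite mulnC].
(* Bernoulli's inequality gives [(1 - th / 2) * (1 + th)], which is at least [1 + th / 4] for
   [th <= 1 / 2]; this is the origin of the 8 in the hypothesis on [beta]. *)
have base : 1 + (8 * d%:R)^-1 <= (1 - th ^+ 2) ^+ d * (1 + th).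
  have b1 := bern (- th ^+ 2) d ltac:(lra).
  apply: (@le_trans _ _ ((1 + d%:R * - th ^+ 2) * (1 + th))); last first.
    by rewrite ler_wpM2r //; lra.
  have -> : (8 * d%:R)^-1 = th / 4.
    by rewrite /th; field; rewrite pnatr_eq0 -lt0n.
  have -> : d%:R * - th ^+ 2 = - (th / 2).
    by rewrite /th; field; rewrite pnatr_eq0 -lt0n.
  by nra.
have e0 : 0 <= (8 * d%:R)^-1 :> rat by rewrite invr_ge0 mulr_ge0.
apply: (@le_trans _ _ ((1 + (8 * d%:R)^-1) ^+ beta)); last first.
  by apply: lerXn2r => //; rewrite nnegrE; lra.
apply: (@le_trans _ _ ((1 + (8 * d%:R)^-1) ^+ (8 * d * (d * v)))); last first.
  by apply: ler_weXn2l; [lra|rewrite (leq_trans _ hv) // mulnA -(mulnA 8) mulnn].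
have -> : (2 ^+ v) ^+ d = 2 ^+ (d * v) :> rat by rewrite -exprM mulnC.
rewrite [leRHS]exprM; apply: lerXn2r; [by []|by apply: exprn_ge0; lra|].
apply: le_trans (bern _ _ _); last by lra.
by rewrite natrM le_eqVlt; apply/orP; left; apply/eqP; field; rewrite pnatr_eq0 -lt0n.
Qed.

(** Union bound over 2^k characters and d^2 < 4^d pairs, each failing with probability at most 2^-(k
    + 2 d). Otherwise every off-diagonal correlation is at most [beta / d], and the diagonal and the
    rest of the square contribute at most [d * beta] each. *)
Lemma good_seed : (0 < d)%N -> (8 * d ^ 2 * (k + 2 * d) <= beta)%N ->
  exists s : seed, forall u, u != zerof k ->
    \sum_(b < beta) (\sum_(j < d) chi u (window s (b * d + j))) ^+ 2 <= 2 * d%:R * beta%:R.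
Proof.
move=> d0 hb; set v := (k + 2 * d)%N in hb.
pose bad (u : V) (j j' : 'I_d) (s : seed) :=
  [&& u != zerof k, (j' < j)%N & beta%:R <= d%:R * \sum_(b < beta) pair_sign u j j' b s].
have count_bad u j j' : (\sum_s (bad u j j' s : nat))%:R * 2 ^+ v <= 2 ^+ L :> rat.
  case: (boolP ((u != zerof k) && (j' < j)%N)) => [/andP[nz jj]|h]; last first.
    rewrite big1 ?mul0r ?exprn_ge0 // => s _; rewrite /bad andbA (negbTE h); by [].
  rewrite -(expected_product (2 * d%:R)^-1 nz (_ : j' < j < d)%N) ?jj ?ltn_ord //.
  rewrite natr_sum mulr_suml; apply: ler_sum => s _.
  case: (boolP (bad u j j' s)) => [/and3P[_ _ hs]|_].
    by rewrite mul1r; apply: large_product => // b; apply: pair_sign_pm1.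
  rewrite mul0r; apply: prodr_ge0 => b _.
  have d1 : 1 <= d%:R :> rat by rewrite ler1n.
  have : (2 * d%:R)^-1 <= 1 :> rat by rewrite invf_le1; lra.
  have : 0 <= (2 * d%:R)^-1 :> rat by rewrite invr_ge0 mulr_ge0.
  by case/orP: (pair_sign_pm1 u j j' b s) => /eqP ->; lra.
have [s gs] : exists s, [forall u, forall j, forall j', ~~ bad u j j' s].
  apply/existsP; apply: contraT; rewrite negb_exists => /forallP h.
  have : 2 ^+ L * 2 ^+ v <= \sum_(u : V) \sum_(j < d) \sum_(j' < d) (2 ^+ L : rat).
    apply: (@le_trans _ _ (\sum_u \sum_j \sum_j' (\sum_s (bad u j j' s : nat))%:R * 2 ^+ v));
      last first.
      by do 3!apply: ler_sum => ? _; apply: count_bad.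
    have -> : 2 ^+ L = (\sum_(s : seed) 1)%:R :> rat.
      by rewrite sum1_card card_ffun card_bool card_ord natrX.
    have -> : \sum_u \sum_j \sum_j' (\sum_s (bad u j j' s : nat))%:R * 2 ^+ v =
        (\sum_s \sum_u \sum_j \sum_j' (bad u j j' s : nat))%:R * 2 ^+ v :> rat.
      rewrite [in RHS]exchange_big natr_sum mulr_suml; apply: eq_bigr => u _.
      rewrite [in RHS]exchange_big natr_sum mulr_suml; apply: eq_bigr => j _.
      by rewrite [in RHS]exchange_big natr_sum mulr_suml; apply: eq_bigr => j' _.
    rewrite ler_wpM2r ?exprn_ge0 // ler_nat; apply: leq_sum => s _.
    move: (h s); rewrite negb_forall => /existsP[u]; rewrite negb_forall => /existsP[j].
    rewrite negb_forall => /existsP[j']; rewrite negbK => bs.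
    by rewrite (bigD1 u) //= (bigD1 j) //= (bigD1 j') //= bs.
  rewrite !sumr_const !card_ord card_ffun card_bool card_ord -!mulrnA -[leRHS]mulr_natl.
  rewrite mulrC ler_pM2r ?exprn_gt0 // -natrX ler_nat /v expnD mulnA [leqRHS]mulnC.
  rewrite leq_pmul2l ?expn_gt0 // mul2n -addnn expnD leqNgt.
  by have ld := ltn_expl d (isT : 1 < 2)%N; rewrite ltn_mul.
exists s => u nz.
have sq : \sum_(b < beta) (\sum_(j < d) chi u (window s (b * d + j))) ^+ 2 =
    \sum_(j < d) \sum_(j' < d) \sum_(b < beta) pair_sign u j j' b s.
  have := sum_mul_sqr (fun=> 1) (fun (b : 'I_beta) (j : 'I_d) => chi u (window s (b * d + j))).
  under eq_bigr do rewrite mul1r; move=> ->; apply: eq_bigr => j _; apply: eq_bigr => j' _.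
  by apply: eq_bigr => b _; rewrite mul1r.
rewrite sq.
have dR : 0 < d%:R :> rat by rewrite ltr0n.
have small (j j' : 'I_d) : j != j' -> \sum_(b < beta) pair_sign u j j' b s <= beta%:R / d%:R.
  have small' (i i' : 'I_d) : (i' < i)%N -> \sum_(b < beta) pair_sign u i i' b s <= beta%:R / d%:R.
    move=> ii; rewrite ler_pdivlMr // mulrC ltW // ltNge.
    by move/forallP/(_ u)/forallP/(_ i)/forallP/(_ i'): gs; rewrite /bad nz ii.
  move=> ne; case: (ltngtP j j') => [jj|jj|/val_inj jj]; last by rewrite jj eqxx in ne.
    by under eq_bigr do rewrite /pair_sign mulrC; apply: small'.
  exact: small'.
apply: (@le_trans _ _ (\sum_(j < d) \sum_(j' < d) ((j == j')%:R * beta%:R + beta%:R / d%:R))).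
  apply: ler_sum => j _; apply: ler_sum => j' _; case: (eqVneq j j') => [->|ne].
    under eq_bigr do rewrite /pair_sign chi_sqr.
    by rewrite sumr_const card_ord mul1r lerDl divr_ge0.
  by rewrite mul0r add0r small.
under eq_bigr => j _.
  rewrite big_split /= sumr_const card_ord (bigD1 j) //= eqxx big1 => [|j' ne]; last first.
    by rewrite eq_sym (negbTE ne) mul0r.
  over.
rewrite sumr_const card_ord -[X in _ + X]mulr_natl -mulr_natr mulr1n le_eqVlt; apply/orP; left;
  apply/eqP.
by field; rewrite gt_eqF.
Qed.

End Seeds.

Section NeighborSampler.
Local Open Scope nat_scope.
Variables k d beta : nat.
Local Notation V := {ffun 'I_k -> bool}.

Definition bits (i : nat) : V := [ffun t : 'I_k => digit 2 t i == 1].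

Lemma digit2 t i : digit 2 t i = (digit 2 t i == 1).
Proof. by have := digit_lt t i (isT : 0 < 2); case: (digit 2 t i) => [|[]]. Qed.

Lemma bits_inj i i' : i < 2 ^ k -> i' < 2 ^ k -> bits i = bits i' -> i = i'.
Proof.
move=> hi hi' /ffunP e.
have {}e t : t < k -> digit 2 t i = digit 2 t i'.
  by move=> tk; have := e (Ordinal tk); rewrite !ffunE /= => et; rewrite digit2 et -digit2.
have dS t j : digit 2 t.+1 j = digit 2 t (j %/ 2) by rewrite !digitE expnS divnMA.
elim: (k) i i' hi hi' e => [|k' IH] i i'; first by rewrite expn0 !ltnS !leqn0 => /eqP-> /eqP->.
rewrite expnS => hi hi' e.
rewrite (divn_eq i 2) (divn_eq i' 2); have := e 0 isT; rewrite !digitE expn0 !divn1 => ->.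
congr (_ * _ + _); apply: IH; rewrite ?ltn_divLR ?[_ * 2]mulnC // => t tk.
by rewrite -!dS e.
Qed.

Definition obits (i : 'I_(2 ^ k)) : V := bits i.

Lemma obits_bij : bijective obits.
Proof.
apply: inj_card_bij; last by rewrite card_ffun card_bool !card_ord.
by move=> i i' /bits_inj e; apply: val_inj; apply: e.
Qed.

Variable u : seq nat.
Hypothesis kE : g_k u = k.
Hypothesis m0E : g_m0 u = 2 ^ k.
Hypothesis betaE : g_beta u = beta.

Definition good_shift (sd : nat) : Prop :=
  exists2 s : {ffun 'I_(d * beta + k) -> bool},
    (forall n, n < d * beta + k -> digit 2 n sd = at_seed s n) &
    forall v, v != zerof k ->
      (\sum_(b < beta) (\sum_(j < d) chi v (window s (b * d + j))) ^+ 2 <= 2 * d%:R * beta%:R)%R.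

Lemma exists_good_shift : 0 < d -> 8 * d ^ 2 * (k + 2 * d) <= beta ->
  exists2 sd, sd < 2 ^ (d * beta + k) & good_shift sd.
Proof.
move=> d0 /(good_seed d0)[s hs].
have lt t : (at_seed s t : nat) < 2 by case: (at_seed s t).
have [lt1 dg] := horner_digits (K := 2 ^ (d * beta + k)) 0 lt (leqnn _).
by eexists; [exact: lt1|exists s => // n nL; rewrite dg].
Qed.

Hypothesis shift : good_shift (g_seed u).

Lemma neighbor_lt e i : neighbor u e i < 2 ^ k.
Proof.
rewrite /neighbor kE m0E.
pose y t := (digit 2 t i + digit 2 (e + t) (g_seed u)) %% 2.
have lt t : y t < 2 by rewrite ltn_pmod.
by have [] := horner_digits (K := 2 ^ k) 0 lt (leqnn _).
Qed.

Lemma bits_neighbor (s : {ffun 'I_(d * beta + k) -> bool}) e i : (forall n, n < d * beta + k ->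
  digit 2 n (g_seed u) = at_seed s n) ->
  e < d * beta -> bits (neighbor u e i) = xorf (bits i) (window s e).
Proof.
move=> hs he; apply/ffunP => t; rewrite !ffunE /neighbor kE m0E.
pose y t := (digit 2 t i + digit 2 (e + t) (g_seed u)) %% 2.
have lt t' : y t' < 2 by rewrite ltn_pmod.
have [_ ->] := horner_digits (K := 2 ^ k) 0 lt (leqnn _) => //.
rewrite add0n /y hs; last by have := ltn_ord t; lia.
by rewrite digit2; case: (digit 2 t i == 1); case: (at_seed s _).
Qed.

Definition degree (T : nat -> bool) (i : nat) : nat :=
  count (fun e => T (neighbor u e i * beta + e %/ d)) (iota 0 (d * beta)).

Lemma count_iota_mul (P : nat -> bool) a b :
  count P (iota 0 (a * b)) = \sum_(i < a) \sum_(j < b) P (i * b + j).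
Proof.
rewrite -sum1_count -(subn0 (a * b)) -/(index_iota 0 (a * b)) big_mkcond big_nat_mul big_mkord.
apply: eq_bigr => i _; rewrite -{1}(add0n (i * b)) big_addn mulSn addnK big_mkord.
by apply: eq_bigr => j _; rewrite addnC; case: (P _).
Qed.

Theorem neighbor_sampler (T : nat -> bool) (tau z : nat) :
  0 < d -> 0 < beta -> 0 < z ->
  (tau%:R <= d%:R * (count T (iota 0 (2 ^ k * beta)))%:R / 2 ^+ k - (d * beta)%:R / z%:R
    :> rat)%R ->
  count (fun i => degree T i < tau) (iota 0 (2 ^ k)) * d <= 2 * z ^ 2 * 2 ^ k.
Proof.
move=> d0 b0 z0 htau; have [s hs spec] := shift.
have [num bitsK numK] := obits_bij.
pose T' (x : V) (b : 'I_beta) := T (num x * beta + b).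
pose A := [set x | degree T (num x) < tau]%SET.
have edge (i : 'I_(2 ^ k)) : degree T i =
    \sum_(b < beta) \sum_(j < d) T' (xorf (obits i) (window s (b * d + j))) b.
  rewrite /degree mulnC count_iota_mul; apply: eq_bigr => b _; apply: eq_bigr => j _.
  have he : b * d + j < d * beta.
    have : d * b.+1 <= d * beta by rewrite leq_mul2l ltn_ord orbT.
    by have := ltn_ord j; rewrite mulnS mulnC; lia.
  rewrite /T' -(bits_neighbor i hs he).
  rewrite -[bits _]/(obits (Ordinal (neighbor_lt (b * d + j) i))) bitsK /=.
  by rewrite divnMDl // divn_small // addn0.
have cM : count T (iota 0 (2 ^ k * beta)) = \sum_x \sum_b T' x b.
  rewrite count_iota_mul (reindex obits) /=; last by apply: onW_bij; exists num.
  by apply: eq_bigr => i _; apply: eq_bigr => b _; rewrite /T' bitsK.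
have hA : {in A, forall i, ((\sum_(b < beta) \sum_(j < d) T' (xorf i (window s (b * d + j)))
  b)%:R <=
     d%:R * (\sum_a \sum_(b < beta) T' a b)%:R / 2 ^+ k - (d * beta)%:R / z%:R :> rat)%R}.
  move=> x; rewrite inE => hx; rewrite -cM; apply: le_trans htau.
  by rewrite ler_nat ltnW // -{1}[x]numK -edge.
have := few_exceptions spec d0 b0 z0 hA.
have -> : #|A| = count (fun i => degree T i < tau) (iota 0 (2 ^ k)).
  rewrite -sum1_count -(subn0 (2 ^ k)) -/(index_iota 0 (2 ^ k)) big_mkcond big_mkord.
  rewrite -sum1_card big_mkcond (reindex obits) /=; last by apply: onW_bij; exists num.
  by apply: eq_bigr => i _; rewrite inE bitsK.
by rewrite -natrX -[(2 ^+ k)%R](natrX _ 2) -!natrM ler_nat.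
Qed.

End NeighborSampler.

(** * The inner code *)

Section InnerCode.
Local Open Scope nat_scope.

Lemma count_iota (a : nat -> bool) n : count a (iota 0 n) = \sum_(i < n) a i.
Proof.
have -> : iota 0 n = index_iota 0 n by rewrite /index_iota subn0.
by rewrite -sum1_count big_mkcond big_mkord; apply: eq_bigr => i _; case: (a i).
Qed.

(** Among the numbers below [A * b ^ B] every combination of the last [B] digits occurs [A] times,
    so the digits are independent. *)
Lemma sum_digits (b A B : nat) (g : nat -> nat -> nat) : 0 < b ->
  \sum_(v < A * b ^ B) \prod_(e < B) g e (digit b e v) = A * \prod_(e < B) \sum_(t < b) g e t.
Proof.
move=> b0; elim: B g => [|B IH] g.
  rewrite expn0 muln1 (eq_bigr (fun=> 1)) => [|v _]; last by rewrite big_ord0.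
  by rewrite big_ord0 sum_nat_const card_ord.
rewrite expnSr mulnA -(big_mkord predT (fun v => \prod_(e < B.+1) g e (digit b e v))).
rewrite big_nat_mul big_mkord big_ord_recl mulnCA -(IH (fun e => g e.+1)) big_distrr /=.
apply: eq_bigr => v _; rewrite -{1}(add0n (v * b)) big_addn mulSn addnK big_mkord.
rewrite big_distrl /=; apply: eq_bigr => t _; rewrite big_ord_recl /=.
have -> : digit b 0 (t + v * b) = t by rewrite digitE expn0 divn1 addnC modnMDl modn_small.
congr (_ * _); apply: eq_bigr => e _; congr (g _ _).
by rewrite !digitE /bump /= add1n expnS divnMA divnDMl // [t %/ b]divn_small // add0n.
Qed.

Section Agreement.
Variables (b B P : nat).
Hypothesis b0 : 0 < b.

Definition matches (y : nat -> nat) (v : nat) : nat :=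
  count (fun e => y e == digit b e v) (iota 0 B).

(** An exponential moment: a matching digit has weight [b.+1] and any other weight 1, so a position
    has total weight exactly [2 * b]. Rounding [P] up to a multiple of [b ^ B] at most doubles it
    and makes the digits independent. *)
Lemma few_matching (y : nat -> nat) tau : (forall e, y e < b) -> b ^ B <= P ->
  count (fun v => tau <= matches y v) (iota 0 P) * b ^ tau <= 2 ^ B.+1 * P.
Proof.
move=> hy bP; pose g e t := if y e == t then b.+1 else 1.
have gE v : b ^ matches y v <= \prod_(e < B) g e (digit b e v).
  rewrite /matches count_iota expn_sum; apply: leq_prod => e _; rewrite /g.
  by case: eqP => _; rewrite ?expn0 ?expn1.
have sg e : \sum_(t < b) g e t = 2 * b.
  rewrite (bigD1 (Ordinal (hy e))) //= /g eqxx (eq_bigr (fun=> 1)) => [|t nt]; last first.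
    by rewrite ifN // eq_sym.
  by rewrite sum1_card cardC1 card_ord; lia.
have bnd : count (fun v => tau <= matches y v) (iota 0 P) * b ^ tau <=
    \sum_(v < P) \prod_(e < B) g e (digit b e v).
  rewrite count_iota big_distrl /=.
  apply: leq_sum => v _; case: (leqP tau _) => h; last by rewrite mul0n.
  by rewrite mul1n; apply: leq_trans (gE v); rewrite leq_pexp2l.
apply: leq_trans bnd _.
have [A [hA AP]] : exists A, P <= A * b ^ B /\ A * b ^ B <= 2 * P.
  exists (P %/ b ^ B).+1; rewrite ltnW ?ltn_ceil ?expn_gt0 ?b0 //; split=> //.
  by rewrite mulSn mul2n -addnn leq_add // leq_divM.
apply: (@leq_trans (\sum_(v < A * b ^ B) \prod_(e < B) g e (digit b e v))).
  rewrite -!(big_mkord predT (fun v => \prod_(e < B) g e (digit b e v))).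
  by rewrite [leqRHS](@big_cat_nat _ _ _ P) //= leq_addr.
rewrite sum_digits // (eq_bigr (fun=> 2 * b)) => [|e _]; last exact: sg.
rewrite prod_nat_const card_ord expnMn mulnCA expnSr -mulnA leq_mul2l AP orbT.
by [].
Qed.

End Agreement.

Variables (p b B K l tau : nat).
Local Notation P := p.+1.
Hypothesis P_prime : prime P.
Hypothesis b0 : 0 < b.
Hypothesis KP : K <= P.
Hypothesis bP : b ^ B <= P.
Hypothesis sparse : b ^ B * (K * 2 ^ B.+1) ^ l.+1 < (b ^ tau) ^ l.+1.

Local Notation F := 'F_P.

Definition hash_poly (cs : seq nat) : {poly F} := Poly [seq n%:R%R | n <- cs].

Lemma natF_hash cs x : ((hash p cs x)%:R = (hash_poly cs).[x%:R] :> F)%R.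
Proof.
rewrite /hash_poly; elim: cs => [|c cs IH] /=; first by rewrite horner0.
by rewrite horner_cons (natF_mod P_prime) natrD natrM -IH; ring.
Qed.

Lemma hash_lt cs x : hash p cs x < P.
Proof. by case: cs => //= c cs; rewrite ltn_pmod. Qed.

Lemma hash_natF cs x : hash p cs x = ((hash_poly cs).[x%:R])%R :> nat.
Proof. by rewrite -natF_hash val_Fp_nat // modn_small // hash_lt. Qed.

Definition close (y : nat -> nat) : {set F} := [set v : F | tau <= matches b B y v]%SET.

Lemma card_close y : (forall e, y e < b) -> #|close y| * b ^ tau <= 2 ^ B.+1 * P.
Proof.
move=> hy; apply: leq_trans (few_matching b0 tau hy bP).
rewrite leq_mul2r -sum1_card count_iota; apply/orP; right.
rewrite big_mkcond (eq_bigr (fun v : F => (tau <= matches b B y v) : nat)) => [|v _]; last first.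
  by rewrite inE; case: (tau <= _).
rewrite -(big_mkord predT (fun v => (tau <= matches b B y v) : nat)).
by rewrite -(big_mkord predT (fun v => (tau <= matches b B y v) : nat)) Fp_cast.
Qed.

Local Notation coefs := (l.+1.-tuple F).

Lemma hash_poly_val (c : coefs) : hash_poly (map val c) = Poly c.
Proof.
rewrite /hash_poly -map_comp map_id_in // => v _ /=.
by rewrite natr_Zp.
Qed.

Lemma eval_inj (xs : {ffun 'I_l.+1 -> 'I_K}) : injective xs ->
  injective (fun c : coefs => [ffun i => (Poly c).[(xs i : nat)%:R] : F]%R).
Proof.
move=> xs_inj c c' /ffunP e; apply/val_inj/(@eq_from_nth _ 0%R); rewrite ?size_tuple // => i il.
suff d0 : (Poly c - Poly c' = 0 :> {poly F})%R.
  have := congr1 (fun D : {poly F} => D`_i)%R d0; rewrite coefB !coef_Poly coef0.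
  by move/eqP; rewrite subr_eq0 => /eqP.
apply/eqP/negPn/negP => nz.
have := @max_poly_roots _ _ [seq (xs i : nat)%:R : F | i <- enum 'I_l.+1]%R nz.
rewrite size_map size_enum_ord => lt.
have aR : all (root (Poly c - Poly c')) [seq (xs i : nat)%:R : F | i <- enum 'I_l.+1]%R.
  apply/allP => _ /mapP[j _ ->]; apply/eqP; rewrite hornerD hornerN.
  by have := e j; rewrite !ffunE => ->; rewrite subrr.
have uR : uniq [seq (xs i : nat)%:R : F | i <- enum 'I_l.+1]%R.
  rewrite map_inj_uniq ?enum_uniq // => j j' /(natF_inj P_prime) => h.
  by apply: xs_inj; apply: val_inj; apply: h; apply: leq_trans KP.
have := lt aR uR; rewrite ltnNge => /negP; apply; apply: leq_trans (size_polyD _ _) _.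
by rewrite size_polyN geq_max !(leq_trans (size_Poly _)) ?size_tuple.
Qed.

(** By [eval_inj] the values of a random polynomial with [l.+1] coefficients at [l.+1] distinct
    points are independent and uniform. [sparse] is the union bound over the [b ^ B] words and the
    [K ^ l.+1] choices of points, a single value being close with probability at most
    [2 ^ B.+1 / b ^ tau]. *)
Theorem exists_hash : exists cs : seq nat, [/\ size cs = l.+1, all (fun c => c < P) cs &
  forall y : nat -> nat,
    count (fun x => tau <= matches b B y (hash p cs x)) (iota 0 K) <= l].
Proof.
pose ev (c : coefs) (xs : {ffun 'I_l.+1 -> 'I_K}) : {ffun 'I_l.+1 -> F} :=
  [ffun i => (Poly c).[(xs i : nat)%:R]%R].
pose target (Y : {ffun 'I_B -> 'I_b}) (e : nat) : nat := if insub e is Some i then Y i else 0.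
have target_lt Y e : target Y e < b by rewrite /target; case: insubP => // i _ _; apply: ltn_ord.
pose bad (c : coefs) := [exists Y : {ffun 'I_B -> 'I_b}, [exists xs : {ffun 'I_l.+1 -> 'I_K},
  injectiveb xs && (ev c xs \in ffun_on (close (target Y)))]].
have badP : #|bad| < #|{: coefs}|.
  rewrite card_tuple card_Fp // -(ltn_pmul2r (m := (b ^ tau) ^ l.+1)) ?expn_gt0 ?b0 //.
  apply: (@leq_ltn_trans (b ^ B * (K ^ l.+1 * (2 ^ B.+1 * P) ^ l.+1))); last first.
    by rewrite -expnMn mulnA expnMn mulnA [ltnRHS]mulnC ltn_pmul2r ?expn_gt0.
  have one Y (xs : {ffun 'I_l.+1 -> 'I_K}) :
      (\sum_c (injectiveb xs && (ev c xs \in ffun_on (close (target Y))))) * (b ^ tau) ^ l.+1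
      <= (2 ^ B.+1 * P) ^ l.+1.
    case: (boolP (injectiveb xs)) => [/injectiveP xi|_] /=; last by rewrite big1.
    apply: (@leq_trans (#|ffun_on (close (target Y)) : pred {ffun 'I_l.+1 ->
      F}| * (b ^ tau) ^ l.+1)); last first.
      by rewrite card_ffun_on card_ord -expnMn leq_exp2r // card_close.
    rewrite leq_mul2r; apply/orP; right.
    rewrite -(card_imset (ffun_on (close (target Y)) : pred {ffun 'I_l.+1 -> F}) (@inj_id _)).
    apply: (@leq_trans #|[set c : coefs | ev c xs \in ffun_on (close (target Y))]%SET|).
      rewrite -[leqRHS]sum1_card [leqRHS]big_mkcond; apply: leq_sum => c _.
      by rewrite inE; case: (_ \in _).
    rewrite -(card_imset _ (eval_inj xi)); apply/subset_leq_card/fintype.subsetP.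
    move=> _ /imsetP[c + ->]; rewrite inE => h; apply/imsetP; by exists (ev c xs).
  apply: (@leq_trans (\sum_(Y : {ffun 'I_B -> 'I_b}) \sum_(xs : {ffun 'I_l.+1 -> 'I_K})
      (2 ^ B.+1 * P) ^ l.+1)); last first.
    by rewrite !sum_nat_const !card_ffun !card_ord.
  apply: (@leq_trans (\sum_(Y : {ffun 'I_B -> 'I_b}) \sum_(xs : {ffun 'I_l.+1 -> 'I_K})
    (\sum_c (injectiveb xs && (ev c xs \in ffun_on (close (target Y))))) * (b ^ tau) ^ l.+1));
      last first.
    by apply: leq_sum => Y _; apply: leq_sum => xs _; apply: one.
  under eq_bigr do rewrite -big_distrl; rewrite -big_distrl leq_mul2r; apply/orP; right.
  under eq_bigr do rewrite exchange_big; rewrite exchange_big -sum1_card big_mkcond.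
  apply: leq_sum => c _; case: ifP => // /existsP[Y /existsP[xs h]].
  by rewrite (bigD1 Y) //= (bigD1 xs) //= h.
have /existsP[c gc] : [exists c, ~~ bad c].
  apply: contraTT badP; rewrite negb_exists => /forallP h; rewrite -leqNgt.
  by apply/subset_leq_card/fintype.subsetP => c _; have := h c; rewrite negbK.
exists (map val c); split; first by rewrite size_map size_tuple.
  by apply/allP => _ /mapP[v _ ->]; have := ltn_ord v; rewrite [X in _ < X -> _]Fp_cast.
move=> y; rewrite leqNgt; apply/negP => many.
set good := fun x => tau <= matches b B y (hash p (map val c) x) in many.
pose xl := seq.filter good (iota 0 K).
have szx : l < size xl by rewrite size_filter.
have xlK i : i < size xl -> nth 0 xl i < K /\ good (nth 0 xl i).
  by move=> /(mem_nth 0); rewrite mem_filter mem_iota add0n => /andP[-> /andP[_ ->]].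
have il (i : 'I_l.+1) : i < size xl by apply: leq_trans szx; apply: ltn_ord.
pose xs : {ffun 'I_l.+1 -> 'I_K} := [ffun i : 'I_l.+1 => Ordinal (xlK i (il i)).1].
pose Y : {ffun 'I_B -> 'I_b} := [ffun e : 'I_B => insubd (Ordinal b0) (y e)].
case/negP: gc; apply/existsP; exists Y; apply/existsP; exists xs; apply/andP; split.
  apply/injectiveP => i j /(congr1 val); rewrite !ffunE /= => /eqP.
  by rewrite nth_uniq ?filter_uniq ?iota_uniq // => /eqP /val_inj.
apply/ffun_onP => i; rewrite ffunE inE -hash_poly_val -hash_natF ffunE /=.
apply: leq_trans (xlK i (il i)).2 _; rewrite /matches !count_iota.
apply: leq_sum => e _; case: eqP => //= ye; rewrite /target valK ffunE.
by rewrite val_insubd ye digit_lt // eqxx.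
Qed.

End InnerCode.

(** * Gaps between primes *)

Section PrimeGap.
Local Open Scope nat_scope.

Lemma central_bin_ge x : 2 ^ x <= 'C(x.*2, x).
Proof.
elim: x => // x IH; rewrite doubleS binS expnS mul2n -addnn.
have -> : 'C(x.*2.+1, x.+1) = 'C(x.*2.+1, x).
  by rewrite -[LHS]bin_sub; [congr ('C(_, _)); lia|lia].
have : 'C(x.*2, x) <= 'C(x.*2.+1, x) by apply: leq_bin2l.
by lia.
Qed.

(** In Legendre's formula each exponent k with p^k <= 2 x contributes at most 1, as rounding down 2
    y exceeds twice rounding down y by at most 1; larger k contribute nothing. *)
Lemma logn_central p x : prime p -> 0 < x -> p ^ logn p 'C(x.*2, x) <= x.*2.
Proof.
move=> pp x0; have x20 : 0 < x.*2 by rewrite double_gt0.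
have c0 : 0 < 'C(x.*2, x) by rewrite bin_gt0; lia.
have e : logn p 'C(x.*2, x) + (logn p x`! + logn p x`!) = logn p (x.*2)`!.
  have le : x <= x.*2 by rewrite -addnn leq_addr.
  have := bin_fact le; rewrite -{2}addnn addnK => <-.
  by rewrite !lognM ?muln_gt0 ?fact_gt0.
suff: logn p 'C(x.*2, x) <= trunc_log p x.*2.
  move=> h; apply: leq_trans (trunc_logP (prime_gt1 pp) x20).
  by rewrite leq_pexp2l // prime_gt0.
have logE n : n <= x.*2 -> logn p n`! = \sum_(1 <= k < x.*2.+1) n %/ p ^ k.
  move=> nx; rewrite logn_fact // [RHS](@big_cat_nat _ _ _ n.+1) //=.
  rewrite [X in _ = _ + X]big_nat_cond [X in _ = _ + X]big1 ?addn0 // => k /andP[/andP[nk _] _].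
  by rewrite divn_small // (leq_trans nk) // ltnW // ltn_expl // prime_gt1.
have {}e : logn p 'C(x.*2, x) + \sum_(1 <= k < x.*2.+1) (x %/ p ^ k + x %/ p ^ k) =
    \sum_(1 <= k < x.*2.+1) x.*2 %/ p ^ k.
  by rewrite big_split /= -!logE //; lia.
have bnd : \sum_(1 <= k < x.*2.+1) x.*2 %/ p ^ k <=
    \sum_(1 <= k < x.*2.+1) ((k <= trunc_log p x.*2) + (x %/ p ^ k + x %/ p ^ k)).
  apply: leq_sum => k _; case: (leqP k (trunc_log p x.*2)) => hk.
    rewrite -addnn; have := leq_divDl (p ^ k) x x; lia.
  by rewrite divn_small // (leq_trans (trunc_log_ltn _ (prime_gt1 pp))) // leq_pexp2l // prime_gt0.
have cnt : \sum_(1 <= k < x.*2.+1) (k <= trunc_log p x.*2) <= trunc_log p x.*2.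
  elim: (x.*2) (trunc_log p x.*2) => [|n IH] t; first by rewrite big_geq.
  rewrite big_nat_recr //=; case: (leqP n.+1 t) => h; last by rewrite addn0.
  apply: (@leq_trans (n + 1)); last by rewrite addn1.
  rewrite leq_add2r -[leqRHS]muln1 -[n in leqRHS](subn1 n.+1) -sum_nat_const_nat.
  by apply: leq_sum => k _; case: (k <= t).
by move: bnd; rewrite big_split /=; lia.
Qed.

(** If all prime divisors of the central binomial coefficient for x = 4 X^2 were at most X, it would
    be at most (2 x)^X, which is less than 2^x. The bound serves for the modulus of the inner code,
    which must exceed a number fixed before and stay polynomial in it. *)
Lemma prime_between X : 1 < X -> exists P, [/\ prime P, X < P & P <= 8 * X ^ 2].
Proof.
move=> X1; pose x := 4 * X ^ 2.
have x0 : 0 < x by rewrite muln_gt0 expn_gt0; lia.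
have c0 : 0 < 'C(x.*2, x) by rewrite bin_gt0; lia.
case: (boolP (has (fun p => X < p) (primes 'C(x.*2, x)))) => [/hasP[P + XP]|/hasPn h].
  rewrite mem_primes => /and3P[pp _ dv]; exists P; split=> //.
  have le : x <= x.*2 by rewrite -addnn leq_addr.
  have dvf : P %| (x.*2)`! by rewrite -(bin_fact le) dvdn_mulr.
  have : logn P (x.*2)`! != 0 by rewrite -lt0n logn_gt0 mem_primes pp fact_gt0.
  case: (leqP P x.*2) => [|Px]; first by rewrite /x; lia.
  rewrite logn_fact // big_nat_cond big1 ?eqxx // => k /andP[/andP[k1 _] _].
  by rewrite divn_small // (leq_trans Px) // -{1}[P]expn1 leq_pexp2l // prime_gt0.
exfalso; have sz : size (primes 'C(x.*2, x)) <= X.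
  rewrite -[leqRHS](size_iota 1); apply: uniq_leq_size; first exact: primes_uniq.
  move=> p hp; rewrite mem_iota add1n ltnS; have := h p hp; rewrite -leqNgt => ->.
  by move: hp; rewrite mem_primes => /and3P[/prime_gt0 -> _ _].
have : 'C(x.*2, x) <= x.*2 ^ X.
  apply: (@leq_trans (x.*2 ^ size (primes 'C(x.*2, x)))); last by rewrite leq_pexp2l // double_gt0.
  rewrite {1}(prod_prime_decomp c0) prime_decompE big_map /=.
  have : all prime (primes 'C(x.*2, x)) by apply/allP => p; rewrite mem_primes => /andP[].
  elim: (primes _) => [|p s IH] /=; first by rewrite big_nil.
  by case/andP=> pp /IH hs; rewrite big_cons expnS leq_mul // logn_central.
move/(leq_trans (central_bin_ge x)); rewrite leqNgt => /negP; apply.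
have e4 : x = 4 * X * X by rewrite /x -mulnn mulnA.
rewrite [X in _ < 2 ^ X]e4 expnM ltn_exp2r; last by lia.
have := ltn_expl X (isT : 1 < 2); rewrite [4 * X]mulnC expnM e4 -muln2.
set Y := 2 ^ X => hX; rewrite (expnD Y 2 2) -!mulnn.
have Y4 : 4 <= Y by rewrite /Y (@leq_exp2l 2 2 X).
have := ltn_mul hX hX; have : 4 * 4 <= Y * Y by apply: leq_mul.
by rewrite -!mulnA mulnCA; set B := Y * Y; set A := X * (X * 2); set A' := X * X; nia.
Qed.

End PrimeGap.

(** * Completeness of the decoder *)

Section CodeFamily.
Local Open Scope nat_scope.

Lemma exists_generator p : prime p.+1 ->
  exists2 c, c < p.+1 & forall a b, a < p -> b < p ->
    (c%:R ^+ a = c%:R ^+ b :> 'F_(p.+1))%R -> a = b.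
Proof.
move=> pr; have p0 : 0 < p by have := prime_gt1 pr.
have : has (p.-primitive_root)%R (enum (predC1 (0%R : 'F_(p.+1)))).
  apply: has_prim_root => //; rewrite ?enum_uniq //.
  - apply/allP => x; rewrite mem_enum => x0; rewrite unity_rootE; apply/eqP.
    apply: (mulfI x0); rewrite mulr1 -exprS.
    by have := expf_card x; rewrite card_Fp.
  - by rewrite -cardE cardC1 card_Fp.
case/hasP=> x _ prx; exists (x : nat).
  by have := ltn_ord x; rewrite [X in _ < X -> _]Fp_cast.
rewrite natr_Zp => a b ap bp /eqP; rewrite (eq_prim_root_expr prx).
by rewrite !modn_small // => /eqP.
Qed.

Lemma mem_tuples k n (u : seq nat) : size u = k -> all (fun x => x < n) u -> u \in tuples k n.
Proof.
elim: k u => [|k IH] [|x u] //= [su] /andP[xn un].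
apply/flattenP; exists [seq x :: t | t <- tuples k n]; last exact/map_f/IH.
by apply: map_f; rewrite mem_iota.
Qed.

Variable z : nat.
Hypothesis z_gt0 : 0 < z.

(** [z] is also the list size of the inner code. The choice of [d] leaves at most [m0 / (4 * z)] bad
    blocks, and [w * s] is twice [z * m'], so that unknowns outnumber equations. The factor 16 in
    [m'] makes the redundancy [m * m0 / z] at least [16 * d ^ 3 * m0], see [block_balance]. *)
Definition par_q0 := 2 ^ z.
Definition par_d := 8 * z ^ 3.
Definition par_s := 4 * z ^ 2.
Definition par_m' := 16 * z * par_d ^ 3.
Definition par_m := (par_m' + par_s).-1.
Definition par_w := 8 * par_d ^ 3.
Definition par_Q := par_q0 ^ par_d.

Local Notation q0 := par_q0.
Local Notation d := par_d.
Local Notation s := par_s.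
Local Notation m' := par_m'.
Local Notation m := par_m.
Local Notation w := par_w.

Variables p P k beta kappa : nat.
Local Notation q := p.+1.
Local Notation B := (d * beta).
Local Notation m0 := (2 ^ k).
Hypothesis q_prime : prime q.
Hypothesis P_prime : prime P.+1.
Hypothesis k_div : 4 * z %| m0.
Hypothesis q_large : m * m0 <= p.
Hypothesis kappa_ge : q ^ m <= q0 ^ kappa.
Hypothesis beta_ge : 8 * d ^ 2 * (k + 2 * d) <= beta.
Hypothesis P_ge1 : q ^ m <= P.+1.
Hypothesis P_ge2 : q0 ^ B <= P.+1.

(** The outer code has [m * m0] evaluation points, hence rate [1 - 1 / z]. *)
Definition degree_bound := m * (m0 - m0 %/ z).
(** [kappa] inner letters suffice to write an outer symbol; since [d = 8 * z ^ 3], the excess is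
    [3 / z] of the length [d * beta] of an inner word. *)
Definition threshold := kappa + 3 * (8 * z ^ 2 * beta).

Definition guess (c sd : nat) (cs : seq nat) (low : nat) : seq nat :=
  [:: p; c; P; k; m0; beta; sd; threshold; low; q ^ m; degree_bound; q ^ s] ++ cs.

Lemma q0_gt0 : 0 < q0.
Proof. by rewrite /par_q0 expn_gt0. Qed.

Lemma d_gt0 : 0 < d.
Proof. by rewrite /par_d muln_gt0 expn_gt0 z_gt0. Qed.

Lemma s_gt0 : 0 < s.
Proof. by rewrite /par_s muln_gt0 expn_gt0 z_gt0. Qed.

Lemma beta_gt0 : 0 < beta.
Proof.
apply: leq_trans beta_ge; move: (d) d_gt0 => D D0.
have : 0 < D ^ 2 by rewrite expn_gt0 D0.
by nia.
Qed.

(** In exponents of 2, once [q ^ m] is bounded by [q0 ^ kappa]: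
    [z * B + (z * kappa + B + 1) * (z + 1)] on the left against [(z * kappa + 3 * B) * (z + 1)] on
    the right. *)
Lemma sparse_inner : q0 ^ B * (q ^ m * 2 ^ B.+1) ^ z.+1 < (q0 ^ threshold) ^ z.+1.
Proof.
have b0 := beta_gt0; have d0 := d_gt0.
apply: (@leq_ltn_trans (q0 ^ B * (q0 ^ kappa * 2 ^ B.+1) ^ z.+1)).
  by rewrite leq_mul2l leq_exp2r // leq_mul2r kappa_ge !orbT.
rewrite /par_q0 -!expnM -expnD -expnM -expnD ltn_exp2l //.
have tE : z * threshold = z * kappa + 3 * B.
  by rewrite /threshold /par_d; ring.
have -> : z * (threshold * z.+1) = (z * kappa + 3 * B) * z.+1 by rewrite mulnA tE.
have : 0 < B by rewrite muln_gt0 d0.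
by move: B => C C0; nia.
Qed.

(** The balance of roots in units of [d ^ 3 * m0]: 16 units of redundancy pay 8 for the
    interpolants, 4 for the windows lost at the ends of blocks and 4 for the bad blocks. *)
Lemma block_balance x a e e' b : 16 * x <= a -> e <= e' + 4 * x -> b <= 4 * x -> a <= e ->
  8 * x + (e - a) <= e' - b.
Proof. by lia. Qed.

Section Guess.
Variables (c sd : nat) (cs : seq nat).
Hypothesis shift : good_shift k d beta sd.
Hypothesis hash_few : forall y : nat -> nat,
  count (fun x => threshold <= matches q0 B y (hash P cs x)) (iota 0 (q ^ m)) <= z.

Variables (f g : seq nat).

Local Notation u := (guess c sd cs).
Local Notation T := (fun r => nth 0 g r == letter q0 d m (u 0) f r).

Lemma neighborK e i : e < B -> i < m0 -> neighbor (u 0) e (neighbor (u 0) e i) = i.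
Proof.
move=> he hi; have [sb hs _] := shift.
apply: (@bits_inj k) => //; first exact: neighbor_lt.
rewrite !(@bits_neighbor k d beta (u 0) erefl erefl erefl sb) //.
by rewrite -xorfA xorff xorf0.
Qed.

(** By [neighborK] the edge followed backwards leads to [i] again, so the slot that the decoder
    reads is the one that the encoder filled from block [i]. *)
Lemma digit_letter e i : e < B -> i < m0 ->
  digit q0 (e %% d) (letter q0 d m (u 0) f (neighbor (u 0) e i * beta + e %/ d)) =
  inner q0 (u 0) (block m (u 0) f i) e.
Proof.
move=> he hi; have d0 := d_gt0; have b0 := beta_gt0.
have eb : e %/ d < beta by rewrite ltn_divLR // mulnC.
rewrite /letter -[g_beta _]/beta modnMDl divnMDl // (modn_small eb)
  [_ %/ d %/ beta]divn_small // addn0.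
pose y j := inner q0 (u 0) (block m (u 0) f (neighbor (u 0) (e %/ d * d + j) (neighbor (u 0) e i)))
   (e %/ d * d + j).
have ylt j : y j < q0 by apply: digit_lt; apply: q0_gt0.
rewrite (@horner_digits_mod q0 (q0 ^ d) y 0 d ylt erefl) ?ltn_pmod //.
by rewrite /y add0n -divn_eq neighborK.
Qed.

(** A block with at least [threshold] edges into [T] passes the test of [candidates], and [hash_few]
    ensures that the truncation spares it. The sampler bounds the number of other blocks. *)
Lemma enough_good_blocks low :
  (threshold%:R <= d%:R * (count T (iota 0 (m0 * beta)))%:R / 2 ^+ k - (d * beta)%:R / z%:R
    :> rat)%R ->
  0 < w * m0 + degree_bound <=
    count (good_block q0 d z m g (u low) f) (iota 0 m0) * m'.
Proof.
move=> hT; have d0 := d_gt0; have b0 := beta_gt0; have s0 := s_gt0.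
have := @neighbor_sampler k d beta (u 0) erefl erefl erefl shift T threshold z d0 b0 z_gt0 hT.
set bad := count _ _ => hbad.
have good_ge : m0 - bad <= count (good_block q0 d z m g (u low) f) (iota 0 m0).
  rewrite leq_subLR -[leqLHS](size_iota 0).
  rewrite -(count_predC (fun i => degree d beta (u 0) T i < threshold)) leq_add2l !count_iota.
  apply: leq_sum => i _ /=; case: ltnP => // deg_i; rewrite lt0b.
  have hi := ltn_ord i.
  have [lt _] := @block_digits m (u 0) erefl f i.
  pose Y e := digit q0 (e %% d) (nth 0 g (neighbor (u 0) e i * beta + e %/ d)).
  rewrite /good_block /candidates take_oversize; last first.
    rewrite size_filter; apply: leq_trans (hash_few Y); rewrite leq_eqVlt; apply/orP; left;
      apply/eqP.
    apply: eq_count => x; rewrite /= /matches /agreement size_filter.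
    by congr (_ <= _); apply: eq_count => e; rewrite /inner /g_hash /= drop0.
  rewrite mem_filter mem_iota; apply/andP; split; last exact: lt.
  apply: leq_trans deg_i _.
  rewrite /agreement size_filter /degree !count_iota; apply: leq_sum => e _.
  by case: eqP => //= ge; rewrite [X in digit _ _ X]ge digit_letter // eqxx.
have bad_small : 4 * z * bad <= m0.
  have : (2 * z ^ 2) * (4 * z * bad) <= (2 * z ^ 2) * m0.
    apply: leq_trans hbad; rewrite leq_eqVlt; apply/orP; left; apply/eqP.
    by rewrite /par_d; ring.
  by rewrite leq_mul2l muln_eq0 expn_eq0 (gtn_eqF z_gt0).
have D0 : 0 < d ^ 3 by rewrite expn_gt0 d0.
have m00 : 0 < m0 by rewrite expn_gt0.
have W0 : 0 < w * m0.
  have wgt : 0 < w by apply: leq_trans D0 _; apply: leq_pmull.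
  by apply: leq_trans wgt _; apply: leq_pmulr.
apply/andP; split; first by rewrite addn_gt0 W0.
apply: leq_trans (leq_mul good_ge (leqnn m')).
rewrite mulnBl /degree_bound mulnBr.
have [h hE] := dvdnP k_div.
have -> : m0 %/ z = 4 * h by rewrite hE [4 * z]mulnC mulnA [h * z * 4]mulnAC mulnK // mulnC.
have bm : bad * m' <= 4 * d ^ 3 * m0.
  by rewrite /par_m'; apply: leq_trans (leq_mul (leqnn (4 * d ^ 3)) bad_small);
    rewrite leq_eqVlt; apply/orP; left; apply/eqP; ring.
set bm' := bad * m' in bm *; set D := d ^ 3 in bm *.
have mm : m' <= m <= m' + s.
  by rewrite /par_m; move: s0; move: (s) (m') => a b; lia.
have sD : s <= 4 * D.
  rewrite /par_s /D /par_d; apply: leq_mul => //; rewrite expnMn -expnM.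
  apply: leq_trans (_ : z ^ (3 * 3) <= _); last by rewrite leq_pmull.
  by rewrite leq_pexp2l.
have mE : m' = 16 * z * D by [].
have e1 : 16 * D * m0 <= m * (4 * h).
  by apply: leq_trans (leq_mul (proj1 (andP mm)) (leqnn _)); rewrite mE hE leq_eqVlt; apply/orP;
    left; apply/eqP; ring.
have e2 : m * m0 <= m' * m0 + 4 * D * m0.
  rewrite -mulnDl leq_mul2r; apply/orP; right; apply: leq_trans (proj2 (andP mm)) _.
  by rewrite leq_add2l.
have wE : w * m0 = 8 * D * m0 by [].
have cE : m0 * m' = m' * m0 by rewrite mulnC.
have h4 : m * (4 * h) <= m * m0.
  by apply: leq_mul => //; rewrite hE mulnC; apply: leq_mul => //; apply: leq_pmulr.
rewrite wE cE; move: (@block_balance (D * m0) (m * (4 * h)) (m * m0) (m' * m0) bm').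
by rewrite !(mulnA _ D m0); apply.
Qed.

End Guess.

Lemma size_recover (g u : seq nat) : 0 < g_cap u -> size (recover q0 d z m m' s w g u) <= g_cap u.
Proof.
move=> cap0; rewrite /recover; set K := kernel _ _ _ _ _ _ _ _ _.
have : size [:: [::] : seq nat] <= g_cap u by [].
elim: (iota _ _) [:: [::]] => //= i t IH L hL; apply: IH.
by rewrite /extend size_take; case: ltnP.
Qed.

(** [u] defines the code and so precedes the received word. The entry [low] depends on [g], but
    encoding is independent of it, hence the decoder may use a list that differs from [u] there. The
    hypothesis bounds every entry by its largest possible value, such as [2 ^ (B + k)] for the
    seed. *)
Theorem decode_complete e :
  let n := m0 * beta in
  all (fun x => x < n ^ e)
    [:: p; P; k; m0; beta; 2 ^ (B + k); threshold; w * m0; q ^ m; degree_bound; q ^ s] ->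
  exists u : seq nat, forall g : seq nat, size g = n ->
  exists2 L : seq (seq nat), size L <= q ^ s &
  forall f, size f = degree_bound -> all (fun y => y < q) f ->
    (threshold%:R <= d%:R * (count (fun r => nth 0 g r == nth 0 (word q0 d m n u f) r) (iota 0
      n))%:R
        / 2 ^+ k - (d * beta)%:R / z%:R :> rat)%R ->
    f \in L /\ word q0 d m n u f \in decode q0 d z m m' s w (z + 13) e g.
Proof.
set n := m0 * beta => /=; case/and5P=> pX PX kX m0X /and5P[betaX sdX thX wX] /and4P[KX degX capX _].
have d0 := d_gt0; have s0 := s_gt0.
have [c c_lt c_inj] := exists_generator q_prime.
have [sd sd_lt shift] := exists_good_shift d0 beta_ge.
have [cs [size_cs cs_lt hash_few]] := exists_hash P_prime q0_gt0 P_ge1 P_ge2 sparse_inner.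
have m00 : 0 < m0 by rewrite expn_gt0.
exists (guess c sd cs 0) => g size_g.
set low := low_index s w (guess c sd cs 0) (kernel q0 d z m m' s w g (guess c sd cs 0)).
exists (recover q0 d z m m' s w g (guess c sd cs low)).
  by apply: size_recover; rewrite /= expn_gt0.
move=> f size_f f_lt agree.
have f_rec : f \in recover q0 d z m m' s w g (guess c sd cs low).
  have deg_le : degree_bound <= m * m0 by rewrite leq_mul2l leq_subr orbT.
  apply: recover_complete => //.
  - by move=> a b ha hb; apply: c_inj; apply: leq_trans q_large.
  - have -> : m0 * (z * m') = w * m0 * (2 * z ^ 2).
      by rewrite /par_m' /par_w; ring.
    rewrite ltn_pmul2l; last by rewrite muln_gt0 m00 andbT /par_w muln_gt0 expn_gt0 d0.
    by rewrite /par_s ltn_pmul2r // expn_gt0 z_gt0.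
  - by rewrite leq_pexp2l ?leq_pred.
  - move: agree; rewrite (@eq_in_count _ _ (fun r => nth 0 g r == letter q0 d m (guess c sd cs 0)
    f r)).
      by move=> agree; apply: enough_good_blocks agree.
    by move=> r; rewrite mem_iota add0n => /andP[_ hr]; rewrite (nth_map 0) ?size_iota // nth_iota.
split=> //; apply/flattenP; exists [seq word q0 d m (size g) (guess c sd cs low) f | f <- recover
  q0 d z m m' s w g (guess c sd cs low)].
  (* Twelve fixed entries and the [z.+1] coefficients of the hash. *)
  apply: map_f; apply: mem_tuples; first by rewrite /= size_cs; lia.
  rewrite all_cat size_g /= pX PX kX m0X betaX thX KX degX capX !andbT.
  have -> : c < n ^ e by apply: leq_trans pX; apply: leq_trans c_lt _.
  have -> : sd < n ^ e by apply: ltn_trans sd_lt sdX.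
  have -> : low < n ^ e.
    by apply: leq_ltn_trans wX; rewrite -[leqRHS](size_iota 0); exact: find_size.
  by apply: sub_all cs_lt => y hy; apply: leq_ltn_trans PX.
by apply/mapP; exists f; rewrite ?size_g.
Qed.
End CodeFamily.

(** * Choice of the parameters *)

Section ParameterChoice.
Local Open Scope nat_scope.

(** The prime is taken first and [k] is the logarithm of [p %/ m]. This puts the field size within a
    factor 2 of the number of evaluation points, however the primes are distributed. *)
Lemma field_size m K : 0 < m -> exists p k,
  [/\ prime p.+1, K <= k, m * 2 ^ k <= p & p < m * 2 ^ k.+1].
Proof.
move=> m0; have [[//|p] hp pr] := prime_above (m * 2 ^ K).
have d0 : 0 < p %/ m.
  by rewrite divn_gt0 //; rewrite -ltnS; apply: leq_ltn_trans hp; rewrite leq_pmulr // expn_gt0.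
have := trunc_log_bounds (isT : 1 < 2) d0; set k := trunc_log 2 _ => /andP[h1 h2].
exists p, k; split=> //.
- rewrite -ltnS -(ltn_exp2l _ _ (isT : 1 < 2)); apply: leq_ltn_trans h2.
  by rewrite leq_divRL // mulnC -ltnS.
- by rewrite mulnC -leq_divRL.
- by rewrite mulnC -ltn_divLR.
Qed.

(** [beta] is [b] times the integer part [t] of [kappa / ((rho + 2 / z) * d * b)]. Rounding raises
    the ratio of [kappa] to [d * beta] by at most a fraction [1 / t] of [rho + 2 / z], and [t] is at
    least [z]. The factor [b] will be the denominator of a rational rho. *)
Lemma multiple_between (R : realType) (rho : R) (z d b kappa : nat) :
  0 < z -> 0 < d -> 0 < b -> (0 < rho)%R -> (rho + 2 / z%:R <= 1)%R -> d * b * z <= kappa ->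
  exists beta, [/\ b %| beta, 0 < beta, ((rho + 2 / z%:R) * (d * beta)%:R <= kappa%:R)%R
    & (kappa%:R <= (rho + 6 / z%:R) * (d * beta)%:R)%R].
Proof.
move=> z0 d0 b0 rho0 rho1 hk; set a := (rho + 2 / z%:R)%R.
have zR : (0 < z%:R :> R)%R by rewrite ltr0n.
have a0 : (0 < a)%R by rewrite /a addr_gt0 // divr_gt0.
have dbR : (0 < (d * b)%:R :> R)%R by rewrite ltr0n muln_gt0 d0.
pose c := (a * (d * b)%:R)%R; have c0 : (0 < c)%R by rewrite mulr_gt0.
have x0 : (0 <= kappa%:R / c)%R by rewrite divr_ge0 // ltW.
have := truncn_itv x0; set t := Num.truncn _ => /andP[t1 t2].
have zt : z <= t.
  rewrite -ltnS -(ltr_nat R); apply: le_lt_trans t2; rewrite ler_pdivlMr //.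
  apply: (@le_trans _ _ (d * b * z)%:R%R); last by rewrite ler_nat.
  by rewrite natrM mulrC /c ler_wpM2r // ler_piMl // ltW.
exists (b * t); split.
- exact: dvdn_mulr.
- by rewrite muln_gt0 b0 (leq_trans z0 zt).
- by rewrite mulnA natrM mulrA -/c mulrC -ler_pdivlMr.
- move: t2; rewrite ltr_pdivrMr // => /ltW/le_trans; apply.
  have key : (a <= 4 / z%:R * t%:R)%R.
    apply: le_trans rho1 _; rewrite mulrAC ler_pdivlMr // mul1r.
    have : (z%:R <= t%:R :> R)%R by rewrite ler_nat.
    by move: zR; lra.
  rewrite mulnA (natrM _ (d * b)) -subr_ge0.
  have -> : ((rho + 6 / z%:R) * ((d * b)%:R * t%:R) - t.+1%:R * c =
      (d * b)%:R * (4 / z%:R * t%:R - a))%R.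
    by rewrite /c /a -natr1; field; rewrite gt_eqF.
  by rewrite mulr_ge0 ?subr_ge0 // ltW.
Qed.

Lemma par_m_ge z : 0 < z -> 16 * z * par_d z ^ 3 <= par_m z.
Proof.
move=> z0; have := s_gt0 z0; rewrite /par_m -/(par_m' z).
by move: (par_m' z) (par_s z) => a b; lia.
Qed.

(** With E = (m + 1) z the hash modulus needs exponent [2 * E + 3]; the summand [s] covers
    [q ^ s]. *)
Definition decoding_exponent (z : nat) : nat := 2 * ((par_m z).+1 * z) + par_s z + 5.

(** The exponent depends on [z] alone because [q <= n]: then [q ^ m <= n ^ m], minimality of [kappa]
    costs one more factor [q0 <= n], and [d * beta <= z * kappa] bounds the number of inner words by
    [n ^ ((m + 1) * z)]. *)
Lemma parameter_bounds z p P k beta kappa : 0 < z -> par_m z <= k -> p < par_m z * 2 ^ k.+1 ->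
  par_q0 z ^ kappa.-1 <= p.+1 ^ par_m z -> 8 * par_d z ^ 2 * (k + 2 * par_d z) <= beta ->
  par_d z * beta <= z * kappa -> threshold z beta kappa <= par_d z * beta ->
  P <= 8 * maxn (p.+1 ^ par_m z) (par_q0 z ^ (par_d z * beta)) ^ 2 ->
  all (fun x => x < (2 ^ k * beta) ^ decoding_exponent z)
    [:: p; P; k; 2 ^ k; beta; 2 ^ (par_d z * beta + k); threshold z beta kappa;
      par_w z * 2 ^ k; p.+1 ^ par_m z; degree_bound z k; p.+1 ^ par_s z].
Proof.
move=> z0 mk plt kap hbeta hB hth hP; set n := 2 ^ k * beta; set m := par_m z in mk plt kap hP *.
have d0 := d_gt0 z0; have mge := par_m_ge z0; rewrite -/m in mge.
move: d0 mge hbeta hB hth hP; rewrite [par_w z]/(8 * par_d z ^ 3);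
  set d := par_d z => d0 mge hbeta hB hth hP.
have d3 : d <= d ^ 3 by rewrite -{1}(expn1 d) leq_pexp2l.
have [zm dm] : z <= m /\ d <= m.
  by split; apply: leq_trans mge; move: d3 d0 z0; move: (d ^ 3) => D *; nia.
have d2 : 0 < d ^ 2 by rewrite expn_gt0 d0.
have kbeta : 8 * k <= beta by apply: leq_trans hbeta; move: d2; move: (d ^ 2) => D *; nia.
have wbeta : 8 * d ^ 3 <= beta.
  by apply: leq_trans hbeta; rewrite (expnS d 2); move: d2; move: (d ^ 2) => D *; nia.
have k2 : k < 2 ^ k by apply: ltn_expl.
have beta0 : 0 < beta by apply: leq_trans wbeta; rewrite muln_gt0 expn_gt0 d0.
have m0n : 2 ^ k <= n by apply: leq_pmulr.
have bn : beta <= n by apply: leq_pmull; rewrite expn_gt0.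
have m1 : 0 < m by apply: leq_trans zm.
have n2 : 1 < n by apply: leq_trans m0n; apply: leq_ltn_trans k2; apply: leq_trans mk.
have qn : p.+1 <= n.
  apply: leq_trans plt _; rewrite expnS mulnCA mulnA mulnC leq_mul2l; apply/orP; right.
  by apply: leq_trans kbeta; move: mk; lia.
have q0n : par_q0 z <= n.
  by apply: leq_trans m0n; rewrite leq_pexp2l // (leq_trans zm).
have qmn : p.+1 ^ m <= n ^ m by rewrite leq_exp2r.
pose E := m.+1 * z.
have q0B : par_q0 z ^ (d * beta) <= n ^ E.
  have powM b : 0 < b -> b ^ (d * beta) <= (b ^ kappa) ^ z.
    by move=> b0; rewrite -expnM leq_pexp2l // [kappa * z]mulnC.
  rewrite [n ^ E]expnM; apply: leq_trans (powM _ (q0_gt0 z)) _.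
  rewrite leq_exp2r //; case: (kappa) kap => [|kk] /= kap; first by rewrite expn0 expn_gt0 ltnW.
  by rewrite !expnS; apply: leq_mul => //; apply: leq_trans qmn.
have nE a b : a <= b -> n ^ a <= n ^ b by move=> ab; rewrite leq_pexp2l // ltnW.
have qmE : p.+1 ^ m <= n ^ E.
  by apply: leq_trans qmn _; apply: nE; apply: leq_trans (leqnSn m) _; apply: leq_pmulr.
pose e' := 2 * E + par_s z + 4.
have eE : decoding_exponent z = e'.+1 by rewrite /decoding_exponent /e' /E addnS.
have lt x : x <= n ^ e' -> x < n ^ decoding_exponent z.
  by move=> /leq_ltn_trans; apply; rewrite eE ltn_exp2l.
have lt1 x : x <= n -> x < n ^ decoding_exponent z.
  by move=> xn; apply: lt; apply: leq_trans xn _; rewrite -{1}(expn1 n); apply: nE;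
    rewrite /e' addnS.
rewrite /= !andbT; apply/and5P; split; last apply/and5P; last (split; last apply/and3P; last split).
- exact/lt1/ltnW.
- apply: lt; apply: leq_trans hP _.
  apply: (@leq_trans (n ^ 3 * (n ^ E) ^ 2)).
    apply: leq_mul; first by rewrite (leq_exp2r 2 n (isT : 0 < 3)).
    by rewrite leq_exp2r // geq_max qmE.
  by rewrite -expnM -expnD; apply: nE; rewrite /e'; lia.
- by apply: lt1; apply: leq_trans m0n; apply: ltnW.
- exact: lt1.
- exact: lt1.
- apply: lt; rewrite expnD; apply: (@leq_trans (n ^ E * n ^ 1)).
    apply: leq_mul; last by rewrite expn1.
    have pow2 b : 1 < b -> 2 ^ (d * beta) <= b ^ (d * beta) by move=> b1;
      rewrite leq_exp2r // muln_gt0 d0.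
    apply: leq_trans (pow2 _ _) q0B.
    exact: (@leq_pexp2l 2 1 z).
  by rewrite -expnD; apply: nE; rewrite /e'; lia.
- apply: lt1; apply: leq_trans hth _; rewrite /n leq_mul2r; apply/orP; right.
  by apply: leq_trans dm _; apply: leq_trans mk (ltnW k2).
- by apply: lt1; rewrite /n mulnC leq_mul2l wbeta orbT.
- by apply: lt; apply: leq_trans qmE _; apply: nE; rewrite /e'; lia.
- apply: lt1; apply: (@leq_trans (m * 2 ^ k)); first by rewrite leq_mul2l leq_subr orbT.
  by rewrite /n mulnC leq_mul2l; apply/orP; right; apply: leq_trans kbeta; move: mk; lia.
- apply: lt; apply: (@leq_trans (n ^ par_s z)); first by rewrite leq_exp2r // s_gt0.
  by apply: nE; rewrite /e'; lia.
Qed.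

End ParameterChoice.

Section Existence.
Local Open Scope ring_scope.
Variable R : realType.

(** Logarithms to base [q0], with c = 1 / z, B = d beta and M = 2 ^ k: the right side is a lower
    bound for the messages, [rho * B * M] is the code, [kap] bounds the list size and 1 absorbs a
    factor 2. The surplus [2 * c] of [kap / B] over [rho] pays for the outer rate [1 - c]. *)
Lemma rate_margin (rho c B M kap : R) : 0 < rho < 1 -> 0 < c -> 4 * c <= 1 -> 4 <= c * B ->
  8 <= c * M -> (rho + 2 * c) * B <= kap -> kap <= B ->
  kap + rho * B * M + 1 <= (kap - 1) * (M * (1 - c)).
Proof.
move=> /andP[rho0 rho1] c0 c4 cB cM hk kB.
have M0 : 0 < M by rewrite -(pmulr_rgt0 M c0); lra.
have B0 : 0 < B by rewrite -(pmulr_rgt0 B c0); lra.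
have B1 : 4 <= B by nra.
have s1 : rho * B + c * B / 4 <= (kap - 1) * (1 - c).
  have e1 : (rho + 2 * c) * B * (1 - c) <= kap * (1 - c) by rewrite ler_wpM2r //; lra.
  have e2 : 0 <= (c * B) * ((1 - rho) + (1 / 2 - 2 * c)).
    by rewrite mulr_ge0 //; lra.
  by nra.
have s2 : (rho * B + c * B / 4) * M <= (kap - 1) * (1 - c) * M by rewrite ler_wpM2r // ltW.
have s3 : 2 * B <= c * B / 4 * M.
  have : 0 <= B * (c * M - 8) by rewrite mulr_ge0 //; lra.
  by nra.
by nra.
Qed.

Lemma powR2_nat (n : nat) : (2 ^ n)%:R = 2 `^ n%:R :> R.
Proof. by rewrite powR_mulrn // natrX. Qed.

(** The order of choice is forced: the field and [k], then [kappa] from the field size, [beta] from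
    [kappa] and rho, and the modulus [P] last. [kappa] grows linearly with [k], which makes [beta]
    large enough for [good_seed]. *)
Lemma exists_parameters (z' b n0 : nat) (rho : R) :
  let z := (2 ^ z')%N in (3 < z)%N -> (0 < b)%N -> 0 < rho -> rho + 10 / z%:R <= 1 ->
  exists p P k beta kappa : nat,
  let q := p.+1 in let n := (2 ^ k * beta)%N in
  [/\ [/\ prime q, prime P.+1, (4 * z %| 2 ^ k)%N, (par_m z * 2 ^ k <= p)%N
        & (q ^ par_m z <= par_q0 z ^ kappa)%N],
      [/\ (8 * par_d z ^ 2 * (k + 2 * par_d z) <= beta)%N, (q ^ par_m z <= P.+1)%N
        & (par_q0 z ^ (par_d z * beta) <= P.+1)%N],
      all (fun x => x < n ^ decoding_exponent z)%N
        [:: p; P; k; 2 ^ k; beta; 2 ^ (par_d z * beta + k); threshold z beta kappa;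
          par_w z * 2 ^ k; q ^ par_m z; degree_bound z k; q ^ par_s z]%N,
      [/\ (b %| n)%N, (n0 <= n)%N &
        (threshold z beta kappa)%:R <= (rho + 9 / z%:R) * (par_d z * beta)%:R] &
      (q ^ par_s z)%:R * ((par_Q z)%:R `^ (rho * n%:R) + 1) <= (q ^ degree_bound z k)%:R].
Proof.
move=> z z4 b0 rho0 rho1; have z0 : (0 < z)%N by apply: leq_trans z4.
have zR : 4 <= z%:R :> R by rewrite (ler_nat R 4).
set d := par_d z; set m := par_m z; have d0 : (0 < d)%N := d_gt0 z0.
have mge : (16 * z * d ^ 3 <= m)%N := par_m_ge z0.
have D0 : (d <= d ^ 3)%N by rewrite -{1}(expn1 d) leq_pexp2l.
have zm : (z <= m)%N by apply: leq_trans mge; move: D0 d0 z0; move: (d ^ 3)%N => D *; nia.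
have m0 : (0 < m)%N by apply: leq_trans zm.
(* Each summand serves one later inequality that needs [k] to be large. *)
have [p [k [q_prime kK q_large q_small]]] := field_size (m + d * b * z + n0 + 2 * d + z' + 3) m0.
have q1 : (1 < p.+1 ^ m)%N.
  by rewrite -(exp1n m) ltn_exp2r // ltnS; apply: leq_trans q_large; rewrite muln_gt0 m0 expn_gt0.
have q01 : (1 < par_q0 z)%N by rewrite /par_q0 -[1%N](expn0 2) ltn_exp2l.
have := up_log_bounds q01 q1; set kappa := up_log _ _ => /andP[kap1 kap2].
have kz : (m * k <= z * kappa)%N.
  rewrite -(leq_exp2l _ _ (isT : 1 < 2)%N) !expnM; apply: leq_trans kap2.
  rewrite -expnM mulnC expnM leq_exp2r //; apply: leqW; apply: leq_trans q_large.
  exact: leq_pmull.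
have k_kappa : (k <= kappa)%N.
  by rewrite -(leq_pmul2l z0); apply: leq_trans kz; rewrite leq_mul2r zm orbT.
have rho_le : rho + 2 / z%:R <= 1.
  by apply: le_trans rho1; rewrite lerD2l ler_pM2r ?invr_gt0; lra.
have dbz : (d * b * z <= kappa)%N by apply: leq_trans k_kappa; apply: leq_trans kK; clear; lia.
have [beta [b_beta beta0 low high]] := multiple_between z0 d0 b0 rho0 rho_le dbz.
set B := (d * beta)%N in low high.
have BR0 : 0 < B%:R :> R by rewrite ltr0n muln_gt0 d0.
have kapB : (kappa <= B)%N.
  rewrite -(ler_nat R); apply: le_trans high _; rewrite ler_piMl ?ler0n //.
  by apply: le_trans rho1; rewrite lerD2l ler_pM2r ?invr_gt0; lra.
have beta_ge : (8 * d ^ 2 * (k + 2 * d) <= beta)%N.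
  rewrite -(leq_pmul2l d0); apply: leq_trans kapB; rewrite -(leq_pmul2l z0); apply: leq_trans kz.
  apply: leq_trans (leq_mul mge (leqnn k)).
  have -> : (z * (d * (8 * d ^ 2 * (k + 2 * d))) = 8 * z * d ^ 3 * (k + 2 * d))%N by ring.
  have -> : (16 * z * d ^ 3 * k = 8 * z * d ^ 3 * (2 * k))%N by ring.
  rewrite leq_mul2l; apply/orP; right; rewrite [(2 * k)%N]mul2n -addnn leq_add2l.
  by apply: leq_trans kK; clear; lia.
pose X := maxn (p.+1 ^ m) (par_q0 z ^ B).
have X1 : (1 < X)%N by apply: leq_trans q1 (leq_maxl _ _).
have [P' [P_prime XP PX]] := prime_between X1.
have z_div : (4 * z %| 2 ^ k)%N.
  by rewrite -[4%N]/(2 ^ 2)%N -expnD dvdn_exp2l //; apply: leq_trans kK; clear; lia.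
case: P' P_prime XP PX => [|P] // P_prime XP PX.
have lowz : 2 * B%:R <= z%:R * kappa%:R :> R.
  have e : (rho + 2 / z%:R) * B%:R * z%:R = rho * (B%:R * z%:R) + 2 * B%:R by field; lra.
  have : (rho + 2 / z%:R) * B%:R * z%:R <= kappa%:R * z%:R by rewrite ler_wpM2r.
  have : 0 < rho * (B%:R * z%:R) by rewrite !mulr_gt0 // (lt_le_trans _ zR).
  by rewrite [z%:R * _]mulrC; lra.
have thE : (threshold z beta kappa)%:R = kappa%:R + 3 / z%:R * B%:R :> R.
  rewrite /threshold natrD; congr (_ + _).
  have -> : B = (z * (8 * z ^ 2 * beta))%N by rewrite /B /d /par_d; ring.
  by rewrite (natrM _ z) (natrM _ 3); field; lra.
have th_le : (threshold z beta kappa)%:R <= (rho + 9 / z%:R) * B%:R.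
  rewrite thE; have -> : (rho + 9 / z%:R) * B%:R = (rho + 6 / z%:R) * B%:R + 3 / z%:R * B%:R.
    by field; lra.
  by rewrite lerD2r.
exists p, P, k, beta, kappa; split; last 2 first.
- split=> //; first by rewrite dvdn_mull.
  by apply: leq_trans (leq_pmulr _ beta0); apply: leq_trans (ltnW (ltn_expl _ _));
    rewrite // (leq_trans _ kK) //; clear; lia.
- have [h hE] := dvdnP z_div.
  have MzE : (2 ^ k %/ z = 4 * h)%N by rewrite hE [(4 * z)%N]mulnC mulnA [(h * z * 4)%N]mulnAC
    mulnK // mulnC.
  have h0 : (0 < h)%N by move: hE; case: (h) => // hE; have := expn_gt0 2 k; rewrite hE.
  have hM : (4 * h < 2 ^ k)%N.
    by rewrite hE mulnC ltn_pmul2l // -[X in (X < _)%N]muln1 ltn_pmul2l // (leq_trans _ z4).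
  have kap0 : (0 < kappa)%N.
    by apply: leq_trans k_kappa; apply: leq_trans kK; rewrite addn3.
  apply: (@le_trans _ _ (par_q0 z ^ (kappa.-1 * (2 ^ k - 4 * h)))%:R); last first.
    rewrite ler_nat /degree_bound MzE !expnM leq_exp2r ?subn_gt0 //; exact: ltnW.
  have hs : (p.+1 ^ par_s z <= par_q0 z ^ kappa)%N.
    apply: leq_trans kap2; rewrite leq_pexp2l // /m /par_m.
    have D3 : (0 < d ^ 3)%N by apply: leq_trans D0.
    have : (0 < par_m' z)%N.
      exact: (leq_trans (leq_trans z0 (leq_pmull z (isT : 0 < 16)%N)) (leq_pmulr _ D3)).
    by move: (par_m' z) (par_s z); clear; lia.
  have QE : (par_Q z)%:R `^ (rho * (2 ^ k * beta)%:R) = 2 `^ (z%:R * (rho * B%:R * (2 ^ k)%:R))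
    :> R.
    rewrite /par_Q /par_q0 -expnM powR2_nat -powRrM /B !natrM; congr (_ `^ _); ring.
  have x0 : 0 <= z%:R * (rho * B%:R * (2 ^ k)%:R) by rewrite !mulr_ge0 // ltW.
  rewrite QE /par_q0 -expnM [leRHS]powR2_nat.
  apply: (@le_trans _ _ (2 `^ (z%:R * kappa%:R) * (2 * 2 `^ (z%:R * (rho * B%:R * (2 ^ k)%:R))))).
    apply: ler_pM; rewrite ?addr_ge0 ?powR_ge0 //.
      by rewrite -natrM -powR2_nat ler_nat expnM.
    have : 1 <= 2 `^ (z%:R * (rho * B%:R * (2 ^ k)%:R)) :> R.
      by rewrite -[leLHS](powRr0 2) ler_powR // ler1n.
    by move: (2 `^ _) => y; lra.
  rewrite -[X in X * 2 `^ _](powRr1 (a := 2)) // -!powRD ?pnatr_eq0 ?implybT // ler_powR ?ler1n //.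
  rewrite natrM natrM natrB ?(ltnW hM) // -subn1 natrB //.
  have ME : (2 ^ k)%:R = h%:R * (4 * z%:R) :> R by rewrite hE !natrM.
  have hE' : (2 ^ k)%:R - (4 * h)%:R = (2 ^ k)%:R * (1 - z%:R^-1) :> R.
    by rewrite ME (natrM _ 4); field; lra.
  have M8 : 8 <= z%:R^-1 * (2 ^ k)%:R :> R.
    rewrite mulrC ler_pdivlMr ?(lt_le_trans _ zR) //.
    rewrite -(natrM _ 8) ler_nat -[8%N]/(2 ^ 3)%N -expnD leq_pexp2l //.
    by apply: leq_trans kK; clear; lia.
  have B4 : 4 <= z%:R^-1 * B%:R :> R.
    rewrite mulrC ler_pdivlMr ?(lt_le_trans _ zR) // -(natrM _ 4) ler_nat.
    apply: (@leq_trans (8 * z ^ 3 * 1)); last by apply: leq_mul.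
    by rewrite muln1 leq_mul // -{1}(expn1 z) leq_pexp2l.
  have := @rate_margin rho z%:R^-1 B%:R (2 ^ k)%:R kappa%:R.
  rewrite hE' => /(_ _ _ _ B4 M8) mar.
  have {mar} : kappa%:R + rho * B%:R * (2 ^ k)%:R + 1 <= (kappa%:R - 1) * ((2 ^ k)%:R * (1 -
    z%:R^-1)) :> R.
    apply: mar => //.
    - by rewrite rho0 (lt_le_trans _ rho1) // ltrDl divr_gt0 // (lt_le_trans _ zR).
    - by rewrite invr_gt0 (lt_le_trans _ zR).
    - by rewrite ler_pdivrMr ?mul1r // (lt_le_trans _ zR).
    - by rewrite ler_nat.
  move/(ler_wpM2l (_ : 0 <= z%:R :> R)) => /(_ (ler0n _ _)).
  apply: le_trans; rewrite 2!mulrDr mulr1; lra.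
- by split.
- split=> //; first by apply: leq_trans (ltnW XP); apply: leq_maxl.
  by apply: leq_trans (ltnW XP); apply: leq_maxr.
- apply: parameter_bounds => //.
  + by apply: leq_trans kK; rewrite -/m; clear; lia.
  + exact: ltnW.
  + have : (2 * B <= z * kappa)%N by rewrite -(ler_nat R) (natrM _ 2) (natrM _ z).
    exact: (leq_trans (leq_pmull B (isT : 0 < 2)%N)).
  + rewrite -(ler_nat R); apply: le_trans th_le _; rewrite ler_piMl ?ler0n //.
    by apply: le_trans rho1; rewrite lerD2l ler_pM2r ?invr_gt0; lra.
  + exact: leq_trans (leqnSn _) PX.
Qed.

End Existence.

(** * From lists of numbers to codes and subcodes *)

Section Codes.
Local Open Scope nat_scope.

Lemma ord_tuple n Q (s : seq nat) : size s = n -> all (fun x => x < Q) s ->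
  {x : n.-tuple 'I_Q | map val x = s}.
Proof.
move=> sn sQ.
have e : map val (pmap (insub : nat -> option 'I_Q) s) = s.
  rewrite (pmap_filter (insubK _)) -[RHS]filter_predT; apply: eq_in_filter => x xs.
  by rewrite /= insubT //; apply: (allP sQ).
have sz : size (pmap (insub : nat -> option 'I_Q) s) == n by rewrite -sn -{2}e size_map.
by exists (Tuple sz).
Qed.

Lemma letter_lt q0 d m u f r : 0 < q0 -> letter q0 d m u f r < q0 ^ d.
Proof.
move=> q0_gt0; rewrite /letter; case: (iota 0 d) => [|j t] /=; first by rewrite expn_gt0 q0_gt0.
by rewrite ltn_pmod // expn_gt0 q0_gt0.
Qed.

Lemma all_word q0 d m n u f : 0 < q0 -> all (fun x => x < q0 ^ d) (word q0 d m n u f).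
Proof. by move=> q0_gt0; rewrite all_map; apply/allP => r _ /=; apply: letter_lt. Qed.

Lemma size_word q0 d m n u f : size (word q0 d m n u f) = n.
Proof. by rewrite size_map size_iota. Qed.

Lemma count_agreements n Q (x y : n.-tuple 'I_Q) :
  count (fun r => nth 0 (map val x) r == nth 0 (map val y) r) (iota 0 n) =
  #|[set i | tnth x i == tnth y i]|.
Proof.
rewrite count_iota -sum1dep_card [RHS]big_mkcond; apply: eq_bigr => i _ /=.
rewrite -!(tnth_nth _ [tuple of map val _]) !tnth_map val_eqE.
by case: (_ == _).
Qed.

(* Greedy choice: each chosen element excludes at most [cap] others. *)
Lemma exists_separated (T : finType) (near : rel T) (cap N : nat) : 0 < cap -> symmetric near ->
  reflexive near -> (forall x, #|[set y | near x y]| <= cap) -> N * cap <= #|T| ->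
  exists2 S : {set T}, #|S| = N & {in S &, forall x y, near x y -> x = y}.
Proof.
move=> cap0 near_sym near_refl few; elim: N => [|N IH] hN.
  by exists (finset.set0); rewrite ?cards0 // => x y; rewrite inE.
have [S SN Sfar] := IH (leq_trans (leq_mul (leqnSn N) (leqnn cap)) hN).
have : #|\bigcup_(x in S) [set y | near x y]| < #|T|.
  apply: leq_trans hN; rewrite mulSn -[X in X < _]add0n -addSn leq_add // -SN -sum_nat_const.
  apply: (big_ind2 (fun (A : {set T}) n => #|A| <= n)) => [|A n A' n' hA hA'|x _].
  - by rewrite cards0.
  - by rewrite cardsU; apply: leq_trans (leq_subr _ _) (leq_add hA hA').
  - exact: few.
move=> small; have /subsetPn[y _ /finset.bigcupP far_y] :
    ~~ ([set: T] \subset \bigcup_(x in S) [set y | near x y])%SET.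
  by apply: contraL small => /subset_leq_card; rewrite cardsT -leqNgt.
have far x : x \in S -> near x y = false by move=> xS; apply/negP => xy; apply: far_y; exists x;
  rewrite ?inE.
exists (y |: S)%SET.
  by rewrite cardsU1 SN; case: (boolP (y \in S)) => // yS; have := far _ yS; rewrite near_refl.
move=> x x'; rewrite !inE => /orP[/eqP-> | xS] /orP[/eqP-> | x'S] //.
- by rewrite near_sym far.
- by rewrite far.
- exact: Sfar.
Qed.

End Codes.

Section ListDecodable.
Local Open Scope ring_scope.
Variable R : realType.

(* The agreement demanded by [decode_complete], cleared of denominators. *)
Lemma agreement_threshold (rho : R) (z d th beta k cnt : nat) : (0 < z)%N ->
  th%:R <= (rho + 9 / z%:R) * (d * beta)%:R -> (rho + 10 / z%:R) * (2 ^ k * beta)%:R <= cnt%:R ->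
  th%:R <= d%:R * cnt%:R / 2 ^+ k - (d * beta)%:R / z%:R :> rat.
Proof.
move=> z0 th_le agree; have zR : 0 < z%:R :> R by rewrite ltr0n.
have zQ : 0 < z%:R :> rat by rewrite ltr0n.
have key : (th * z * 2 ^ k + d * beta * 2 ^ k <= d * cnt * z)%N.
  rewrite -(ler_nat R) natrD; apply: (@le_trans _ _ (d%:R * ((rho + 10 / z%:R) * (2 ^ k *
    beta)%:R) * z%:R)).
    apply: (@le_trans _ _ ((rho + 9 / z%:R) * (d * beta)%:R * (z * 2 ^ k)%:R + (d * beta * 2 ^
      k)%:R)).
      by rewrite lerD2r -mulnA natrM ler_wpM2r.
    by rewrite le_eqVlt; apply/orP; left; apply/eqP; rewrite !natrM; field; rewrite gt_eqF.
  by rewrite !natrM ler_wpM2r // ler_wpM2l // -natrM.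
rewrite lerBrDr ler_pdivlMr ?exprn_gt0 // -(ler_pM2r zQ).
have -> : (th%:R + (d * beta)%:R / z%:R) * 2 ^+ k * z%:R = (th * z * 2 ^ k + d * beta * 2 ^ k)%:R
  :> rat.
  by rewrite natrD !natrM !natrX; field; rewrite gt_eqF.
by rewrite -!natrM ler_nat.
Qed.

Lemma list_decodable_code (z' b n0 : nat) (rho : R) :
  let z := (2 ^ z')%N in (3 < z)%N -> (0 < b)%N -> 0 < rho -> rho + 10 / z%:R <= 1 ->
  exists (n : nat) (T : finType) (enc : T -> n.-tuple 'I_(par_Q z)) (cap : nat),
  [/\ (b %| n)%N, (n0 <= n)%N, (0 < cap)%N,
      cap%:R * ((par_Q z)%:R `^ (rho * n%:R) + 1) <= #|T|%:R :> R &
      forall g : n.-tuple 'I_(par_Q z), exists2 L : {set T}, (#|L| <= cap)%N &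
      forall t, (rho + 10 / z%:R) * n%:R <= #|[set i | tnth g i == tnth (enc t) i]%SET|%:R ->
        t \in L /\ map val (enc t) \in
          decode (par_q0 z) (par_d z) z (par_m z) (par_m' z) (par_s z) (par_w z)
            (z + 13) (decoding_exponent z) (map val g)].
Proof.
move=> z z4 b0 rho0 rho1; have z0 : (0 < z)%N by apply: leq_trans z4.
have [p [P [k [beta [kappa [[q_prime P_prime k_div q_large kappa_ge] [beta_ge P1 P2]
  bounds [b_n n_ge th_le] many]]]]]] := exists_parameters n0 z4 b0 rho0 rho1.
set n := (2 ^ k * beta)%N in bounds b_n n_ge many.
have [u hu] := decode_complete z0 q_prime P_prime k_div q_large kappa_ge beta_ge P1 P2 bounds.
pose T := (degree_bound z k).-tuple 'I_p.+1.
pose msg (t : T) : seq nat := map val t.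
have wT t := ord_tuple (size_word (par_q0 z) (par_d z) (par_m z) n u (msg t))
  (all_word (par_d z) (par_m z) n u (msg t) (q0_gt0 z)).
exists n, T, (fun t => sval (wT t)), (p.+1 ^ par_s z)%N; split=> //.
- by rewrite expn_gt0.
- by rewrite card_tuple card_ord.
move=> g; have [|L sL hL] := hu (map val g); first by rewrite size_map size_tuple.
exists [set t | msg t \in L]%SET.
  apply: leq_trans sL; rewrite cardE -(size_map msg); apply: uniq_leq_size.
    rewrite map_inj_uniq ?enum_uniq // => t t' /(inj_map val_inj); exact: val_inj.
  by move=> y /mapP[t]; rewrite mem_enum inE => tL ->.
move=> t agree; rewrite inE (svalP (wT t)).
apply: hL.
- by rewrite size_map size_tuple.
- by rewrite all_map; apply/allP => i _ /=; apply: ltn_ord.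
rewrite -/n -(svalP (wT t)) count_agreements; move: agree; set cnt := #|_| => agree.
exact: agreement_threshold agree.
Qed.
End ListDecodable.

(** * Rate and distance *)

Section Rates.
Local Open Scope ring_scope.
Variable R : realType.

(** With [x] as in the proof, [delta] is [(1 - 1 / Q) * (1 - x)], and x <= sqrt x because x <= 1.
    For negative [x], where [Num.sqrt] is 0, this remains true. *)
Lemma johnson_le (Q : nat) (delta : R) : (1 < Q)%N -> 0 <= delta -> johnson Q delta <= delta.
Proof.
move=> Q1 delta0; have Q1R : 1 < Q%:R :> R by rewrite ltr1n.
have a0 : 0 < 1 - 1 / Q%:R :> R by rewrite subr_gt0 ltr_pdivrMr ?mul1r //; lra.
rewrite /johnson; set x := 1 - Q%:R * delta / _.
have xE : (1 - 1 / Q%:R) * (1 - x) = delta by rewrite /x; field; rewrite !gt_eqF //; lra.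
rewrite -[leRHS]xE ler_wpM2l ?(ltW a0) // lerD2l lerN2.
have x1 : x <= 1 by rewrite gerBl divr_ge0 ?mulr_ge0 ?ler0n // subr_ge0 ltW.
have [xneg|xpos] := leP x 0; first by apply: le_trans xneg (sqrtr_ge0 _).
by rewrite -[leLHS]gtr0_norm // -sqrtr_sqr ler_wsqrtr // expr2 ler_piMl // ltW.
Qed.

Lemma hammingC Q n (f g : n.-tuple 'I_Q) : hamming R f g = hamming R g f.
Proof. by congr (_%:R / _); apply: eq_card => i; rewrite !inE eq_sym. Qed.

Lemma hammingxx Q n (f : n.-tuple 'I_Q) : hamming R f f = 0.
Proof.
rewrite /hamming (_ : [set i | _]%SET = finset.set0) ?cards0 ?mul0r //.
by apply/setP => i; rewrite !inE eqxx.
Qed.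

Lemma agreement_hamming Q n (f g : n.-tuple 'I_Q) : (0 < n)%N ->
  #|[set i | tnth f i == tnth g i]%SET|%:R = (1 - hamming R f g) * n%:R.
Proof.
move=> n0; have nR : 0 < n%:R :> R by rewrite ltr0n.
rewrite /hamming mulrBl mul1r divfK ?gt_eqF // -[X in X%:R - _](card_ord n).
rewrite -(cardsC [set i | tnth f i == tnth g i]%SET) natrD.
rewrite (_ : ~: _ = [set i | tnth f i != tnth g i])%SET ?addrK //.
by apply/setP => i; rewrite !inE.
Qed.

Lemma distance_ge Q n (C : {set n.-tuple 'I_Q}) (delta : R) : delta <= 1 ->
  {in C &, forall f g, hamming R f g < delta -> f = g} -> delta <= distance R C.
Proof.
move=> delta1 far; rewrite /distance; elim/big_ind: _ => // [x y hx hy|[f g] /= /and3P[fC gC fg]].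
  by rewrite le_min hx.
by rewrite leNgt; apply: contraNN fg => /far -> //.
Qed.

(** Rounding up keeps the rate from falling below [rho]. *)
Definition code_size (Q n : nat) (rho : R) : nat := `|Num.ceil (Q%:R `^ (rho * n%:R))|%N.

Lemma code_sizeE Q n rho : (code_size Q n rho)%:R = (Num.ceil (Q%:R `^ (rho * n%:R)))%:~R :> R.
Proof.
by rewrite /code_size natr_absz ger0_norm // ceil_ge0 (lt_le_trans _ (powR_ge0 _ _)) // ltrN10.
Qed.

Lemma code_size_bounds Q n rho :
  Q%:R `^ (rho * n%:R) <= (code_size Q n rho)%:R < Q%:R `^ (rho * n%:R) + 1.
Proof.
rewrite code_sizeE; have := ceil_itv (Q%:R `^ (rho * n%:R)) => /andP[h ->] /=.
by move: h; rewrite intrB ltrBlDr.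
Qed.

(** The exponent [rho * n] is then a natural number. *)
Lemma code_size_rational Q n rho (r : rat) : (0 < Q)%N -> 0 < rho -> rho = ratr r ->
  (`|denq r| %| n)%N -> (code_size Q n rho)%:R = Q%:R `^ (rho * n%:R).
Proof.
move=> Q0 rho0 rE /dvdnP[c ->].
have num : rho * (c * `|denq r|)%:R = (`|numq r| * c)%:R.
  have d0 : (`|denq r|%N%:R : R) = (denq r)%:~R by rewrite natr_absz gtr0_norm // denq_gt0.
  have n0 : (`|numq r|%N%:R : R) = (numq r)%:~R.
    by rewrite natr_absz gtr0_norm // numq_gt0 -(ltr0q R) -rE.
  rewrite !natrM d0 n0 rE /ratr mulrCA mulfVK 1?mulrC //.
  by rewrite intr_eq0 denq_neq0.
by rewrite num powR_mulrn ?ler0n // code_sizeE num powR_mulrn ?ler0n // -natrX pmulrn intrKceil.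
Qed.

Lemma exists_code (z' b n0 : nat) (rho eps : R) :
  let z := (2 ^ z')%N in (3 < z)%N -> (0 < b)%N -> 0 < rho -> 10 / z%:R <= eps -> rho < 1 - eps ->
  exists (n : nat) (C : {set n.-tuple 'I_(par_Q z)}),
  [/\ (b %| n)%N, (n0 <= n)%N, #|C| = code_size (par_Q z) n rho,
      {in C &, forall f g, hamming R f g < 1 - rho - eps -> f = g} &
      forall f g, f \in C -> hamming R f g < 1 - rho - eps ->
        map val f \in decode (par_q0 z) (par_d z) z (par_m z) (par_m' z) (par_s z) (par_w z)
          (z + 13) (decoding_exponent z) (map val g)].
Proof.
move=> z z4 b0 rho0 z_eps rho1; set delta := 1 - rho - eps.
have delta0 : 0 < delta by rewrite /delta; lra.
have rho_le : rho + 10 / z%:R <= 1 by lra.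
have [n [T [enc [cap [b_n n_ge cap0 many dec]]]]] := list_decodable_code (maxn n0 1) z4 b0 rho0
  rho_le.
move: n_ge; rewrite geq_max => /andP[n0_n n_gt0].
have close g t : hamming R g (enc t) < delta ->
    (rho + 10 / z%:R) * n%:R <= #|[set i | tnth g i == tnth (enc t) i]%SET|%:R.
  move=> gt; rewrite agreement_hamming // ler_wpM2r // (@le_trans _ _ (1 - delta)) //.
    by rewrite /delta; lra.
  by rewrite lerD2l lerN2 ltW.
pose near x y := hamming R (enc x) (enc y) < delta.
(* The list bound is applied with a codeword as the received word. *)
have few x : (#|[set y | near x y]%SET| <= cap)%N.
  have [L sL hL] := dec (enc x); apply: leq_trans sL; apply/subset_leq_card/fintype.subsetP => y.
  by rewrite inE => /close/hL[].
have size_le : (code_size (par_Q z) n rho * cap <= #|T|)%N.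
  rewrite -(ler_nat R) natrM mulrC; apply: le_trans many; rewrite ler_wpM2l //.
  by have /andP[_ /ltW] := code_size_bounds (par_Q z) n rho.
have [||S cardS farS] := exists_separated cap0 _ _ few size_le.
- by move=> x y; rewrite /near hammingC.
- by move=> x; rewrite /near hammingxx.
exists n, (enc @: S)%SET; split=> //.
(* Messages with equal codewords are near each other, so [enc] is injective on the chosen ones. *)
- rewrite card_in_imset // => x y xS yS exy; apply: farS => //.
  by rewrite /near exy hammingxx.
- by move=> _ _ /imsetP[x xS ->] /imsetP[y yS ->] /farS->.
- move=> _ g /imsetP[t tS ->]; rewrite hammingC => /close gt.
  by have [L _ hL] := dec g; have [] := hL _ gt.
Qed.

(** The ceiling is below Q^(rho n) + 1 <= Q * Q^(rho n), and a factor Q in the size changes the rate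
    by 1 / n. *)
Lemma rate_bounds Q n (C : {set n.-tuple 'I_Q}) (rho : R) : (1 < Q)%N -> (0 < n)%N -> 0 <= rho ->
  #|C| = code_size Q n rho -> rho <= rate R C <= rho + n%:R^-1.
Proof.
move=> Q1 n0 rho0 CE; have nR : 0 < n%:R :> R by rewrite ltr0n.
have QR : 1 < Q%:R :> R by rewrite ltr1n.
have lnQ : 0 < ln Q%:R :> R by rewrite ln_gt0.
have /andP[h1 h2] := code_size_bounds Q n rho.
have x1 : 1 <= Q%:R `^ (rho * n%:R) :> R.
  by rewrite -[leLHS](powRr0 Q%:R) ler_powR ?(ltW QR) // mulr_ge0 // ltW.
have x0 : 0 < Q%:R `^ (rho * n%:R) :> R by apply: lt_le_trans x1.
have Q0 : 0 < Q%:R :> R by apply: lt_trans QR.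
have lnx y : ln (Q%:R `^ y) = y * ln Q%:R :> R by rewrite ln_powR.
rewrite /rate CE; apply/andP; split.
  rewrite ler_pdivlMr // ler_pdivlMr // -lnx ler_ln // posrE // (lt_le_trans x0) //.
rewrite ler_pdivrMr // ler_pdivrMr // mulrDl mulVf ?gt_eqF // -lnx.
rewrite ler_ln ?posrE ?powR_gt0 ?(lt_le_trans x0 h1) //.
rewrite powRD; last by rewrite (gt_eqF Q0) implybT.
rewrite powRr1 ?ler0n //; apply: le_trans (ltW h2) _.
have Q2 : 2 <= Q%:R :> R by rewrite (ler_nat R 2).
by move: x1 Q2; set x := _ `^ _ => x1 Q2; nra.
Qed.

Lemma rate_rational Q n (C : {set n.-tuple 'I_Q}) (rho : R) (r : rat) : (1 < Q)%N -> (0 < n)%N ->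
  0 < rho -> rho = ratr r -> (`|denq r| %| n)%N -> #|C| = code_size Q n rho -> rate R C = rho.
Proof.
move=> Q1 n0 rho0 rE den CE; have nR : 0 < n%:R :> R by rewrite ltr0n.
have QR : 1 < Q%:R :> R by rewrite ltr1n.
have lnQ : 0 < ln Q%:R :> R by rewrite ln_gt0.
rewrite /rate CE (code_size_rational _ rho0 rE den) 1?ltnW // ln_powR.
by field; rewrite !gt_eqF.
Qed.

End Rates.

(** * Size of the alphabet *)

Section AlphabetSize.
Local Open Scope ring_scope.
Variable R : realType.

Lemma exponent_arith (t a b L y : R) : 0 < t -> 0 < b -> a <= b -> 1 / 2 <= L ->
  y <= 16 * t * a -> 8 * y <= 256 * t * b * L.
Proof.
move=> t0 b0 ab hL hy.
have s1 : t * a <= t * b by rewrite ler_wpM2l // ltW.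
have s2 : t * b * (1 / 2) <= t * b * L by rewrite ler_wpM2l // ltW // mulr_gt0.
by lra.
Qed.

(** Some power of two satisfies 10 / eps < z <= 20 / eps; powers of two make [4 * z] divide [2 ^ k].
    The exponent of Q = 2^(8 z^4) is at most 128 * 10^4 / eps^4, and ln (1 / eps) >= 1 / 2 turns 128
    into 256. *)
Lemma exists_alphabet (eps : R) : 0 < eps < 1 / 2 ->
  exists z', let z := (2 ^ z')%N in
  [/\ (3 < z)%N, 10 / z%:R <= eps & (par_Q z)%:R <= 2 `^ (256 * 10 ^+ 4 * eps ^- 6 * ln (1 / eps))].
Proof.
move=> /andP[eps0 eps1].
have x0 : 0 <= 10 / eps by rewrite divr_ge0 // ltW.
have /andP[t1 t2] := truncn_itv x0; set t := Num.truncn _ in t1 t2.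
have x20 : 20 < 10 / eps by rewrite ltr_pdivlMr //; lra.
have t0 : (1 < t.+1)%N.
  by rewrite -(ltr_nat R); apply: lt_trans t2; lra.
have /andP[z1 z2] := up_log_bounds (isT : 1 < 2)%N t0; exists (up_log 2 t.+1).
set z' := up_log _ _ in z1 z2 *; move=> z.
have zge : 10 / eps < z%:R by apply: lt_le_trans t2 _; rewrite ler_nat.
have zle : z%:R <= 20 / eps.
  have z'0 : (0 < z')%N by move: zge; rewrite /z; case: (z') => //; rewrite expn0 => h; lra.
  rewrite /z -(prednK z'0) expnS natrM (_ : 20 / eps = 2 * (10 / eps)); last by field;
    rewrite gt_eqF.
  by rewrite ler_wpM2l // (le_trans _ t1) // ler_nat -ltnS.
have zR : 0 < z%:R :> R by apply: lt_trans zge; lra.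
split.
- by rewrite -(ltr_nat R); apply: lt_trans zge; lra.
- by rewrite ler_pdivrMr // mulrC -ler_pdivrMr // ltW.
have lnhalf : 1 / 2 <= ln (1 / eps).
  have : ln (1 + (eps - 1)) <= eps - 1 by apply: le_ln1Dx; lra.
  by rewrite addrC subrK [1 / eps]div1r lnV ?posrE //; lra.
rewrite /par_Q /par_q0 -expnM powR2_nat ler_powR ?ler1n // /par_d.
have -> : (z * (8 * z ^ 3))%:R = 8 * z%:R ^+ 4 :> R by rewrite !natrM natrX; ring.
have z4 : z%:R ^+ 4 <= (20 / eps) ^+ 4 by rewrite lerXn2r // nnegrE ltW // divr_gt0.
have e1 : (20 / eps) ^+ 4 = 16 * 10 ^+ 4 * eps^-1 ^+ 4.
  by rewrite (_ : 20 = 2 * 10 :> R) ?exprMn; ring.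
have e2 : eps^-1 ^+ 4 <= eps^-1 ^+ 6.
  by rewrite ler_weXn2l // invf_ge1 //; lra.
have e0 : 0 < eps^-1 ^+ 6 by rewrite exprn_gt0 // invr_gt0.
rewrite e1 in z4; rewrite -exprVn.
by apply: exponent_arith e0 e2 lnhalf z4; rewrite exprn_gt0.
Qed.

Lemma iter_choice (T : Type) (next : T -> T -> Prop) (x0 : T) : (forall x, exists y, next x y) ->
  exists f : nat -> T, f 0%N = x0 /\ forall i, next (f i) (f i.+1).
Proof.
move=> /choice[g hg]; exists (fun i => iter i g x0); split=> // i; apply: hg.
Qed.

End AlphabetSize.

(** * The family of codes and its decoder *)

Local Open Scope ring_scope.

Theorem theorem7p3 (R : realType) :
  exists2 A : R, 0 < A &
  forall eps1 : R, 0 < eps1 < 1 / 2 ->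
  exists2 B : R, 0 < B &
  forall eps2 : R, 0 < eps2 < 1 / 2 ->
  forall rho : R, 0 < rho < 1 - eps1 ->
  exists (Q : nat) (N : nat -> nat) (C : forall i, {set (N i).-tuple 'I_Q}),
    [/\ (1 < Q)%N /\ Q%:R <= 2 `^ (A * eps1 ^- 6 * ln (1 / eps1)),
        forall i j, (i < j)%N -> (N i < N j)%N,
        has_rate C rho,
        forall i, 1 - rho - eps1 <= distance R (C i)
      & exists M : machine Q,
          list_decodes M C (johnson Q (1 - rho - eps1) - eps2)
            (fun n => n%:R `^ (B / eps2 ^+ 4))].
Proof.
exists (256 * 10 ^+ 4); first by rewrite mulr_gt0 ?exprn_gt0.
move=> eps1 eps1_bounds; have [z' [z3 z_eps Q_le]] := exists_alphabet eps1_bounds.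
set z := (2 ^ z')%N in z3 z_eps Q_le; set Q := par_Q z in Q_le.
have z0 : (0 < z)%N by apply: leq_trans z3.
pose F := decode (par_q0 z) (par_d z) z (par_m z) (par_m' z) (par_s z) (par_w z)
  (z + 13) (decoding_exponent z).
have wordF g y : y \in F g -> size y = size g /\ {in y, forall a, (a < Q)%N}.
  move=> /flattenP[_ /mapP[u _ ->] /mapP[f _ ->]]; split; first exact: size_word.
  by apply/allP; apply: all_word; apply: q0_gt0.
have [M [c hM]] := machine_of_PT (PT_decode Q _ _ _ _ _ _ _ _ (q0_gt0 z)) wordF.
(* [c] comes from the machine and thus depends on [z] only; the successor makes the constant
   positive. *)
exists c.+1%:R; first by rewrite ltr0n.
move=> eps2 eps2_bounds rho /andP[rho0 rho1].
have Q1 : (1 < Q)%N.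
  rewrite /Q /par_Q /par_q0 -expnM -[X in (X < _)%N](expn0 2) ltn_exp2l //.
  by rewrite muln_gt0 z0 d_gt0.
(* Block lengths divisible by the denominator of a rational [rho] make the rate exact. *)
have [b b0 hb] : exists2 b : nat, (0 < b)%N & forall r : rat, rho = ratr r -> b = `|denq r|%N.
  have [[r rE]|irr] := pselect (exists r : rat, rho = ratr r).
    exists `|denq r|%N; first by rewrite absz_gt0 denq_neq0.
    by move=> r'; rewrite rE => /fmorph_inj->.
  by exists 1%N => // r rE; case: irr; exists r.
pose code := {n : nat & {set n.-tuple 'I_Q}}.
pose good (x : code) := [/\ (b %| tag x)%N, #|tagged x| = code_size Q (tag x) rho,
  {in tagged x &, forall f g, hamming R f g < 1 - rho - eps1 -> f = g} &
  forall f g, f \in tagged x -> hamming R f g < 1 - rho - eps1 -> map val f \in F (map val g)].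
have larger (n0 : nat) : exists x : code, good x /\ (n0 <= tag x)%N.
  have [n [C [h1 h2 h3 h4 h5]]] := exists_code n0 z3 b0 rho0 z_eps rho1.
  by exists (Tagged (fun n : nat => {set n.-tuple 'I_Q}) C).
(* Starting at length 2 gives [1 < N i], as the time bound of the machine requires. *)
have [x0 [good0 x0_ge]] := larger 2.
have [|x [x_0 x_next]] := @iter_choice {y : code | good y}
    (fun y y' => (tag (sval y) < tag (sval y'))%N) (exist _ x0 good0).
  by move=> [y gy]; have [y' [gy' h]] := larger (tag y).+1; exists (exist _ y' gy').
pose N i := tag (sval (x i)); pose C i : {set (N i).-tuple 'I_Q} := tagged (sval (x i)).
have N_incr : {homo N : i j / (i < j)%N} by apply: homo_ltn => //; apply: ltn_trans.
have N_ge i : (i.+1 < N i)%N.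
  elim: i => [|i IH]; first by rewrite /N x_0.
  exact: leq_ltn_trans IH (x_next i).
have N_gt0 i : (0 < N i)%N by apply: leq_ltn_trans (N_ge i).
have C_card i : #|C i| = code_size Q (N i) rho by have [] := svalP (x i).
have C_far i : {in C i &, forall f g, hamming R f g < 1 - rho - eps1 -> f = g}.
  by have [] := svalP (x i).
have C_dec i f g : f \in C i -> hamming R f g < 1 - rho - eps1 -> map val f \in F (map val g).
  by have [h1 h2 h3 h4] := svalP (x i); apply: h4.
have rates i := rate_bounds Q1 (N_gt0 i) (ltW rho0) (C_card i).
exists Q, N, C; split=> //.
- split=> [i||[r rE] i]; first by have /andP[] := rates i.
  (* The rates exceed [rho] by at most [1 / N i], and [harmonic i] is [1 / i.+1] with
     [i.+1 < N i]. *)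
  + apply: (@squeeze_cvgr _ _ _ _ (fun=> rho) (fun i => rho + harmonic i)).
    * apply: nearW => i; have /andP[-> h] := rates i; apply: le_trans h _.
      by rewrite lerD2l lef_pV2 ?posrE ?ltr0n // ler_nat ltnW.
    * exact: cvg_cst.
    * by rewrite -[X in (_ --> X)%classic]addr0; apply: cvgD; [exact: cvg_cst|exact: cvg_harmonic].
  + apply: (rate_rational Q1 (N_gt0 i) rho0 rE _ (C_card i)).
    by rewrite -(hb _ rE); have [] := svalP (x i).
- by move=> i; apply: distance_ge => //; case/andP: eps1_bounds => ? _; lra.
exists M => i g; have [|t [L [tL out LE]]] := hM (N i) g.
  by apply: leq_ltn_trans (N_ge i).
exists t, L; split=> //.
- have n1 : 1 <= (N i)%:R :> R by rewrite ler1n.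
  apply: (@le_trans _ _ ((N i)%:R ^+ c)); first by rewrite -natrX ler_nat.
  rewrite -[leLHS]powR_mulrn ?ler0n // ler_powR // ler_pdivlMr ?exprn_gt0 //;
    last by case/andP: eps2_bounds.
  apply: (@le_trans _ _ c%:R); last by rewrite ler_nat.
  by rewrite ler_piMr ?ler0n // exprn_ile1 //; case/andP: eps2_bounds => ? ?; lra.
- move=> f fC close; have [eps2_0 _] := andP eps2_bounds.
  have : map val f \in F (map val g).
    apply: C_dec fC _; apply: lt_trans close _; rewrite ltrBlDr.
    apply: le_lt_trans (johnson_le Q1 _) _; first by lra.
    by rewrite ltrDl.
  rewrite /F -LE => /mapP[y yL] /(inj_map val_inj)/val_inj ->.
  by [].
Qed.
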